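(* Consider the dual problem $$\min_{Z=(y,w,S)\in\mathbb{R}^e\times\mathbb{R}^d\times\mathbb{X}}\ \Psi(Z):=\delta_{\mathcal{Q}^*}(y)-\langle b,y\rangle+h^*(-w)+\theta^*(-S)\quad\text{s.t.}\quad\mathcal{A}^*y+\mathcal{F}^*w+S=C,$$ where $\theta$ is a spectral function, either $\theta=g\circ\sigma$ with $g$ proper closed convex and absolutely symmetric, or (with $\mathbb{X}=\mathbb{S}^n$) $\theta=g\circ\lambda$ with $g$ proper closed convex and symmetric. Let $\overline{Z}=(\bar y,\bar w,\overline{S})$ be an optimal solution of this problem with $\mathcal{M}_D(\overline{Z})\neq\emptyset$. Assume that: (a) $h^*$ is twice continuously differentiable on $\mathrm{dom}\,h^*$; (b) $g^*$ is $\mathcal{C}^2$-cone reducible at $\sigma(-\overline{S})$ (if $\theta=g\circ\sigma$), respectively at $\lambda(-\overline{S})$ (if $\theta=g\circ\lambda$); (c) the ''no-gap'' second order sufficient condition holds at $\overline{Z}$: for every $(H_y,H_w,H_S)\in\mathcal{C}_D(\overline{Z})\setminus\{0\}$, $$\sup_{\overline{X}\in\mathcal{M}_D(\overline{Z})}\Big\{\langle H_w,\nabla^2h^*(-\bar w)H_w\rangle-\psi^*_{(\overline{S},H_S)}(\overline{X})\Big\}>0,$$ where $\psi^*_{(\overline{S},H_S)}$ is the conjugate function of $\psi_{(\overline{S},H_S)}(\cdot):=(\theta^* )^{\downarrow\downarrow}_-(-\overline{S};-H_S,\cdot)$. Then $\overline{Z}$ is the unique optimal solution of the dual problem, and the quadratic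 growth condition holds at $\overline{Z}$: there exist constants $\delta_d>0$ and $\kappa_d>0$ such that $$\Psi(Z)\ge\Psi(\overline{Z})+\kappa_d\,\mathrm{dist}^2(Z,\Omega_D)\qquad\forall\,Z\in F_D\cap\mathbb{B}_{\delta_d}(\overline{Z}).$$
   Context: Setting. $\mathbb{X}$ is either $\mathbb{R}^{n\times m}$ ($n\le m$) or the space $\mathbb{S}^n$ of real symmetric $n\times n$ matrices, with the trace inner product and the induced norm. $C\in\mathbb{X}$, $b\in\mathbb{R}^e$; $\mathcal{F}:\mathbb{X}\to\mathbb{R}^d$ and $\mathcal{A}:\mathbb{X}\to\mathbb{R}^e$ are linear with adjoints $\mathcal{F}^*,\mathcal{A}^*$; $h:\mathbb{R}^d\to(-\infty,+\infty]$ is convex and continuously differentiable on $\mathrm{dom}\,h$, which is a nonempty open convex set; $\theta:\mathbb{X}\to(-\infty,+\infty]$ is proper closed convex; $\mathcal{Q}\subseteq\mathbb{R}^e$ is a convex polyhedral cone with dual cone $\mathcal{Q}^*=\{y\mid\langle y,z\rangle\ge0\ \forall z\in\mathcal{Q}\}$; $h^*,\theta^*,g^*$ are conjugate functions; $\delta_{\mathcal{Q}^*}$ is the indicator function of $\mathcal{Q}^*$. The displayed problem is the dual of the primal problem $\min_{X\in\mathbb{X}}\ h(\mathcal{F}X)+\langle C,X\rangle+\theta(X)$ s.t. $\mathcal{A}X\in b+\mathcal{Q}$. Standing assumption: the optimal solution sets $\Omega_P$ of the primal problem and $\Omega_D$ of the dual problem are nonempty. $F_D=\{Z=(y,w,S)\mid\mathcal{A}^*y+\mathcal{F}^*w+S=C,\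 y\in\mathcal{Q}^*\}$. $\mathbb{B}_\rho(u)$ is the closed ball of radius $\rho$ centered at $u$, and $\mathrm{dist}$ is the Euclidean distance to a set. Spectral functions. $\sigma(X)$ is the vector of singular values of $X\in\mathbb{X}$, and $\lambda(X)$ the vector of eigenvalues of $X\in\mathbb{S}^n$, in non-increasing order. $g:\mathbb{R}^n\to(-\infty,+\infty]$ is symmetric (resp. absolutely symmetric) if $g(Qx)=g(x)$ for all $x$ and all permutation (resp. signed permutation) matrices $Q$. Multipliers. $\mathcal{M}_D(\overline{Z})$ is the set of $\overline{X}\in\mathbb{X}$ such that $0\in\mathcal{A}\overline{X}-b+\mathcal{N}_{\mathcal{Q}^*}(\bar y)$, $0\in\mathcal{F}\overline{X}-\partial h^*(-\bar w)$, $0\in\overline{X}-\partial\theta^*(-\overline{S})$ and $C=\mathcal{A}^*\bar y+\mathcal{F}^*\bar w+\overline{S}$, where $\mathcal{N}_{\mathcal{Q}^*}$ is the normal cone of convex analysis. Directional epiderivatives. For a proper closed convex function $p:\mathbb{U}\to(-\infty,+\infty]$, $u\in\mathrm{dom}\,p$: $p^{\downarrow}(u;d)=\liminf_{t\downarrow0,\,d'\to d}\frac{p(u+td')-p(u)}{t}$, and, when $p^\downarrow(u;d)$ is finite, $p^{\downarrow\downarrow}_-(u;d,w)=\liminf_{t\downarrow0,\,w'\to w}\frac{p(u+td+\frac12t^2w')-p(u)-t\,p^{\downarrow}(u;d)}{\frac12t^2}$. Critical cone. With the tangent cone $\mathcal{T}_D(u)=\{d\mid\exists\,u^k\to u,\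 u^k\in D,\ t^k\downarrow0,\ (u^k-u)/t^k\to d\}$, $\mathcal{C}_D(\overline{Z})$ is the set of $(H_y,H_w,H_S)\in\mathbb{R}^e\times\mathbb{R}^d\times\mathbb{X}$ such that $\mathcal{A}^*H_y+\mathcal{F}^*H_w+H_S=0$, $H_y\in\mathcal{T}_{\mathcal{Q}^*}(\bar y)$, $-H_S\in\mathcal{T}_{\mathrm{dom}\,\theta^*}(-\overline{S})$ and $\langle-b,H_y\rangle-\langle\nabla h^*(-\bar w),H_w\rangle+(\theta^* )^{\downarrow}(-\overline{S};-H_S)=0$. $\mathcal{C}^2$-cone reducibility. A closed convex set $\mathcal{K}\subseteq\mathbb{V}$ is $\mathcal{C}^2$-cone reducible at $\bar v\in\mathcal{K}$ if there exist a Euclidean space $\mathbb{U}$, a pointed closed convex cone $\mathcal{R}\subseteq\mathbb{U}$ (i.e. $\mathcal{R}\cap(-\mathcal{R})=\{0\}$), an open neighborhood $\mathcal{W}$ of $\bar v$ and a twice continuously differentiable $\Xi:\mathcal{W}\to\mathbb{U}$ with $\Xi(\bar v)=0$, $\Xi'(\bar v)$ onto, and $\mathcal{K}\cap\mathcal{W}=\{v\in\mathcal{W}\mid\Xi(v)\in\mathcal{R}\}$. A proper closed convex function $p$ is $\mathcal{C}^2$-cone reducible at $u\in\mathrm{dom}\,p$ if $\mathrm{epi}\,p$ is $\mathcal{C}^2$-cone reducible at $(u,p(u))$. *)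

(* Defs.v *)
From HB Require Import structures.
From mathcomp Require Import all_boot all_order perm all_algebra.
From mathcomp Require Import complex.
From mathcomp Require Import all_classical all_reals all_analysis.

Set Implicit Arguments.
Unset Strict Implicit.
Unset Printing Implicit Defensive.
Import Order.TTheory GRing.Theory Num.Theory.
Import numFieldNormedType.Exports.

Local Open Scope classical_set_scope.
Local Open Scope ring_scope.

(* Finite-dimensional Euclidean spaces.  The norm `|x| inherited from
   MathComp-Analysis (the sup norm on matrices and on products) only provides
   the topology; every metric notion below uses [enorm]. *)
HB.mixin Record NormedModule_hasDot (R : realType) V & NormedModule R V := {
  dot : V -> V -> R ;
  dotC : forall x y, dot x y = dot y x ;
  dotDZl : forall a x y z, dot (a *: x + y) z = a * dot x z + dot y z ;
  dot_gt0 : forall x, x != 0 -> 0 < dot x x ;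
  dot_norm_equiv : exists2 c : R, 0 < c &
    forall x, `|x| ^+ 2 <= c * dot x x /\ dot x x <= c * `|x| ^+ 2
}.

#[short(type="euclidType")]
HB.structure Definition Euclid (R : realType) :=
  {V of NormedModule R V & Vector R V & NormedModule_hasDot R V}.

Section MatrixDot.
Context {R : realType} {m n : nat}.
Implicit Types A B : 'M[R]_(m, n).

Definition mxdot A B : R := \tr (A^T *m B).

Lemma mxdotE A B : mxdot A B = \sum_j \sum_i A i j * B i j.
Proof.
by apply: eq_bigr => j _; rewrite mxE; apply: eq_bigr => i _; rewrite mxE.
Qed.

Fact mxdotC A B : mxdot A B = mxdot B A.
Proof.
by rewrite !mxdotE; apply: eq_bigr => j _; apply: eq_bigr => i _; rewrite mulrC.
Qed.

Fact mxdotDZl a A B D : mxdot (a *: A + B) D = a * mxdot A D + mxdot B D.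
Proof. by rewrite /mxdot linearP /= mulmxDl -scalemxAl linearP. Qed.

Fact mxdot_entry A i j : A i j ^+ 2 <= mxdot A A.
Proof.
rewrite mxdotE (bigD1 j)//= (bigD1 i)//= -expr2 -addrA lerDl addr_ge0//.
  by apply: sumr_ge0 => k _; rewrite -expr2 sqr_ge0.
by apply: sumr_ge0 => k _; apply: sumr_ge0 => l _; rewrite -expr2 sqr_ge0.
Qed.

Fact mxdot_gt0 A : A != 0 -> 0 < mxdot A A.
Proof.
move=> A0; have [i [j Aij]] : exists i j, A i j != 0.
  apply/not_existsP => H; case/eqP: A0; apply/matrixP => i j; rewrite mxE.
  by apply/eqP; apply: contrapT => /negP Aij; apply: (H i); exists j.
by apply: lt_le_trans (mxdot_entry A i j); rewrite exprn_even_gt0.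
Qed.

Fact mxdot_norm_equiv : exists2 c : R, 0 < c &
  forall A, `|A| ^+ 2 <= c * mxdot A A /\ mxdot A A <= c * `|A| ^+ 2.
Proof.
exists ((n * m)%:R + 1); first by rewrite ltr_wpDl.
move=> A; split.
  have dA0 : 0 <= mxdot A A.
    have [->|/mxdot_gt0/ltW//] := eqVneq A 0.
    by rewrite mxdotE big1// => j _; rewrite big1// => i _; rewrite mxE mul0r.
  apply: (@le_trans _ _ (mxdot A A)); last first.
    by rewrite mulrDl mul1r lerDr mulr_ge0.
  have [A0|/mx_norm_neq0[[i j] Aij]] := eqVneq (mx_norm A) 0.
    by rewrite /Num.norm /= A0 expr0n.
  by rewrite /Num.norm /= Aij real_normK ?num_real//; exact: mxdot_entry.
rewrite mulrDl mul1r; apply: (@le_trans _ _ ((n * m)%:R * `|A| ^+ 2)); last first.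
  by rewrite lerDl sqr_ge0.
rewrite mxdotE natrM -mulrA.
have Aij i j : A i j * A i j <= `|A| ^+ 2.
  rewrite -expr2 -(real_normK (num_real (A i j))).
  rewrite lerXn2r ?nnegrE//.
  rewrite [leRHS]/Num.norm /= /mx_norm.
  rewrite -[leLHS]nngE num_le.
  by apply: (le_bigmax _ (fun k : 'I_m * 'I_n => `|A k.1 k.2|%:nng) (i, j)).
rewrite mulr_natl -[X in _ *+ X]card_ord -sumr_const; apply: ler_sum => j _.
rewrite mulr_natl -[X in _ *+ X]card_ord -sumr_const; apply: ler_sum => i _.
exact: Aij.
Qed.

HB.instance Definition _ := NormedModule_hasDot.Build R 'M[R]_(m, n)
  mxdotC mxdotDZl mxdot_gt0 mxdot_norm_equiv.

End MatrixDot.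

Section ProductDot.
Context {R : realType} {U V : euclidType R}.

Definition proddot (x y : U * V) : R := dot x.1 y.1 + dot x.2 y.2.

Fact proddotC x y : proddot x y = proddot y x.
Proof. by rewrite /proddot dotC [dot x.2 _]dotC. Qed.

Fact proddotDZl a x y z :
  proddot (a *: x + y) z = a * proddot x z + proddot y z.
Proof. by rewrite /proddot /= !dotDZl mulrDr addrACA. Qed.

Fact dot_ge0 (W : euclidType R) (x : W) : 0 <= dot x x.
Proof.
have [->|/dot_gt0/ltW//] := eqVneq x 0.
have /eqP := dotDZl 1 (0 : W) 0 0.
by rewrite scaler0 addr0 mul1r addrC -subr_eq subrr => /eqP <-.
Qed.

Fact proddot_gt0 x : x != 0 -> 0 < proddot x x.
Proof.
case: x => x y xy0; rewrite /proddot /=.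
have [x0|/dot_gt0 dx] := eqVneq x 0; last by rewrite ltr_wpDr// dot_ge0.
rewrite ltr_wpDl ?dot_ge0// dot_gt0//.
by apply: contra xy0 => /eqP y0; rewrite x0 y0.
Qed.

Fact proddot_norm_equiv : exists2 c : R, 0 < c &
  forall x : U * V, `|x| ^+ 2 <= c * proddot x x /\ proddot x x <= c * `|x| ^+ 2.
Proof.
have [c c0 Hc] := @dot_norm_equiv R U; have [d d0 Hd] := @dot_norm_equiv R V.
exists (c + d); first exact: addr_gt0.
move=> [x y]; rewrite /proddot /=.
have [x1 x2] := Hc x; have [y1 y2] := Hd y.
have dx := dot_ge0 x; have dy := dot_ge0 y.
have cdy := mulr_ge0 (ltW c0) dy; have ddx := mulr_ge0 (ltW d0) dx.
have Nxy : `|(x, y)| = Num.max `|x| `|y| by [].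
rewrite {}Nxy; split.
  rewrite mulrDl !mulrDr.
  case: (leP `|x| `|y|) => _.
    apply: (le_trans y1); rewrite addrA lerDr !addr_ge0// mulr_ge0// ltW//.
  by apply: (le_trans x1); rewrite -addrA lerDl !addr_ge0// mulr_ge0// ltW.
rewrite mulrDl; apply: lerD; [apply: (le_trans x2)|apply: (le_trans y2)];
  rewrite ler_pM2l// lerXn2r ?nnegrE// ?le_max ?normr_ge0 ?lexx ?orbT//.
Qed.

HB.instance Definition _ := NormedModule_hasDot.Build R (U * V)%type
  proddotC proddotDZl proddot_gt0 proddot_norm_equiv.

End ProductDot.

Section SymmetricMatrices.
Context {R : realType} {n : nat}.

Definition symmetric_mx : {pred 'M[R]_n} := fun A => A^T == A.

Fact symmetric_mx_submod : submod_closed symmetric_mx.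
Proof.
split; first by rewrite unfold_in trmx0.
by move=> a A B /eqP hA /eqP hB; rewrite unfold_in linearP /= hA hB.
Qed.

HB.instance Definition _ :=
  GRing.isSubmodClosed.Build R 'M[R]_n symmetric_mx symmetric_mx_submod.

Record symmx := SymMx { symval :> 'M[R]_n ; _ : symval \in symmetric_mx }.

HB.instance Definition _ := [isSub of symmx for symval].
HB.instance Definition _ := [Choice of symmx by <:].
HB.instance Definition _ := [SubChoice_isSubLmodule of symmx by <:].

Definition symmx_norm (A : symmx) : R := `|symval A|.

Fact symmx_normD A B : symmx_norm (A + B) <= symmx_norm A + symmx_norm B.
Proof. by rewrite /symmx_norm /= ler_normD. Qed.

Fact symmx_normZ a A : symmx_norm (a *: A) = `|a| * symmx_norm A.
Proof. by rewrite /symmx_norm /= normrZ. Qed.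

Fact symmx_norm0_eq0 A : symmx_norm A = 0 -> A = 0.
Proof. by move=> /normr0_eq0 A0; apply: val_inj. Qed.

HB.instance Definition _ :=
  Lmodule_isNormed.Build R symmx symmx_normD symmx_normZ symmx_norm0_eq0.

Import VectorInternalTheory.

Fact symmx_vect_iso :
  vector_axiom (\dim (lker (linfun (fun A : 'M[R]_n => A^T - A)))) symmx.
Proof.
set K := lker _.
have lin : linear (fun A : 'M[R]_n => A^T - A).
  by move=> a A B; rewrite linearP /= scalerBr opprD addrACA.
pose lfm := GRing.isLinear.Build R _ _ _ _ lin.
pose fL : {linear 'M[R]_n -> 'M[R]_n} := HB.pack (fun A : 'M[R]_n => A^T - A) lfm.
have KP A : (A \in K) = (A \in symmetric_mx).
  rewrite /K memv_ker (lfunE fL) /= subr_eq0; by rewrite [RHS]unfold_in.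
have KS (w : subvs_of K) : vsval w \in symmetric_mx by rewrite -KP subvsP.
exists (fun A : symmx => v2r (vsproj K (symval A))).
  move=> a A B /=.
  by rewrite !linearP.
exists (fun w => SymMx (KS (r2v w))).
  move=> A; apply: val_inj; rewrite /= v2rK vsprojK// KP; exact: valP.
by move=> w; rewrite /= vsvalK r2vK.
Qed.

HB.instance Definition _ := Lmodule_hasFinDim.Build R symmx symmx_vect_iso.

Definition symmx_dot (A B : symmx) : R := dot (symval A) (symval B).

Fact symmx_dotC A B : symmx_dot A B = symmx_dot B A.
Proof. exact: dotC. Qed.

Fact symmx_dotDZl a A B D :
  symmx_dot (a *: A + B) D = a * symmx_dot A D + symmx_dot B D.
Proof. exact: dotDZl. Qed.

Fact symmx_dot_gt0 A : A != 0 -> 0 < symmx_dot A A.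
Proof. by move=> A0; apply: dot_gt0; rewrite -(inj_eq val_inj) in A0. Qed.

Fact symmx_dot_norm_equiv : exists2 c : R, 0 < c & forall A : symmx,
  `|A| ^+ 2 <= c * symmx_dot A A /\ symmx_dot A A <= c * `|A| ^+ 2.
Proof.
by have [c c0 H] := @dot_norm_equiv R 'M[R]_n; exists c => // A; exact: H.
Qed.

HB.instance Definition _ := NormedModule_hasDot.Build R symmx
  symmx_dotC symmx_dotDZl symmx_dot_gt0 symmx_dot_norm_equiv.

End SymmetricMatrices.
Arguments symmx : clear implicits.

Section EuclidMetric.
Context {R : realType} {V : euclidType R}.

Definition enorm (x : V) : R := Num.sqrt (dot x x).

Definition dist_to (x : V) (D : set V) : R := inf [set enorm (x - u) | u in D].

Definition closed_enorm_ball (x : V) (r : R) : set V := [set u | enorm (u - x) <= r].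

End EuclidMetric.

Section ConvexAnalysis.
Context {R : realType} {V : euclidType R}.
Implicit Types (p : V -> \bar R) (D : set V) (u v : V).
Local Open Scope ereal_scope.

Definition effdom p : set V := [set u | p u < +oo].

Definition epi p : set (V * R^o)%type := [set z | p z.1 <= z.2%:E].

Definition proper_fun p := (forall u, p u != -oo) /\ effdom p !=set0.

Definition convex_fun p := convex_set (epi p).

Definition closed_fun p := closed (epi p).

Definition conjugate p v : \bar R := ereal_sup [set (dot u v)%:E - p u | u in setT].

Definition subdiff p u : set V :=
  [set v | forall z, p u + (dot v (z - u)%R)%:E <= p z].

Definition indicator D u : \bar R := if u \in D then 0 else +oo.

Definition normal_cone D u : set V :=
  [set v | D u /\ forall z, D z -> (dot v (z - u) <= 0)%R].

Definition dual_cone D : set V := [set v | forall z, D z -> (0 <= dot v z)%R].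

Definition tangent_cone D u : set V :=
  [set v | exists (u_ : nat -> V) (t_ : nat -> R),
    [/\ forall k, D (u_ k), u_ k @[k --> \oo] --> u,
        forall k, (0 < t_ k)%R, t_ k @[k --> \oo] --> (0 : R)%R
      & ((t_ k)^-1 *: (u_ k - u))%R @[k --> \oo] --> v]].

Definition epideriv p u v : \bar R :=
  limf_einf (fun z : R * V => (p (u + z.1 *: z.2)%R - p u) * (z.1^-1)%:E)
    (filter_prod 0^'+ (nbhs v)).

(* Meaningful only when [p u] and [epideriv p u v] are finite. *)
Definition epideriv2 p u v (w : V) : \bar R :=
  limf_einf (fun z : R * V =>
      (p (u + z.1 *: v + (z.1 ^+ 2 / 2) *: z.2)%R - p u
        - z.1%:E * epideriv p u v) * ((z.1 ^+ 2 / 2)^-1)%:E)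
    (filter_prod 0^'+ (nbhs w)).

Definition argmin D p : set V :=
  [set u | [/\ D u, p u < +oo & forall z, D z -> p u <= p z]].

End ConvexAnalysis.

Section Smoothness.
Context {R : realType}.

(* In finite dimension these are the usual classes: f is Frechet differentiable
   on the open set D and, for every v, x |-> f'(x) v is continuous (C1_on),
   respectively C1 (C2_on), on D. *)
Definition C1_on {V W : normedModType R} (D : set V) (f : V -> W) :=
  open D /\ forall x, D x ->
    differentiable f x /\ forall v, {for x, continuous ('D_v f)}.

Definition C2_on {V W : normedModType R} (D : set V) (f : V -> W) :=
  C1_on D f /\ forall v, C1_on D ('D_v f).

Definition grad {k : nat} (f : 'cV[R]_k -> R^o) (x : 'cV[R]_k) : 'cV[R]_k :=
  \col_i 'D_(delta_mx i 0) f x.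

Definition hess {k : nat} (f : 'cV[R]_k -> R^o) (x : 'cV[R]_k) : 'M[R]_k :=
  \matrix_(i, j) 'D_(delta_mx i 0) ('D_(delta_mx j 0) f) x.

Definition pointed_closed_convex_cone {U : euclidType R} (K : set U) :=
  [/\ closed K, convex_set K,
      forall (t : R) x, 0 <= t -> K x -> K (t *: x)
    & K `&` [set x | K (- x)] = [set 0]].

Definition cone_reducible {V : normedModType R} (K : set V) (v : V) :=
  exists (U : euclidType R) (C : set U) (W : set V) (Xi : V -> U),
    [/\ pointed_closed_convex_cone C, W v & C2_on W Xi] /\
    [/\ Xi v = 0, forall u, exists dv, 'd Xi v dv = u
      & K `&` W = W `&` [set x | C (Xi x)]].

Definition fun_cone_reducible {V : euclidType R} (p : V -> \bar R) (u : V) :=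
  effdom p u /\ cone_reducible (epi p) (u, fine (p u)).

End Smoothness.

Section Spectra.
Context {R : realType} {n : nat}.
Implicit Types A : 'M[R]_n.

Definition is_eigvals A (l : 'cV[R]_n) :=
  (forall i j : 'I_n, (i <= j)%N -> l j 0 <= l i 0) /\
  char_poly A = \prod_i ('X - (l i 0)%:P).

(* Arbitrary when the characteristic polynomial of A does not split over R;
   [eigvalsP] settles the symmetric case, the only one used. *)
Definition eigvals A : 'cV[R]_n := xget 0 (is_eigvals A).

Definition singvals {m : nat} (B : 'M[R]_(n, m)) : 'cV[R]_n :=
  map_mx Num.sqrt (eigvals (B *m B^T)).

Definition perm_symmetric (g : 'cV[R]_n -> \bar R) :=
  forall (s : 'S_n) x, g (perm_mx s *m x) = g x.

Definition abs_symmetric (g : 'cV[R]_n -> \bar R) :=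
  forall (s : 'S_n) (eps : 'rV[R]_n), (forall j, eps 0 j = 1 \/ eps 0 j = -1) ->
    forall x, g (diag_mx eps *m perm_mx s *m x) = g x.

(* The matrix spaces allowed, each with its spectral map and the symmetry
   required of g. *)
Inductive spectral_setting : forall X : euclidType R,
    (X -> 'cV[R]_n) -> (('cV[R]_n -> \bar R) -> Prop) -> Prop :=
| RectSingular m of (n <= m)%N :
    @spectral_setting 'M[R]_(n, m) (fun B => singvals B) abs_symmetric
| SymSingular :
    @spectral_setting (symmx R n) (fun B => singvals (symval B)) abs_symmetric
| SymEigen :
    @spectral_setting (symmx R n) (fun B => eigvals (symval B)) perm_symmetric.

End Spectra.

Fact char_poly_conj (K : fieldType) n (P D : 'M[K]_n) : P \in unitmx ->
  char_poly (invmx P *m D *m P) = char_poly D.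
Proof.
move=> PU; pose P1 := map_mx polyC (invmx P); pose P2 := map_mx polyC P.
have P12 : P1 *m P2 = 1%:M by rewrite -map_mxM mulVmx// map_mx1.
have -> : char_poly (invmx P *m D *m P) = \det (P1 *m char_poly_mx D *m P2).
  congr (\det _); rewrite /char_poly_mx !map_mxM mulmxBr mulmxBl.
  by rewrite scalar_mxC -[X in _ = X - _]mulmxA P12 mulmx1.
by rewrite !det_mulmx mulrAC -det_mulmx P12 det1 mul1r.
Qed.

Lemma eigvalsP (R : realType) (n : nat) (A : 'M[R]_n) :
  A \in symmetric_mx -> is_eigvals A (eigvals A).
Proof.
move=> /eqP symA; pose toC := real_complex R.
pose AC : 'M[R[i]]_n := map_mx toC A.
have hA : AC \is hermsymmx.
  apply/is_hermitianmxP; rewrite expr0 scale1r ; apply/matrixP => i j.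
  rewrite !mxE -[in LHS]symA mxE; symmetry; apply: CrealP.
  by apply/complex_realP; exists (A j i).
have := hermitian_spectral_diag_real hA; set sp := spectral_diag AC => sp_real.
have spE : AC = _ := orthomx_spectralP (hermitian_normalmx hA).
have [l lE] : {l : 'I_n -> R & forall i, sp 0 i = toC (l i)}.
  apply: (@choice _ _ (fun i x => sp 0 i = toC x)) => i.
  by apply/complex_realP; move/mxOverP : sp_real; exact.
have cpA : char_poly A = \prod_i ('X - (l i)%:P).
  apply: (map_poly_inj toC); rewrite map_char_poly -/AC.
  have PU := spectral_unit AC.
  have -> : char_poly AC = char_poly (diag_mx sp).
    by rewrite {1}spE char_poly_conj.
  rewrite char_poly_trig ?diag_mx_is_trig// rmorph_prod /=; apply: eq_bigr => i _.
  by rewrite rmorphB /= map_polyX map_polyC !mxE eqxx mulr1n lE.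
pose s := sort >=%O [seq l i | i <- enum 'I_n].
have ss : size s = n by rewrite size_sort size_map size_enum_ord.
apply: (xgetPex 0); exists (\col_i s`_i); split.
  move=> i j ij; rewrite !mxE.
  have so : sorted >=%O s by apply: sort_sorted => x y; exact: le_total.
  apply: (sorted_leq_nth (@ge_trans _ _) (@lexx _ _) 0 so) => //; rewrite inE ss//.
rewrite cpA.
transitivity (\prod_(x <- s) ('X - x%:P)).
  rewrite (perm_big [seq l i | i <- enum 'I_n]) ?perm_sort//=.
  by rewrite big_map big_enum.
rewrite (big_nth 0) ss big_mkord; apply: eq_bigr => i _.
by rewrite mxE.
Qed.

Section Problem.
Context {R : realType} {e d : nat} {X : euclidType R}.
Variables (C : X) (b : 'cV[R]_e).
Variables (F : X -> 'cV[R]_d) (Fadj : 'cV[R]_d -> X).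
Variables (A : X -> 'cV[R]_e) (Aadj : 'cV[R]_e -> X).
Variables (h : 'cV[R]_d -> \bar R) (theta : X -> \bar R) (Q : set 'cV[R]_e).
Local Open Scope ereal_scope.

Definition primal_feasible : set X := [set x | Q (A x - b)%R].

Definition primal_obj (x : X) : \bar R := h (F x) + (dot C x)%:E + theta x.

Definition primal_solutions : set X := argmin primal_feasible primal_obj.

Definition dual_constraint : set ('cV[R]_e * 'cV[R]_d * X)%type :=
  [set Z | (Aadj Z.1.1 + Fadj Z.1.2 + Z.2)%R = C].

Definition dual_obj (Z : 'cV[R]_e * 'cV[R]_d * X) : \bar R :=
  indicator (dual_cone Q) Z.1.1 - (dot b Z.1.1)%:E
  + conjugate h (- Z.1.2)%R + conjugate theta (- Z.2)%R.

Definition dual_solutions : set ('cV[R]_e * 'cV[R]_d * X)%type :=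
  argmin dual_constraint dual_obj.

Definition dual_feasible : set ('cV[R]_e * 'cV[R]_d * X)%type :=
  [set Z | dual_constraint Z /\ dual_cone Q Z.1.1].

Definition multipliers (Z : 'cV[R]_e * 'cV[R]_d * X) : set X :=
  [set x | [/\ normal_cone (dual_cone Q) Z.1.1 (b - A x)%R,
               subdiff (conjugate h) (- Z.1.2)%R (F x),
               subdiff (conjugate theta) (- Z.2)%R x
             & dual_constraint Z]].

Definition critical_cone (Z : 'cV[R]_e * 'cV[R]_d * X) :
    set ('cV[R]_e * 'cV[R]_d * X)%type :=
  [set H | [/\ (Aadj H.1.1 + Fadj H.1.2 + H.2)%R = 0%R,
    tangent_cone (dual_cone Q) Z.1.1 H.1.1,
    tangent_cone (effdom (conjugate theta)) (- Z.2)%R (- H.2)%R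
  & (dot (- b)%R H.1.1)%:E
    - (dot (grad (fine \o conjugate h) (- Z.1.2)%R) H.1.2)%:E
    + epideriv (conjugate theta) (- Z.2)%R (- H.2)%R = 0]].

Definition no_gap_sosc (Z : 'cV[R]_e * 'cV[R]_d * X) :=
  forall H, critical_cone Z H -> H != 0%R ->
  0 < ereal_sup
    [set (dot H.1.2 (hess (fine \o conjugate h) (- Z.1.2)%R *m H.1.2)%R)%:E
         - conjugate (epideriv2 (conjugate theta) (- Z.2)%R (- H.2)%R) x
    | x in multipliers Z].

End Problem.

Definition is_adjoint {R : realType} {U V : euclidType R}
  (f : U -> V) (fadj : V -> U) := forall u v, dot (f u) v = dot u (fadj v).

Definition polyhedral_cone {R : realType} {e : nat} (Q : set 'cV[R]_e) :=
  exists (k : nat) (B : 'M[R]_(k, e)),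
    Q = [set z | forall i, 0 <= (B *m z) i 0].

(* Main.v *)
Require Import Defs.
From HB Require Import structures.
From mathcomp Require Import all_boot all_order perm all_algebra.
From mathcomp Require Import all_classical all_reals all_analysis.
From mathcomp Require Import ring lra.

Set Implicit Arguments.
Unset Strict Implicit.
Unset Printing Implicit Defensive.
Import Order.TTheory GRing.Theory Num.Theory.
Import numFieldNormedType.Exports.

Local Open Scope classical_set_scope.
Local Open Scope ring_scope.

(** Suppose that quadratic growth fails.  Then feasible points
    [Z_ k = Zbar + t k *: H_ k] with unit directions [H_ k] and [t k --> 0] have
    objective values below [Psi Zbar + o(t k ^+ 2)], and along an ultrafilter
    the directions converge to some [H != 0].  For a multiplier [x] the
    difference [Psi (Z_ k) - Psi Zbar] is the sum of three nonnegative gaps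
    ([kkt_gaps]): a complementarity term, the gap in the subgradient inequality
    for the conjugate of [h], and the gap in the subgradient inequality for the
    conjugate of [theta].  Hence each gap is [o(t k ^+ 2)]; at first order this
    says that [H] is a critical direction ([limit_critical]).  The second-order
    condition then supplies a multiplier [x] with
    [<H_w, hess H_w> > psi^*(x)].  The gap of [h] is at least
    [t k ^+ 2 / 2 * (<H_w, hess H_w> - o(1))] by Taylor's formula
    ([C2_taylor]), so the gap of [theta] is at most the opposite of that.

    To contradict this, the points [- (Z_ k).2], which are only known to approach
    [- Sbar] in a direction converging to that of [- H.2], have to be compared
    with points [- Sbar - t k *: H.2 + (t k ^+ 2 / 2) *: w_ k] with [w_ k]
    convergent, those that enter the second epiderivative.  This comparison is
    [outer_regular]: the replacement points have an objective value, linearised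
    by the multiplier, larger by [o(t k ^+ 2)] at most.  Their limit [w] shows
    that [psi w <= <x, w> - <H_w, hess H_w>], that is, [psi^*(x)] is at least
    [<H_w, hess H_w>]: a contradiction.

    Outer regularity of the conjugate of [theta] is the core of the proof.  The
    conjugate of [g \o spec] is the spectral function of the conjugate of [g]
    ([conjugate_spectral]).  The conjugate of [g] is cone reducible, and this
    gives the analogous regularity of its epigraph ([cone_reducible_regular]):
    in the reducing coordinates one moves to the ray [t *: 'd Xi v d] of the
    cone, on which the normal functional vanishes, and one lifts that ray by a
    quantitative implicit function argument ([submersion_curve]).  Passing from
    [g] to the matrices ([spectral_outer_regular]) uses only what eigenvalues
    and singular values have in common, isolated in [spectral_system]: an
    isometry group preserving the spectrum, Fan's or von Neumann's trace
    inequality, the polyhedral cone of ordered spectra, and a first-order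
    description of the perturbed eigenvectors.  In Fan's inequality, equality
    forces a common ordered frame ([fan_equality]); this makes [x], the base
    point and the direction of the spectra diagonal at once, and the regular
    curve of spectra is transported by rotations that follow the perturbed
    points up to [O(t ^+ 2)].  The two instances are [rect_system] and
    [sym_system].

    Uniqueness follows from local growth since the objective is convex: a second
    solution would make the objective constant on the segment to [Zbar].

    Limits are taken along an ultrafilter on [nat] so that every bounded sequence
    converges and no subsequence has to be extracted. *)

(** * Euclidean spaces and limits along filters *)

Section DotTheory.
Context {R : realType} {V : euclidType R}.
Implicit Types (x y z : V) (a : R).

Lemma dot0l x : dot 0 x = 0.
Proof.
have := dotDZl 1 0 0 x; rewrite scaler0 addr0 mul1r => /eqP.
by rewrite addrC -subr_eq subrr => /eqP <-.
Qed.

Lemma dot0r x : dot x 0 = 0. Proof. by rewrite dotC dot0l. Qed.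

Lemma dotDl x y z : dot (x + y) z = dot x z + dot y z.
Proof. by rewrite -[x in LHS]scale1r dotDZl mul1r. Qed.

Lemma dotZl a x z : dot (a *: x) z = a * dot x z.
Proof. by rewrite -[a *: x]addr0 dotDZl dot0l addr0. Qed.

Lemma dotDr x y z : dot z (x + y) = dot z x + dot z y.
Proof. by rewrite dotC dotDl !(dotC z). Qed.

Lemma dotZr a x z : dot z (a *: x) = a * dot z x.
Proof. by rewrite dotC dotZl (dotC z). Qed.

Lemma dotNl x z : dot (- x) z = - dot x z.
Proof. by rewrite -scaleN1r dotZl mulN1r. Qed.

Lemma dotNr x z : dot z (- x) = - dot z x.
Proof. by rewrite dotC dotNl (dotC z). Qed.

Lemma dotBl x y z : dot (x - y) z = dot x z - dot y z.
Proof. by rewrite dotDl dotNl. Qed.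

Lemma dotBr x y z : dot z (x - y) = dot z x - dot z y.
Proof. by rewrite dotDr dotNr. Qed.

Lemma dot_eq0 x : dot x x = 0 -> x = 0.
Proof.
by move=> xx0; apply/eqP; apply: contraT => /dot_gt0; rewrite xx0 ltxx.
Qed.

Lemma dot_inj x y : (forall z, dot z x = dot z y) -> x = y.
Proof.
move=> xy; apply/eqP; rewrite -subr_eq0; apply/eqP; apply: dot_eq0.
by rewrite dotBr xy subrr.
Qed.

Lemma dot_Cauchy x y : dot x y ^+ 2 <= dot x x * dot y y.
Proof.
have [->|x0] := eqVneq x 0; first by rewrite !dot0l mul0r expr0n.
have xx := dot_gt0 _ x0.
have := dot_ge0 (dot x x *: y - dot x y *: x).
rewrite dotBl !dotBr !dotZl !dotZr (dotC y x) => H.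
have {}H : 0 <= dot x x * (dot x x * dot y y - dot x y ^+ 2).
  by apply: le_trans H _; rewrite le_eqVlt; apply/orP; left; apply/eqP; ring.
by move: H; rewrite pmulr_rge0// subr_ge0.
Qed.

Lemma dot_bound : exists2 c : R, 0 < c & forall x y, `|dot x y| <= c * (`|x| * `|y|).
Proof.
have [c c0 H] := @dot_norm_equiv R V; exists c => // x y.
rewrite -(@ler_pXn2r _ 2)// ?nnegrE ?mulr_ge0// ?(ltW c0)//.
rewrite real_normK ?num_real//; apply: le_trans (dot_Cauchy x y) _.
have [_ hx] := H x; have [_ hy] := H y.
have -> : (c * (`|x| * `|y|)) ^+ 2 = (c * `|x| ^+ 2) * (c * `|y| ^+ 2) by ring.
by apply: ler_pM => //; exact: dot_ge0.
Qed.

Lemma norm_dot_bound : exists2 c : R, 0 < c & forall x, `|x| ^+ 2 <= c * dot x x.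
Proof. by have [c c0 H] := @dot_norm_equiv R V; exists c => // x; case: (H x). Qed.

Lemma enorm_sqr x : enorm x ^+ 2 = dot x x.
Proof. by rewrite sqr_sqrtr// dot_ge0. Qed.

Lemma enorm_gt0 x : x != 0 -> 0 < enorm x.
Proof. by move=> x0; rewrite sqrtr_gt0 dot_gt0. Qed.

Lemma enormZ a x : enorm (a *: x) = `|a| * enorm x.
Proof.
rewrite /enorm dotZl dotZr mulrA -expr2 sqrtrM ?sqr_ge0//.
by rewrite sqrtr_sqr.
Qed.

End DotTheory.

Lemma cvg_dot (R : realType) (V : euclidType R) T (F : set_system T) {FF : Filter F}
  (f g : T -> V) (a b : V) :
  f @ F --> a -> g @ F --> b -> (fun k => dot (f k) (g k)) @ F --> dot a b.
Proof.
move=> fa gb; have [c c0 H] := @dot_bound R V.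
rewrite -(subr_cvg0 (F := F)).
have : (fun k => c * (`|f k - a| * `|g k|) + c * (`|a| * `|g k - b|)) @ F
    --> c * (0 * `|b|) + c * (`|a| * 0).
  apply: cvgD; apply: cvgMr; apply: cvgM.
  - by apply/norm_cvg0P/subr_cvg0.
  - exact: cvg_norm.
  - exact: cvg_cst.
  - by apply/norm_cvg0P/subr_cvg0.
rewrite mul0r !mulr0 addr0 => L.
apply/norm_cvg0P; apply: (squeeze_cvgr _ _ L); last exact: cvg_cst.
apply: nearW => k; rewrite normr_ge0/=.
have -> : (dot (f k) (g k) - dot a b) = dot (f k - a) (g k) + dot a (g k - b).
  by rewrite dotBl dotBr addrA subrK.
by apply: le_trans (ler_normD _ _) _; apply: lerD; exact: H.
Qed.

Lemma fmap_ultra T T' (f : T -> T') (F : set_system T) :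
  UltraFilter F -> UltraFilter (f @ F).
Proof.
move=> FU; split=> [|G GP sFG]; first exact: fmap_proper_filter.
apply/seteqP; split=> [A GA|A]; last exact: sFG.
case: (in_ultra_setVsetC (f @^-1` A) FU) => // FnA.
have GnA : G (~` A) by exact: sFG.
by have := filter_ex (filterI GA GnA) => -[x []].
Qed.

Lemma cvg_le_norm (R : realType) (V : normedModType R) T (F : set_system T)
  {FF : Filter F} (u : T -> V) (a : V) (r : T -> R) :
  (\forall k \near F, `|u k - a| <= r k) -> r @ F --> 0 -> u @ F --> a.
Proof.
move=> ur r0; apply/subr_cvg0; apply/norm_cvg0P.
apply: (squeeze_cvgr _ (cvg_cst 0) r0).
by apply: filterS ur => k ->; rewrite normr_ge0.
Qed.

Lemma cvg_sum_finite (R : realType) (V : normedModType R) T (F : set_system T)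
  {FF : Filter F} I (r : seq I) (f : I -> T -> V) (l : I -> V) :
  (forall i, f i @ F --> l i) ->
  (fun x => \sum_(i <- r) f i x) @ F --> \sum_(i <- r) l i.
Proof.
move=> fl; elim: r => [|i r IH].
  under eq_fun do rewrite big_nil; rewrite big_nil; exact: cvg_cst.
under eq_fun do rewrite big_cons; rewrite big_cons; exact: cvgD.
Qed.

(** The coordinates in a basis are bounded by the norm because the norm of a
    linear combination, which is continuous in the coefficients and vanishes
    at no point of the unit sphere, has a positive minimum there. *)
Lemma coord_bounded (R : realType) (V : euclidType R) :
  exists2 c : R, 0 < c &
    forall (x : V) i, `|coord (vbasis {:V}) i x| <= c * `|x|.
Proof.
set N := \dim {:V}; set e := vbasis {:V}.
pose comb (a : 'rV[R]_N) := \sum_i a 0 i *: e`_i.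
have [N0|N0] := posnP N.
  exists 1 => // x i; exfalso.
  by move: (leq_ltn_trans (leq0n i) (ltn_ord i)); rewrite -/N N0.
pose f (a : 'rV[R]_N) : R := `|comb a|.
have cf : continuous f.
  move=> a; apply: (@cvg_norm _ _ _ (nbhs a)).
  apply: (@cvg_sum_finite _ _ _ (nbhs a)) => i; apply: (@cvgZr_tmp _ _ _ (nbhs a)).
  exact: (@coord_continuous R 1 N 0 i a).
pose S := [set a : 'rV[R]_N | `|a| = 1].
have cS : compact S.
  apply: bounded_closed_compact.
    by exists 1; split; [exact: num_real|move=> M M1 a /= ->; exact: ltW].
  apply: (@closed_comp _ _ (fun a : 'rV[R]_N => `|a|) [set 1]); last exact: closed_eq.
  by move=> a _; exact: norm_continuous.
have i0 : 'I_N by exact: (Ordinal N0).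
have n1 : `|const_mx 1 : 'rV[R]_N| = 1 :> R.
  apply/le_anti/andP; split.
    rewrite [leLHS]/Num.norm/= mx_normrE; apply: bigmax_le => // i _.
    by rewrite mxE normr1.
  rewrite [leRHS]/Num.norm/= mx_normrE; apply/bigmax_geP; right.
  by exists (0, i0) => //=; rewrite mxE normr1.
have S0 : S !=set0 by exists (const_mx 1).
have [a aS amin] := compact_EVT_min S0 cS (continuous_subspaceT cf).
have fa : 0 < f a.
  rewrite normr_gt0; apply/eqP => a0.
  have /freeP := basis_free (vbasisP {:V}); move=> /(_ _ a0) az.
  have a00 : a = 0 by apply/rowP => i; rewrite mxE az.
  by move: aS; rewrite inE /S /= a00 normr0 => /eqP; rewrite eq_sym oner_eq0.
have fZ t b : 0 <= t -> f (t *: b) = t * f b.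
  move=> t0; rewrite /f -[X in X * _]ger0_norm// -normrZ /comb scaler_sumr.
  by congr `| _ |; apply: eq_bigr => i _; rewrite mxE scalerA.
exists (f a)^-1; first by rewrite invr_gt0.
move=> x i; rewrite ler_pdivlMl//.
pose b := \row_i coord e i x.
have bx : comb b = x.
  rewrite [RHS](coord_vbasis (memvf x)); apply: eq_bigr => j _; by rewrite mxE.
have bi : `|coord e i x| <= `|b|.
  rewrite [leRHS]/Num.norm/= mx_normrE; apply/bigmax_geP; right.
  by exists (0, i) => //=; rewrite mxE.
apply: le_trans (ler_wpM2l (ltW fa) bi) _.
have [b0|b0] := eqVneq `|b| 0; first by rewrite b0 mulr0.
have bgt : 0 < `|b| by rewrite lt_neqAle eq_sym b0 normr_ge0.
have : f a <= f (`|b|^-1 *: b).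
  by apply: amin; rewrite inE /S/= normrZ normfV normr_id mulVf.
rewrite fZ ?invr_ge0// ler_pdivlMl// mulrC => H.
by apply: le_trans H _; rewrite /f bx.
Qed.

Lemma ultra_cvg_bounded (R : realType) (V : euclidType R) T (F : set_system T)
  (f : T -> V) (M : R) : UltraFilter F -> (\forall k \near F, `|f k| <= M) ->
  exists p : V, f @ F --> p.
Proof.
move=> FU fM; have [c c0 H] := @coord_bounded R V.
set e := vbasis {:V}.
have ci i : exists p : R, (fun k => coord e i (f k)) @ F --> p.
  have cM : compact `[- (c * M), c * M]%classic by exact: segment_compact.
  have := cM; rewrite compact_ultra => /(_ _ (fmap_ultra (fun k => coord e i (f k)) FU)).
  case=> [|p [_ pf]]; last by exists p.
  apply: filterS fM => k fk /=; rewrite in_itv/= -ler_norml.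
  by apply: le_trans (H _ _) _; rewrite ler_pM2l.
have [p pP] := choice ci.
exists (\sum_i p i *: e`_i).
rewrite (_ : f = fun k => \sum_i coord e i (f k) *: e`_i); last first.
  by apply/funext => k; exact: (coord_vbasis (memvf _)).
by apply: cvg_sum_finite => i; apply: cvgZr_tmp; exact: pP.
Qed.

Lemma linear_bounded_euclid (R : realType) (V : euclidType R) (W : normedModType R)
  (f : {linear V -> W}) : exists2 c : R, 0 < c & forall x, `|f x| <= c * `|x|.
Proof.
have [c c0 H] := @coord_bounded R V; set e := vbasis {:V}.
pose s := \sum_(i < \dim {:V}) `|f e`_i|.
have s0 : 0 <= s by apply: sumr_ge0.
exists (c * (s + 1)); first by rewrite mulr_gt0// ltr_wpDl.
move=> x; rewrite [x in f x](coord_vbasis (memvf x)) linear_sum.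
apply: le_trans (ler_norm_sum _ _ _) _.
apply: (@le_trans _ _ (\sum_(i < \dim {:V}) (c * `|x|) * `|f e`_i|)).
  apply: ler_sum => i _; rewrite linearZ normrZ; apply: ler_wpM2r => //.
rewrite -mulr_sumr -/s mulrAC; apply: ler_wpM2r => //.
by rewrite mulrDr mulr1 lerDl ltW.
Qed.

Lemma linear_cvg (R : realType) (V : euclidType R) (W : normedModType R)
  (f : {linear V -> W}) T (F : set_system T) {FF : Filter F} (u : T -> V) (a : V) :
  u @ F --> a -> (fun k => f (u k)) @ F --> f a.
Proof.
move=> ua; have [c c0 H] := linear_bounded_euclid f.
apply: (@cvg_le_norm _ _ _ _ _ _ _ (fun k => c * `|u k - a|)).
  by apply: nearW => k; rewrite -linearB.
by rewrite -[X in _ --> X](mulr0 c); apply: cvgMl_tmp; apply/norm_cvg0P/subr_cvg0.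
Qed.

(** * Smooth maps and second-order regularity of cone-reducible sets *)

(** The scalars as a Euclidean space, so that epigraphs live in the Euclidean
    space [V * R^o]. *)
Section RealDot.
Variable R : realType.
Implicit Types x y z : R^o.

Definition rdot x y : R := x * y.

Fact rdotC x y : rdot x y = rdot y x. Proof. exact: mulrC. Qed.

Fact rdotDZl (a : R) x y z : rdot (a *: x + y) z = a * rdot x z + rdot y z.
Proof. by rewrite /rdot mulrDl -mulrA. Qed.

Fact rdot_gt0 x : x != 0 -> 0 < rdot x x.
Proof. by move=> x0; rewrite /rdot -expr2 exprn_even_gt0. Qed.

Fact rdot_norm_equiv : exists2 c : R, 0 < c &
  forall x, `|x| ^+ 2 <= c * rdot x x /\ rdot x x <= c * `|x| ^+ 2.
Proof.
by exists 1 => // x; rewrite !mul1r /rdot -expr2 real_normK ?num_real.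
Qed.

HB.instance Definition _ := NormedModule_hasDot.Build R R^o
  rdotC rdotDZl rdot_gt0 rdot_norm_equiv.

End RealDot.

Lemma diff_remainder (R : realType) (V W : normedModType R) (f : V -> W) (x : V)
  (eps : R) : differentiable f x -> 0 < eps ->
  exists2 r : R, 0 < r &
    forall z, `|z - x| < r -> `|f z - f x - 'd f x (z - x)| <= eps * `|z - x|.
Proof.
move=> fx e0; have H := diff_locallyx fx.
have /nbhs_ballP[r /= r0 Hr] : \forall h \near (0 : V),
    `|f (h + x) - f x - 'd f x h| <= eps * `|h|.
  near=> h; rewrite -addrA -opprD H addrAC subrr add0r.
  by near: h; exact: littleoP.
exists r => // z zr; have := Hr (z - x); rewrite subrK; apply.
by rewrite -ball_normE /ball_/= sub0r normrN.
Unshelve. all: by end_near. Qed.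

Lemma diff_Lipschitz_at (R : realType) (V : euclidType R) (W : normedModType R)
  (f : V -> W) (x : V) : differentiable f x ->
  exists K r : R, [/\ 0 < K, 0 < r &
    forall z, `|z - x| < r -> `|f z - f x| <= K * `|z - x|].
Proof.
move=> fx; have [r r0 H] := diff_remainder fx ltr01.
have [c c0 Hc] := linear_bounded_euclid ('d f x).
exists (1 + c), r; split => //; first exact: addr_gt0.
move=> z zr; rewrite -[f z - f x](subrK ('d f x (z - x))) mulrDl.
by apply: le_trans (ler_normD _ _) _; apply: lerD; [exact: H|exact: Hc].
Qed.

(** Testing against a fixed vector [a] makes the scalar mean value theorem
    available for vector-valued maps. *)
Lemma is_derive_line (R : realType) (V U : euclidType R) (f : V -> U) (a : U)
  (y w : V) (s : R) : derivable f (y + s *: w) w ->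
  is_derive s 1 (fun s : R => dot a (f (y + s *: w)))
    (dot a ('D_w f (y + s *: w))).
Proof.
move=> fd; set z := y + s *: w.
have L : (fun h : R => h^-1 *: (((fun s : R => dot a (f (y + s *: w))) \o shift s) (h *: 1)
    - dot a (f z))) @ 0^' --> dot a ('D_w f z).
  rewrite [X in X @ _](_ : _ = fun h : R =>
      dot a (h^-1 *: ((f \o shift z) (h *: w) - f z))).
    by apply: cvg_dot; [exact: cvg_cst|exact: fd].
  apply/funext => h /=; rewrite dotZr dotBr /z; congr (_ * (dot a (f _) - _)).
  by rewrite [h *: 1]mulr1 scalerDl addrCA.
by split; [apply/cvg_ex; exists (dot a ('D_w f z))|exact: cvg_lim].
Qed.

(** Mean value theorem along the segment from [y] to [x], for a derivative that
    is Lipschitz at [v] because it is differentiable there. *)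
Lemma C2_strict_linearization (R : realType) (V U : euclidType R) (D : set V)
  (f : V -> U) (v : V) : C2_on D f -> D v ->
  exists K r : R, [/\ 0 < K, 0 < r,
    forall x, `|x - v| < r -> D x &
    forall x y m, `|x - v| <= m -> `|y - v| <= m -> m < r ->
      `|f x - f y - 'd f v (x - y)| <= K * m * `|x - y|].
Proof.
move=> [[oD fD] D2] Dv.
have /nbhs_ballP[r1 /= r10 Dr1] : \forall x \near v, D x by exact: open_nbhs_nbhs.
have {}Dr1 x : `|x - v| < r1 -> D x.
  by move=> xr; apply: Dr1; rewrite -ball_normE /ball_/= distrC.
have Dd x : D x -> differentiable f x by move=> /fD[].
set e := vbasis {:V}.
have /choice[K_ /choice[r_ HKr]] : forall i : 'I_(\dim {:V}), exists K r : R,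
    [/\ 0 < K, 0 < r &
    forall z, `|z - v| < r -> `|'D_(e`_i) f z - 'D_(e`_i) f v| <= K * `|z - v|].
  by move=> i; apply: diff_Lipschitz_at; have [_ /(_ _ Dv)[]] := D2 e`_i.
have [r [r0 rr1 rr_]] : exists r, [/\ 0 < r, r <= r1 & forall i, r <= r_ i].
  exists (\big[Order.min/r1]_i r_ i); split.
  - by apply: lt_bigmin => // i _; have [] := HKr i.
  - exact: bigmin_le_id.
  - by move=> i; exact: bigmin_le.
have [c c0 Hc] := @coord_bounded R V.
pose K := \sum_i c * K_ i.
have K0 : 0 <= K by apply: sumr_ge0 => i _; have [/ltW ? _ _] := HKr i; rewrite mulr_ge0// ltW.
have dK z u : `|z - v| < r -> `|'d f z u - 'd f v u| <= K * `|z - v| * `|u|.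
  move=> zr; have Dz : D z by apply: Dr1; exact: lt_le_trans rr1.
  have -> : 'd f z u - 'd f v u
      = \sum_i coord e i u *: ('D_(e`_i) f z - 'D_(e`_i) f v).
    have E p : D p -> 'd f p u = \sum_i coord e i u *: 'D_(e`_i) f p.
      move=> Dp; rewrite [in LHS](coord_vbasis (memvf u)) linear_sum.
      by apply: eq_bigr => i _; rewrite linearZ deriveE//; exact: Dd.
    by rewrite !E// -sumrB; apply: eq_bigr => i _; rewrite scalerBr.
  apply: le_trans (ler_norm_sum _ _ _) _.
  rewrite /K !mulr_suml; apply: ler_sum => i _.
  have [_ _ Hi] := HKr i; rewrite normrZ.
  apply: le_trans (ler_pM _ _ (Hc u i) (Hi z _)) _ => //.
    exact: lt_le_trans (rr_ i).
  by rewrite le_eqVlt; apply/orP; left; apply/eqP; ring.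
have [c1 c10 Hc1] := @dot_bound R U; have [c2 c20 Hc2] := @norm_dot_bound R U.
exists (c2 * c1 * K + 1), r; split => //.
- by rewrite ltr_wpDl// !mulr_ge0// ltW.
- by move=> x xr; apply: Dr1; exact: lt_le_trans rr1.
move=> x y m xm ym mr; set a := f x - f y - _.
have m0 : 0 <= m by exact: le_trans xm.
pose g (s : R) := dot a (f (y + s *: (x - y))) - s * dot a ('d f v (x - y)).
have zm (s : R) : s \in `[0, 1] -> `|y + s *: (x - y) - v| <= m.
  rewrite in_itv/= => /andP[s0 s1].
  have -> : y + s *: (x - y) - v = s *: (x - v) + (1 - s) *: (y - v).
    have -> : x - y = (x - v) - (y - v) by rewrite opprB addrA subrK.
    by rewrite addrAC scalerBr scalerBl scale1r addrCA.
  apply: le_trans (ler_normD _ _) _; rewrite !normrZ !ger0_norm ?subr_ge0//.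
  apply: le_trans (lerD (ler_wpM2l s0 xm) (ler_wpM2l _ ym)) _; rewrite ?subr_ge0//.
  by rewrite -mulrDl addrC subrK mul1r.
have dg (s : R) : s \in `[0, 1] -> is_derive s 1 g
    (dot a ('d f (y + s *: (x - y)) (x - y) - 'd f v (x - y))).
  move=> s01; have Dz : D (y + s *: (x - y)).
    by apply: Dr1; apply: le_lt_trans (zm _ s01) _; exact: lt_le_trans rr1.
  rewrite dotBr; apply: is_deriveB.
    rewrite -deriveE; last exact: Dd.
    by apply: is_derive_line; apply: diff_derivable; exact: Dd.
  apply: (is_derive_eq (is_deriveM (is_derive_id _ _) (is_derive_cst _ _ _))).
  by rewrite scaler0 add0r [_ *: _]mulr1.
have sub01 (s : R) : s \in `]0, 1[ -> s \in `[0, 1].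
  by rewrite !in_itv/= => /andP[/ltW-> /ltW->].
have [s s01 gE] := MVT ltr01 (fun s s01 => dg s (sub01 s s01))
  (derivable_within_continuous (fun s s01 => @ex_derive _ _ _ _ _ _ _ (dg s s01))).
have aa : dot a a = dot a ('d f (y + s *: (x - y)) (x - y) - 'd f v (x - y)).
  rewrite -[RHS]mulr1 -[1 in RHS](subr0 1) -gE /g scale1r scale0r addr0 mul1r mul0r.
  by rewrite subr0 [y + _]addrC subrK -!dotBr [_ - f y]addrAC.
have {}aa : `|a| ^+ 2 <= (c2 * c1 * K * m * `|x - y|) * `|a|.
  apply: le_trans (Hc2 a) _; rewrite aa.
  apply: (@le_trans _ _ (c2 * (c1 * (`|a| * (K * m * `|x - y|))))); last first.
    by rewrite le_eqVlt; apply/orP; left; apply/eqP; ring.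
  rewrite ler_pM2l//; apply: le_trans (ler_norm _) _; apply: le_trans (Hc1 _ _) _.
  rewrite ler_pM2l//; apply: ler_wpM2l => //.
  have zs := zm _ (sub01 _ s01).
  apply: le_trans (dK _ _ (le_lt_trans zs mr)) _; apply: ler_wpM2r => //.
  exact: ler_wpM2l.
have [a0|a0] := eqVneq `|a| 0.
  by rewrite a0 !mulr_ge0// addr_ge0// !mulr_ge0// ltW.
have agt : 0 < `|a| by rewrite lt_neqAle eq_sym a0 normr_ge0.
move: aa; rewrite expr2 ler_pM2r// => aa; apply: le_trans aa _.
by rewrite mulrDl mulrDl lerDl mul1r mulr_ge0.
Qed.

Lemma closed_ball_euclid_compact (R : realType) (U : euclidType R) (B : R) :
  compact [set u : U | `|u| <= B].
Proof.
rewrite compact_ultra => F FU FB.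
have [p Fp] := @ultra_cvg_bounded _ U _ F id B FU FB.
exists p; split=> //=; rewrite leNgt; apply/negP => pB.
have Bp : F [set u | B < `|u|] by exact: (cvgr_gt _ (cvg_norm Fp)).
have [x [/=]] := filter_ex (filterI FB Bp).
by rewrite leNgt => /negP.
Qed.

Lemma linear_right_inverse (R : realType) (V U : euclidType R) (J : {linear V -> U}) :
  (forall u, exists v, J v = u) -> exists S : {linear U -> V}, forall u, J (S u) = u.
Proof.
move=> Jonto; exists (linfun J)^-1%VF => u.
rewrite -(lfunE J) limg_lfunVK//.
have [v <-] := Jonto u; rewrite -(lfunE J); exact: memv_img (memvf v).
Qed.

(** A quantitative implicit function argument: the point with image [t J d] is
    found by minimising the residual, measured at scale [t ^+ 2], with a penalty
    on the correction; a Newton step would decrease a nonzero residual by more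
    than it increases the penalty. *)
Lemma submersion_curve (R : realType) (V U : euclidType R) (D : set V)
  (f : V -> U) (v d : V) : C2_on D f -> D v -> f v = 0 ->
  (forall u, exists w, 'd f v w = u) ->
  exists M t0 : R, 0 < t0 /\ forall t, 0 < t -> t < t0 ->
    exists e, [/\ `|e| <= M, D (v + t *: d + t ^+ 2 *: e) &
      f (v + t *: d + t ^+ 2 *: e) = t *: 'd f v d].
Proof.
move=> fC2 Dv fv0 onto.
have [K [r [K0 r0 Dr strict]]] := C2_strict_linearization fC2 Dv.
have [S JS] := linear_right_inverse onto.
have [c c0 Sc] := linear_bounded_euclid S.
set J := 'd f v in onto JS *.
pose r0b := K * `|d| ^+ 2.
have r0b0 : 0 <= r0b by rewrite mulr_ge0 ?(ltW K0) ?sqr_ge0.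
(* leaves room for a Newton step from every point where [phi u <= phi 0] *)
pose B := 3 * r0b.
have B0 : 0 <= B by rewrite mulr_ge0.
pose L := `|d| + c * B + 1.
have L0 : 0 < L by rewrite ltr_wpDl// addr_ge0// mulr_ge0// ltW.
have KcL : 0 < K * c * L by rewrite !mulr_gt0.
exists (c * B), (Num.min 1 (Num.min (r / L) ((4 * (K * c * L))^-1))).
split; first by rewrite !lt_min ltr01 divr_gt0//= invr_gt0 mulr_gt0.
move=> t t0; rewrite !lt_min => /and3P[t1 tr tK].
have t20 : 0 < t ^+ 2 by rewrite exprn_gt0.
pose x u := v + t *: d + t ^+ 2 *: S u.
pose m := t * L.
have mr : m < r by move: tr; rewrite ltr_pdivlMr.
(* a Newton step divides the residual by 4 *)
have mK : K * m * c <= 1 / 4.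
  have -> : K * m * c = t * (K * c * L) by rewrite /m; ring.
  by move/ltW: tK; rewrite invfM ler_pdivlMr// div1r.
have m0 : 0 < m by rewrite mulr_gt0.
have xm u : `|u| <= B -> `|x u - v| <= m.
  move=> uB; rewrite /x addrAC [v + _]addrC addrK.
  apply: le_trans (ler_normD _ _) _; rewrite !normrZ (ger0_norm (ltW t0)).
  rewrite /m /L mulrDr mulrDr mulr1 -addrA lerD2l.
  apply: (@le_trans _ _ (t * (c * B))); last by rewrite lerDl ltW.
  rewrite -mulrA ler_pM2l//.
  apply: (@le_trans _ _ (1 * (c * B))); last by rewrite mul1r.
  apply: ler_pM => //; [exact: ltW|exact: ltW|].
  by apply: le_trans (Sc _) _; rewrite ler_pM2l.
pose rho u := f (x u) - t *: J d.
have rho0 : `|rho 0| <= r0b * t ^+ 2.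
  have vtd : v + t *: d - v = t *: d by rewrite [v + _]addrC addrK.
  have tdm : `|v + t *: d - v| <= t * `|d|.
    by rewrite vtd normrZ ger0_norm// ltW.
  have tdr : t * `|d| < r.
    apply: le_lt_trans mr; rewrite /m ler_pM2l// /L -addrA lerDl.
    by rewrite addr_ge0// mulr_ge0// ltW.
  have := strict (v + t *: d) v (t * `|d|) tdm.
  rewrite subrr normr0 => /(_ (mulr_ge0 (ltW t0) (normr_ge0 d)) tdr).
  rewrite fv0 subr0 vtd => H.
  rewrite /rho /x linear0 scaler0 addr0 -linearZ; apply: le_trans H _.
  rewrite normrZ ger0_norm ?(ltW t0)// /r0b.
  by rewrite le_eqVlt; apply/orP; left; apply/eqP; ring.
pose phi u := `|rho u| / t ^+ 2 + `|u| / 2.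
pose Ball := [set u : U | `|u| <= B].
have Ball0 : Ball 0 by rewrite /Ball/= normr0.
have cphi : {within Ball, continuous phi}.
  apply: continuous_in_subspaceT => u; rewrite inE => uB.
  apply: (@cvgD _ _ _ (nbhs u)).
    apply: (@cvgMr_tmp _ _ (nbhs u)); apply: (@cvg_norm _ _ _ (nbhs u)).
    apply: (@cvgB _ _ _ (nbhs u)); last exact: cvg_cst.
    apply: (@cvg_comp _ _ _ x f (nbhs u) (nbhs (x u))).
      apply: (@cvgD _ _ _ (nbhs u)); first exact: cvg_cst.
      by apply: (@cvgZl_tmp _ _ _ (nbhs u)); apply: linear_cvg; exact: cvg_id.
    apply: differentiable_continuous.
    by have [[_ fD] _] := fC2; apply: (fD _ _).1; apply: Dr; apply: le_lt_trans (xm _ uB) _.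
  by apply: (@cvgMr_tmp _ _ (nbhs u)); apply: (@cvg_norm _ _ _ (nbhs u)); exact: cvg_id.
have [u uB umin] := compact_EVT_min (ex_intro _ _ Ball0) (@closed_ball_euclid_compact _ U B) cphi.
rewrite inE in uB.
have phi0 : phi u <= r0b.
  apply: le_trans (umin 0 _) _; first by rewrite inE.
  by rewrite /phi normr0 mul0r addr0 ler_pdivrMr.
have rho_u : rho u = 0.
  apply/eqP; rewrite -normr_eq0; apply/negPn/negP => rhoN0.
  have rgt : 0 < `|rho u| by rewrite lt_neqAle eq_sym rhoN0 normr_ge0.
  pose s := `|rho u| / t ^+ 2.
  have s0 : 0 < s by rewrite divr_gt0.
  have phiE : phi u = s + `|u| / 2 by [].
  pose u' := u - t ^- 2 *: rho u.
  have u's : `|u'| <= `|u| + s.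
    apply: le_trans (ler_normB _ _) _; rewrite lerD2l normrZ mulrC /s.
    by rewrite ger0_norm// invr_ge0 ltW.
  have u'B : `|u'| <= B.
    apply: le_trans u's _; move: phi0; rewrite phiE /B => H.
    have : 0 <= `|u| by []. 
    lra.
  have xx' : x u' - x u = - S (rho u).
    rewrite /x opprD addrACA subrr add0r -scalerBr -linearB /u' addrAC subrr.
    by rewrite add0r linearN scalerN [S (_ *: _)]linearZ scalerA mulfV ?gt_eqF// scale1r.
  have rho' : `|rho u'| <= `|rho u| / 4.
    have := strict (x u') (x u) m (xm _ u'B) (xm _ uB) mr.
    rewrite xx' linearN JS opprK normrN => H.
    have -> : rho u' = f (x u') - f (x u) + rho u by rewrite /rho addrA subrK.
    apply: le_trans H _; apply: (@le_trans _ _ (K * m * (c * `|rho u|))).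
      by rewrite ler_pM2l ?mulr_gt0.
    by rewrite mulrA [leRHS]mulrC -[4^-1]div1r; apply: ler_wpM2r.
  have := umin u'; rewrite inE => /(_ u'B); rewrite phiE /phi.
  have : `|rho u'| / t ^+ 2 <= s / 4.
    by rewrite /s mulrAC ler_pM2r// invr_gt0.
  lra.
exists (S u); split.
- by apply: le_trans (Sc _) _; rewrite ler_pM2l.
- by apply: Dr; apply: le_lt_trans (xm _ uB) mr.
- by apply/eqP; rewrite -subr_eq0; apply/eqP.
Qed.

(** A normal [N] and a direction [d] orthogonal to it play the role of a
    multiplier and of a critical direction.  The last clause compares the points
    [v + t k *: d_ k] of [K] with the replacement points through [N], at the
    scale of [t k ^+ 2] since both sides are divided by [t k]. *)
Definition second_order_regular (R : realType) (V : euclidType R) (K : set V) (v : V) :=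
  forall N : V, (forall z, K z -> dot N (z - v) <= 0) ->
  forall (F : set_system nat) (FF : ProperFilter F) (t : nat -> R) (d_ : nat -> V) (d : V),
    (forall k, 0 < t k) -> t @ F --> 0 -> d_ @ F --> d ->
    (\forall k \near F, K (v + t k *: d_ k)) -> dot N d = 0 ->
  exists M (e_ : nat -> V),
    (\forall k \near F, `|e_ k| <= M /\ K (v + t k *: d + t k ^+ 2 *: e_ k)) /\
    (forall eps, 0 < eps ->
      \forall k \near F, dot N (d_ k - d - t k *: e_ k) <= eps * t k).

(** Second-order regularity of cone-reducible sets: along a critical direction
    [d], points of [K] approaching [v] can be replaced, without loss in the
    normal direction [N] beyond second order, by points of [K] that stay within
    [O(t ^+ 2)] of [v + t *: d].  The replacement solves [Xi = t Xi'(v) d].  The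
    normal [N] factors as [nu \o Xi'(v)] with [nu <= 0] on the cone, and [nu]
    vanishes at [Xi'(v) d], so moving there can only increase [nu \o Xi]. *)
Lemma cone_reducible_regular (R : realType) (V : euclidType R) (K : set V) (v : V) :
  cone_reducible K v -> second_order_regular K v.
Proof.
move=> [U [C [W [Xi [[Ccone Wv XiC2] [Xiv onto KW]]]]]] N NK F FF t d_ d t0 t_cvg d_cvg Kk Nd.
have [clC _ CZ _] := Ccone.
have KWP z : W z -> K z <-> C (Xi z).
  move=> Wz; have : (K `&` W) z <-> (W `&` [set x | C (Xi x)]) z by rewrite KW.
  by move=> [H1 H2]; split=> [Kz|Cz]; [have [] := H1 (conj Kz Wz)|have [] := H2 (conj Wz Cz)].
have [L [r [L0 r0 Wr strict]]] := C2_strict_linearization XiC2 Wv.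
have [S JS] := linear_right_inverse onto.
set J := 'd Xi v in onto JS strict.
have [cS cS0 HcS] := linear_bounded_euclid S.
have [c1 c10 Hc1] := @dot_bound R V.
(* the curve of [submersion_curve] in the direction [d'] stays in [K] *)
have normal_le d' : C (J d') -> dot N d' <= 0.
  move=> Cd'; have [M [s0 [s00 Hs]]] := submersion_curve d' XiC2 Wv Xiv onto.
  apply/ler_addgt0Pl => eps eps0; rewrite addr0.
  pose A := c1 * (`|N| * `|M|) + 1.
  have A0 : 0 < A by rewrite ltr_wpDl// !mulr_ge0// ltW.
  pose s := Num.min (s0 / 2) (eps / A).
  have s_gt0 : 0 < s by rewrite lt_min !divr_gt0.
  have ss0 : s < s0 by rewrite gt_min ltr_pdivrMr// mulr2n mulrDr mulr1 ltrDl s00.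
  have [e [eM We Xie]] := Hs s s_gt0 ss0.
  have Ke : K (v + s *: d' + s ^+ 2 *: e).
    by apply/KWP => //; rewrite Xie; apply: CZ => //; exact: ltW.
  have := NK _ Ke; rewrite addrAC [v + _]addrC addrK dotDr !dotZr.
  rewrite expr2 -mulrA -mulrDr pmulr_rle0// => H.
  have {}H : dot N d' <= - (s * dot N e) by rewrite -subr_le0 opprK.
  apply: le_trans H _; rewrite -mulrN.
  apply: (@le_trans _ _ (s * A)).
    rewrite ler_pM2l// /A; apply: le_trans (ler_norm _) _; rewrite normrN.
    apply: le_trans (Hc1 _ _) _; apply: (@le_trans _ _ (c1 * (`|N| * `|M|))).
      by rewrite ler_pM2l// ler_wpM2l//; apply: le_trans eM _; exact: ler_norm.
    by rewrite lerDl.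
  by rewrite -ler_pdivlMr// ge_min lexx orbT.
have ker0 y : J y = 0 -> dot N y = 0.
  have C0 : C 0.
    by have [_ _ _ Cp] := Ccone; have : [set (0 : U)] 0 by []; rewrite -Cp => -[].
  move=> Jy; apply/le_anti; rewrite normal_le ?Jy//=.
  by rewrite -oppr_le0 -dotNr normal_le// linearN Jy oppr0.
have NSJ y : dot N y = dot N (S (J y)).
  apply/eqP; rewrite -subr_eq0 -dotBr; apply/eqP; apply: ker0.
  by rewrite linearB JS subrr.
have dB : \forall k \near F, `|d_ k| <= `|d| + 1.
  near=> k; apply: ltW; near: k.
  by apply: (cvgr_lt _ (cvg_norm d_cvg)); rewrite ltrDl.
have t1 : \forall k \near F, t k <= 1.
  by near=> k; apply: ltW; near: k; apply: (cvgr_lt _ t_cvg).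
have tsmall e : 0 < e -> \forall k \near F, t k < e by move=> e0; apply: (cvgr_lt _ t_cvg).
have vkr k : v + t k *: d_ k - v = t k *: d_ k by rewrite [v + _]addrC addrK.
have Bpos : 0 < `|d| + 1 by rewrite ltr_wpDl.
have CXi : \forall k \near F, C (Xi (v + t k *: d_ k)).
  near=> k; apply/KWP; last by near: k.
  apply: Wr; rewrite vkr normrZ (gtr0_norm (t0 k)).
  apply: (@le_lt_trans _ _ (t k * (`|d| + 1))).
    by rewrite ler_pM2l//; near: k.
  by rewrite -ltr_pdivlMr//; near: k; apply: tsmall; exact: divr_gt0.
have CJd : C (J d).
  apply: (closed_cvg (fun x : U => C x) clC (F := F) (u_ := fun k => (t k)^-1 *: Xi (v + t k *: d_ k))).
    by near=> k; apply: CZ; [rewrite invr_ge0 ltW|near: k].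
  have Jd_ : (fun k => J (d_ k)) @ F --> J d by exact: linear_cvg.
  rewrite -[J d]add0r.
  rewrite (_ : (fun k => _) = (fun k => ((t k)^-1 *: Xi (v + t k *: d_ k) - J (d_ k)) + J (d_ k))); last first.
    by apply/funext => k; rewrite subrK.
  apply: cvgD => //.
  apply: (@cvg_le_norm _ _ _ _ _ _ _ (fun k => t k * (L * (`|d| + 1) ^+ 2))).
    near=> k; rewrite subr0.
    have tk := t0 k.
    have dk : `|d_ k| <= `|d| + 1 by near: k.
    have -> : (t k)^-1 *: Xi (v + t k *: d_ k) - J (d_ k)
        = (t k)^-1 *: (Xi (v + t k *: d_ k) - J (t k *: d_ k)).
      by rewrite scalerBr [J (_ *: _)]linearZ scalerA mulVf ?gt_eqF// scale1r.
    rewrite normrZ gtr0_norm ?invr_gt0// ler_pdivrMl//.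
    have := strict (v + t k *: d_ k) v (t k * (`|d| + 1)).
    rewrite vkr subrr normr0 normrZ (gtr0_norm tk) ler_pM2l// => /(_ dk).
    move=> /(_ (mulr_ge0 (ltW tk) (ltW Bpos))); rewrite Xiv subr0 => H.
    apply: le_trans (H _) _.
      by rewrite -ltr_pdivlMr//; near: k; apply: tsmall; exact: divr_gt0.
    have -> : t k * (t k * (L * (`|d| + 1) ^+ 2)) = L * (t k * (`|d| + 1)) * (t k * (`|d| + 1)) by ring.
    by rewrite ler_wpM2l ?mulr_ge0 ?(ltW L0) ?(ltW tk) ?(ltW Bpos)// ler_pM2l.
  by rewrite -[X in _ --> X](mul0r (L * (`|d| + 1) ^+ 2)); exact: cvgMr_tmp.
have [M [s0 [s00 Hs]]] := submersion_curve d XiC2 Wv Xiv onto.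
have /choice[e_ He] : forall k, exists e, t k < s0 -> [/\ `|e| <= M,
    W (v + t k *: d + t k ^+ 2 *: e) & Xi (v + t k *: d + t k ^+ 2 *: e) = t k *: J d].
  move=> k; have [tk|tk] := ltP (t k) s0; last by exists 0.
  by have [e He] := Hs _ (t0 k) tk; exists e.
exists M, e_; split.
  near=> k.
  have [|eM We Xie] := He k; first by near: k; exact: tsmall.
  by split => //; apply/KWP => //; rewrite Xie; apply: CZ => //; rewrite ltW.
move=> eps eps0.
have M0 : 0 <= M.
  have [k tk] := filter_ex (tsmall _ s00); have [eM _ _] := He k tk.
  exact: le_trans eM.
pose B := `|d| + 1 + M.
have B0 : 0 < B by rewrite ltr_wpDr.
pose A := c1 * (`|N| * (cS * (L * B))) + 1.
have A0 : 0 < A by rewrite ltr_wpDl// !mulr_ge0// ltW.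
have yto0 : \forall k \near F, `|d_ k - d| + t k * M <= eps / A.
  have : (fun k => `|d_ k - d| + t k * M) @ F --> 0 + 0 * M.
    by apply: cvgD; [apply/norm_cvg0P/subr_cvg0|exact: cvgMr_tmp].
  rewrite mul0r addr0 => H; near=> k; apply: ltW; near: k.
  by apply: (cvgr_lt _ H); rewrite divr_gt0.
near=> k.
have tk := t0 k.
have [|eM We Xie] := He k; first by near: k; exact: tsmall.
have tk1 : t k <= 1 by near: k.
have dk : `|d_ k| <= `|d| + 1 by near: k.
have Cq : C (Xi (v + t k *: d_ k)) by near: k.
set y := d_ k - d - _.
have tB : t k * B < r by rewrite -ltr_pdivlMr//; near: k; apply: tsmall; exact: divr_gt0.
have ydiff : (v + t k *: d_ k) - (v + t k *: d + t k ^+ 2 *: e_ k) = t k *: y.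
  by rewrite -(addrA v (t k *: d)) opprD addrACA subrr add0r opprD /y !scalerBr addrA scalerA -expr2.
have ve : `|v + t k *: d + t k ^+ 2 *: e_ k - v| <= t k * B.
  rewrite addrAC [v + _]addrC addrK; apply: le_trans (ler_normD _ _) _.
  rewrite !normrZ (gtr0_norm tk) -mulrA -mulrDr ler_pM2l// /B.
  apply: lerD; first by rewrite lerDl.
  by apply: le_trans eM; rewrite -[leRHS]mul1r; apply: ler_wpM2r.
have vd : `|v + t k *: d_ k - v| <= t k * B.
  rewrite vkr normrZ (gtr0_norm tk) ler_pM2l//; apply: le_trans dk _.
  by rewrite /B lerDl.
have := strict _ _ _ vd ve tB; rewrite Xie ydiff normrZ (gtr0_norm tk).
set q := Xi (v + t k *: d_ k) in Cq *; set err := q - _ - _ => errB.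
have Nq : dot N (S q) <= 0 by apply: normal_le; rewrite JS.
have tyE : t k * dot N y = dot N (S q) - dot N (S err).
  have qerr : q - err = J (t k *: d) + J (t k *: y).
    rewrite [J (t k *: d)]linearZ /err -[q - _ - _]addrA opprD addrA subrr add0r.
    by rewrite -opprD opprK.
  have -> : dot N (S q) - dot N (S err) = dot N (S (q - err)).
    by rewrite -dotBr -(linearB S).
  by rewrite qerr (linearD S) [RHS]dotDr -!NSJ !dotZr Nd mulr0 add0r.
have yB : `|y| <= eps / A.
  apply: (@le_trans _ _ (`|d_ k - d| + t k * M)); last by near: k.
  apply: le_trans (ler_normB _ _) _; rewrite lerD2l normrZ (gtr0_norm tk).
  by rewrite ler_pM2l.
rewrite -(ler_pM2l tk) tyE.
apply: (@le_trans _ _ (- dot N (S err))); first by rewrite gerDr.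
apply: le_trans (ler_norm _) _; rewrite normrN; apply: le_trans (Hc1 _ _) _.
apply: (@le_trans _ _ (c1 * (`|N| * (cS * (L * (t k * B) * (t k * (eps / A))))))).
  rewrite ler_pM2l// ler_wpM2l//; apply: le_trans (HcS _) _.
  rewrite ler_pM2l//; apply: le_trans errB _.
  rewrite ler_pM2l; last by rewrite !mulr_gt0.
  by rewrite ler_pM2l.
have -> : c1 * (`|N| * (cS * (L * (t k * B) * (t k * (eps / A)))))
    = (c1 * (`|N| * (cS * (L * B)))) * (t k * (t k * (eps / A))) by ring.
have -> : t k * (eps * t k) = A * (t k * (t k * (eps / A))).
  by field; rewrite gt_eqF.
apply: ler_wpM2r; last by rewrite /A lerDl.
by rewrite pmulr_rge0// pmulr_rge0// ltW// divr_gt0.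
Unshelve. all: by end_near. Qed.

Lemma norm_le_of_dot (R : realType) (V : euclidType R) : exists2 c : R, 0 < c &
  forall x y : V, dot x x <= dot y y -> `|x| <= c * `|y|.
Proof.
have [c c0 H] := @dot_norm_equiv R V; exists c => // x y xy.
rewrite -(@ler_pXn2r _ 2)// ?nnegrE ?mulr_ge0// ?(ltW c0)//.
have [hx _] := H x; have [_ hy] := H y.
apply: le_trans hx _; rewrite exprMn [c ^+ 2]expr2 -mulrA ler_pM2l//.
exact: le_trans xy hy.
Qed.

Lemma second_order_regular_isometry (R : realType) (V : euclidType R) (K : set V)
  (f g : V -> V) (v : V) :
  (forall a x y, f (a *: x + y) = a *: f x + f y) ->
  (forall x y, dot (f x) (f y) = dot x y) -> cancel g f ->
  (forall z, K (f z) <-> K z) ->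
  second_order_regular K (f v) -> second_order_regular K v.
Proof.
move=> flin fdot gK Kf reg N NK F FF t d_ d t0 tc dc Kd Nd.
pose lm := GRing.isLinear.Build R V V _ f flin.
pose fL : {linear V -> V} := HB.pack f lm.
have f_fL x : f x = fL x by [].
have gdot x y : dot (g x) (g y) = dot x y by rewrite -fdot !gK.
have fg x y : dot (f x) y = dot x (g y) by rewrite -[in LHS](gK y) fdot.
have NK' z : K z -> dot (f N) (z - f v) <= 0.
  move=> Kz; rewrite -(gK z) f_fL -(linearB fL) fdot.
  by apply: NK; apply/Kf; rewrite gK.
have dc' : (fun k => f (d_ k)) @ F --> f d by exact: (linear_cvg (f := fL)).
have Kd' : \forall k \near F, K (f v + t k *: f (d_ k)).
  by apply: filterS Kd => k; rewrite -Kf /= !f_fL linearD linearZ.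
have Nd' : dot (f N) (f d) = 0 by rewrite fdot.
have [M [e_ [eM eps_]]] := reg (f N) NK' F FF t _ _ t0 tc dc' Kd' Nd'.
have [c c0 Hc] := @norm_le_of_dot _ V.
exists (c * M), (g \o e_); split.
  apply: filterS eM => k [eM Ke] /=; split.
    by apply: (le_trans (Hc _ (e_ k) _)); [rewrite gdot|rewrite ler_pM2l].
  by apply/Kf; rewrite !f_fL !linearD !linearZ -!f_fL gK.
move=> eps /eps_; apply: filterS => k; apply: le_trans.
rewrite -[leLHS]fdot le_eqVlt; apply/orP; left; apply/eqP; congr (dot _ _).
by rewrite !f_fL !linearB linearZ -!f_fL /= gK.
Qed.

(** * Spectral functions over an abstract spectral system *)

Section ZmodIdentities.
Variable V : zmodType.
Implicit Types a b c d : V.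

Lemma cancel_sum a b c : a + b + (c - a - b) = c.
Proof. by rewrite -(addrA c) -opprD (addrC c) addrA subrr add0r. Qed.

Lemma cancel_step a b c d : b + (c - a - b) - d = - (a + d - c).
Proof. by rewrite addrC [b + _]addrC subrK opprB opprD [RHS]addrA [RHS]addrC. Qed.

Lemma cancel_diff a b c d : d - b - (c - a - b) = a + d - c.
Proof.
rewrite !opprD !opprK addrACA [- b + b]addrC subrr addr0 addrA.
by rewrite [a + d]addrC [RHS]addrAC.
Qed.

End ZmodIdentities.

Lemma cvg_lim_ge0 (R : realType) T (F : set_system T) {FF : ProperFilter F}
  (f : T -> R) (a : R) : f @ F --> a -> (\forall k \near F, 0 <= f k) -> 0 <= a.
Proof.
move=> fa f0; rewrite leNgt; apply/negP => a0.
have fneg : \forall k \near F, f k < 0 by exact: (cvgr_lt _ fa _ a0).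
have [k []] := @filter_ex _ F _ _ (@filterI _ F _ _ _ f0 fneg).
by rewrite leNgt => /negP.
Qed.

(** The property of a convex function that the no-gap condition calls for.
    Points [s + t k *: h_ k] whose first-order gap in the subgradient inequality
    vanishes are compared with points along [H] whose second-order part [w_ k]
    converges; the excess over the linearisation by [x] is [o(t k ^+ 2)]. *)
Definition outer_regular (R : realType) (X : euclidType R) (Th : X -> \bar R) (s : X) :=
  forall x, subdiff Th s x ->
  forall (F : set_system nat) (FU : UltraFilter F) (t : nat -> R) (h_ : nat -> X) (H : X)
    (th_ : nat -> R),
    (forall k, 0 < t k) -> t @ F --> 0 -> h_ @ F --> H ->
    (\forall k \near F, Th (s + t k *: h_ k) = (th_ k)%:E) ->
    (forall eps, 0 < eps -> \forall k \near F,
      th_ k - fine (Th s) - t k * dot x (h_ k) <= eps * t k) ->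
  exists (w_ : nat -> X) (w : X), w_ @ F --> w /\
    forall eps, 0 < eps -> \forall k \near F,
      (Th (s + t k *: H + (t k ^+ 2 / 2) *: w_ k)%R <=
       (th_ k + dot x (t k *: H + (t k ^+ 2 / 2) *: w_ k - t k *: h_ k)
        + eps * t k ^+ 2)%R%:E)%E.

(** What ordered eigenvalues and singular values have in common: [dg] builds the
    diagonal matrices, and [G] consists of the orthogonal changes of frame.  The
    field [ss_tangent] is first-order perturbation theory: in the limit, [U] is
    a frame of [s], and the frames [V_ k] carry the curve of spectra
    [spec s + t k *: l'] to the line [s + t k *: H] up to [O(t k ^+ 2)]. *)
Record spectral_system (R : realType) (X : euclidType R) (n : nat)
    (spec : X -> 'cV[R]_n) (dg : {linear 'cV[R]_n -> X}) (G : set (X -> X)) : Prop := {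
  ss_linear : forall U, G U -> forall a x y, U (a *: x + y) = a *: U x + U y ;
  ss_dot : forall U, G U -> forall x y, dot (U x) (U y) = dot x y ;
  ss_comp : forall U V, G U -> G V -> G (U \o V) ;
  ss_inv : forall U, G U -> exists2 U', G U' & cancel U' U ;
  ss_spec : forall U, G U -> forall x, spec (U x) = spec x ;
  ss_dg : forall l l', dot (dg l) (dg l') = dot l l' ;
  ss_diag : forall x, exists2 U, G U & x = U (dg (spec x)) ;
  ss_fan : forall x y, dot x y <= dot (spec x) (spec y) ;
  ss_range : exists (I : finType) (K : I -> 'cV[R]_n), forall l,
    spec (dg l) = l <-> forall i, 0 <= dot (K i) l ;
  ss_tangent : forall (F : set_system nat) (t : nat -> R) (h_ : nat -> X) (s H : X) (l' : 'cV[R]_n),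
    UltraFilter F -> (forall k, 0 < t k) -> t @ F --> 0 -> h_ @ F --> H ->
    (fun k => (t k)^-1 *: (spec (s + t k *: h_ k) - spec s)) @ F --> l' ->
    exists (U : X -> X) (V_ : nat -> X -> X),
    [/\ G U, s = U (dg (spec s)), forall k, G (V_ k),
      forall x, exists M, \forall k \near F, `|V_ k x - U x| <= M * t k &
      exists M, \forall k \near F,
        `|V_ k (dg (spec s + t k *: l')) - s - t k *: H| <= M * t k ^+ 2] }.

Section SpectralSystem.
Context {R : realType} {X : euclidType R} {n : nat} {spec : X -> 'cV[R]_n}.
Context {dg : {linear 'cV[R]_n -> X}} {G : set (X -> X)}.
Hypothesis ss : spectral_system spec dg G.

Lemma ss_scale U a x : G U -> U (a *: x) = a *: U x.
Proof.
move=> GU; have U0 : U 0 = 0.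
  have := ss_linear ss GU 1 0 0; rewrite scaler0 addr0 scale1r => /eqP.
  by rewrite -subr_eq subrr eq_sym => /eqP.
by have := ss_linear ss GU a x 0; rewrite U0 !addr0.
Qed.

Lemma ss_add U x y : G U -> U (x + y) = U x + U y.
Proof. by move=> GU; have := ss_linear ss GU 1 x y; rewrite !scale1r. Qed.

Lemma ss_sub U x y : G U -> U (x - y) = U x - U y.
Proof. by move=> GU; rewrite ss_add// -scaleN1r ss_scale// scaleN1r. Qed.

Lemma spec_dg_spec x : spec (dg (spec x)) = spec x.
Proof.
by have [U GU xE] := ss_diag ss x; rewrite [in RHS]xE (ss_spec ss GU).
Qed.

Lemma spec_norm x : dot (spec x) (spec x) = dot x x.
Proof.
have [U GU xE] := ss_diag ss x.
by rewrite [in RHS]xE (ss_dot ss GU) (ss_dg ss).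
Qed.

Lemma spec_lipschitz x y :
  dot (spec x - spec y) (spec x - spec y) <= dot (x - y) (x - y).
Proof.
have := ss_fan ss x y; rewrite !dotBl !dotBr !spec_norm (dotC y x) (dotC (spec y)).
lra.
Qed.

(** Equality in Fan's inequality forces an ordered simultaneous diagonalisation.
    Applying Fan's inequality to the pairs [(a + b, a)] and [(a + b, b)] shows
    that [spec (a + b) = spec a + spec b]; a second application, to the pairs
    made of [a] and each half of the diagonal form of [a + b], then gives
    equality in a Cauchy-Schwarz inequality. *)
Lemma fan_equality V a b : G V -> a + b = V (dg (spec (a + b))) ->
  dot a b = dot (spec a) (spec b) ->
  [/\ a = V (dg (spec a)), b = V (dg (spec b)) & spec (a + b) = spec a + spec b].
Proof.
move=> GV abE ab; set la := spec a; set lb := spec b; set c := spec (a + b).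
have aa := spec_norm a; have bb := spec_norm b; have cc := spec_norm (a + b).
have ca := ss_fan ss (a + b) a; have cb := ss_fan ss (a + b) b.
have cE : c = la + lb.
  apply/eqP; rewrite -subr_eq0; apply/eqP; apply: dot_eq0.
  apply/le_anti; rewrite dot_ge0 andbT.
  move: aa bb cc ca cb ab; rewrite -/la -/lb -/c.
  rewrite !(dotBl, dotBr, dotDl, dotDr) (dotC b a) (dotC lb la) (dotC la c) (dotC lb c).
  lra.
have sVa z : dot a (V (dg (spec z))) <= dot la (spec z).
  by apply: le_trans (ss_fan ss _ _) _; rewrite (ss_spec ss GV) spec_dg_spec.
have abV : a + b = V (dg la) + V (dg lb) by rewrite abE -/c cE linearD ss_add.
have aE : a = V (dg la).
  apply/eqP; rewrite -subr_eq0; apply/eqP; apply: dot_eq0.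
  apply/le_anti; rewrite dot_ge0 andbT.
  have Va : dot (V (dg la)) (V (dg la)) = dot la la by rewrite (ss_dot ss GV) (ss_dg ss).
  have : dot a (a + b) = dot a (V (dg la)) + dot a (V (dg lb)) by rewrite abV dotDr.
  have := sVa a; have := sVa b; move: aa ab; rewrite -/la -/lb.
  rewrite !(dotBl, dotBr, dotDr) (dotC (V (dg la)) a) Va.
  lra.
split=> //; apply: (addrI a); by rewrite {2}aE -abV.
Qed.

Lemma conjugate_spectral (g : 'cV[R]_n -> \bar R) :
  (forall l, g (spec (dg l)) = g l) ->
  conjugate (g \o spec) = conjugate g \o spec.
Proof.
move=> gsym; apply/funext => s /=; apply/le_anti/andP; split.
  apply: ge_ereal_sup => _ [u _ <-] /=.
  apply: (@le_trans _ _ ((dot (spec u) (spec s))%:E - g (spec u))%E).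
    by apply: leeB => //; rewrite lee_fin; exact: (ss_fan ss).
  by apply: ereal_sup_ubound; exists (spec u).
apply: ge_ereal_sup => _ [v _ <-] /=.
have [U GU sE] := ss_diag ss s.
apply: ereal_sup_ubound; exists (U (dg v)) => //=.
rewrite (ss_spec ss GU) gsym; congr (_%:E - _)%E.
by rewrite [in LHS]sE (ss_dot ss GU) (ss_dg ss).
Qed.

(** Directional limits of spectra stay feasible for a short while because the
    set of ordered spectra is a polyhedral cone. *)
Lemma spec_range_direction (F : set_system nat) {FF : ProperFilter F} (t : nat -> R)
  (l_ : nat -> 'cV[R]_n) (l l' : 'cV[R]_n) : spec (dg l) = l ->
  (forall k, 0 < t k) -> (forall k, spec (dg (l_ k)) = l_ k) ->
  (fun k => (t k)^-1 *: (l_ k - l)) @ F --> l' ->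
  exists2 tau : R, 0 < tau & spec (dg (l + tau *: l')) = l + tau *: l'.
Proof.
move=> sl t0 sl_ l'_cvg; have [I [K KP]] := ss_range ss.
have Kl := (KP l).1 sl.
have K0 i : dot (K i) l = 0 -> 0 <= dot (K i) l'.
  move=> Kil; have L : (fun k => dot (K i) ((t k)^-1 *: (l_ k - l))) @ F --> dot (K i) l'.
    by apply: cvg_dot => //; exact: cvg_cst.
  rewrite leNgt; apply/negP => neg.
  have /filter_ex[k] : \forall k \near F, dot (K i) ((t k)^-1 *: (l_ k - l)) < 0.
    exact: (cvgr_lt _ L _ neg).
  rewrite dotZr dotBr Kil subr0 pmulr_rlt0 ?invr_gt0// ltNge => /negP; apply.
  exact: (KP _).1 (sl_ k) i.
have /choice[tau_ Htau] : forall i, exists tau : R, 0 < tau /\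
    forall s, 0 <= s -> s <= tau -> 0 <= dot (K i) l + s * dot (K i) l'.
  move=> i; have [Kil|Kil] := eqVneq (dot (K i) l) 0.
    by exists 1; split=> // s s0 _; rewrite Kil add0r mulr_ge0// K0.
  have Kpos : 0 < dot (K i) l by rewrite lt_neqAle eq_sym Kil Kl.
  have B0 : 0 < `|dot (K i) l'| + 1 by rewrite ltr_wpDl.
  exists (dot (K i) l / (`|dot (K i) l'| + 1)); split; first exact: divr_gt0.
  move=> s s0; rewrite ler_pdivlMr// => sB.
  have : - (s * dot (K i) l') <= s * (`|dot (K i) l'| + 1).
    rewrite -mulrN; apply: ler_wpM2l => //; apply: le_trans (ler_norm _) _.
    by rewrite normrN lerDl.
  lra.
exists (\big[Order.min/1]_i tau_ i).
  by apply: lt_bigmin => // i _; have [] := Htau i.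
apply/KP => i; rewrite dotDr dotZr; have [_ H] := Htau i; apply: H.
  by apply: ltW; apply: lt_bigmin => // j _; have [] := Htau j.
exact: bigmin_le.
Qed.

(** The eigenvectors of the perturbed points select, within the orbit of [s],
    a frame in which [s], the multiplier [x] and the first-order part of the
    spectrum are diagonal at once.  The regular curve of spectra is rotated along
    the tangent of the orbit, and the comparison is made through the multiplier
    rotated in the same way, at the cost of [o(t k ^+ 2)]; this stands in for a
    second-order expansion of eigenvalues. *)
Theorem spectral_outer_regular (gs : 'cV[R]_n -> \bar R) (s : X) :
  (forall l, gs (spec (dg l)) = gs l) ->
  gs (spec s) \is a fin_num ->
  second_order_regular (epi gs) (spec s, fine (gs (spec s)) : R^o) ->
  outer_regular (gs \o spec) s.
Proof.
move=> gsym gfin reg x xsub F FU t h_ H th_ t0 t_cvg h_cvg thE th_le.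
set l := spec s in gfin reg *; set xb := spec x.
set ths := fine (gs l) in reg.
have Ths : gs l = ths%:E by rewrite fineK.
have sub_real z r : gs (spec z) = r%:E -> ths + dot x (z - s) <= r.
  by move=> zr; have := xsub z; rewrite /= zr -/l Ths -EFinD lee_fin.
(* The subgradient inequality at the point of the orbit of [s] that is diagonal
   in a frame of [x] forces equality in Fan's inequality. *)
have xs : dot x s = dot xb l.
  apply/le_anti; rewrite (ss_fan ss)/=.
  have [U GU xE] := ss_diag ss x.
  have := sub_real (U (dg l)) ths; rewrite (ss_spec ss GU) spec_dg_spec => /(_ Ths).
  rewrite dotBr {1}xE (ss_dot ss GU) (ss_dg ss) -/xb.
  lra.
have xb_sub z : ((ths + dot xb (z - l))%R%:E <= gs z)%E.
  have [P GP xsE] := ss_diag ss (x + s).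
  have [xE sE _] := fan_equality GP xsE xs.
  have := xsub (P (dg z)); rewrite /= (ss_spec ss GP) gsym -/l Ths -EFinD.
  apply: le_trans; rewrite lee_fin lerD2l sE xE -ss_sub// (ss_dot ss GP).
  by rewrite -linearB (ss_dg ss).
pose l_ k := spec (s + t k *: h_ k).
pose de k := (t k)^-1 *: (l_ k - l).
have t_neq0 k : t k != 0 by rewrite gt_eqF.
have l_E k : l_ k = l + t k *: de k.
  by rewrite /de scalerA mulfV// scale1r addrC subrK.
have h_bound : \forall k \near F, `|h_ k| <= `|H| + 1.
  near=> k; apply: ltW; near: k.
  by apply: (cvgr_lt _ (cvg_norm h_cvg)); rewrite ltrDl.
have [l' de_cvg] : exists l' : 'cV[R]_n, de @ F --> l'.
  have [c c0 Hc] := @dot_norm_equiv R X; have [c' c'0 Hc'] := @norm_dot_bound R 'cV[R]_n.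
  apply: (ultra_cvg_bounded (M := Num.sqrt (c' * (c * (`|H| + 1) ^+ 2)))).
  near=> k; rewrite -(@ler_pXn2r _ 2) ?nnegrE ?sqrtr_ge0// sqr_sqrtr; last first.
    by rewrite !mulr_ge0 ?sqr_ge0// ltW.
  apply: le_trans (Hc' _) _; rewrite ler_pM2l//.
  apply: (@le_trans _ _ (dot (h_ k) (h_ k))).
    rewrite /de dotZl dotZr mulrA -invfM ler_pdivrMl ?mulr_gt0//.
    apply: le_trans (spec_lipschitz _ _) _.
    by rewrite addrAC subrr add0r dotZl dotZr mulrA.
  apply: le_trans (Hc _).2 _; rewrite ler_pM2l// ler_pXn2r// ?nnegrE// ?addr_ge0//.
  by near: k.
have thk k : gs (l_ k) = (th_ k)%:E -> t k * dot x (h_ k) <= th_ k - ths.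
  by move=> /sub_real; rewrite [s + _]addrC addrK dotZr; lra.
(* Upper bound: the subgradient inequality for [gs] and the vanishing
   first-order gap; lower bound: Fan's inequality, an equality at [s]. *)
have xbl' : dot xb l' = dot x H.
  have Lde : (fun k => dot xb (de k)) @ F --> dot xb l'.
    by apply: cvg_dot => //; exact: cvg_cst.
  have Lh : (fun k => dot x (h_ k)) @ F --> dot x H.
    by apply: cvg_dot => //; exact: cvg_cst.
  have deE k : t k * dot xb (de k) = dot xb (l_ k) - dot xb l.
    by rewrite -dotZr -dotBr l_E [l + _]addrC addrK.
  apply/le_anti/andP; split.
    apply/ler_addgt0Pl => eps eps0; rewrite -subr_ge0.
    have L : (fun k => eps + dot x (h_ k) - dot xb (de k)) @ F -->
        eps + dot x H - dot xb l'.
      by apply: cvgB => //; apply: cvgD => //; exact: cvg_cst.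
    apply: (cvg_lim_ge0 L).
    near=> k; rewrite /= subr_ge0 -(ler_pM2l (t0 k)) deE.
    have th_k : gs (l_ k) = (th_ k)%:E by near: k.
    have : th_ k - ths - t k * dot x (h_ k) <= eps * t k.
      by rewrite /ths; near: k; exact: th_le.
    have := xb_sub (l_ k); rewrite th_k lee_fin dotBr.
    lra.
  rewrite -subr_ge0; apply: (cvg_lim_ge0 (cvgB Lde Lh)).
  near=> k; rewrite /= subr_ge0 -(ler_pM2l (t0 k)) deE.
  have := ss_fan ss x (s + t k *: h_ k); rewrite dotDr dotZr xs -/(l_ k) -/xb.
  lra.
have [U [V_ [GU sU GV M1P [M2 M2P]]]] := ss_tangent ss FU t0 t_cvg h_cvg de_cvg.
rewrite -/l in sU M2P.
have [c1 c10 Hc1] := @dot_bound R X.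
have dot_le (y z : X) : dot y z <= c1 * (`|y| * `|z|).
  by apply: le_trans (ler_norm _) _; exact: Hc1.
have sl : spec (dg l) = l by exact: spec_dg_spec.
have [tau tau0 stau] := spec_range_direction sl t0 (fun k => spec_dg_spec _) de_cvg.
have [U' GU' UK] := ss_inv ss GU.
set Y := U' x.
have sY : spec Y = xb by rewrite /Y (ss_spec ss GU').
have YE z : dot Y z = dot x (U z) by rewrite -(ss_dot ss GU) UK.
have Yl : dot Y (dg l) = dot xb l by rewrite YE -sU.
have dgE a : dg (l + a *: l') = dg l + a *: dg l' by rewrite linearD linearZ.
have Yl' : dot Y (dg l') = dot xb l'.
  apply/le_anti/andP; split.
    have := ss_fan ss Y (dg (l + tau *: l')).
    rewrite stau sY dgE !dotDr Yl lerD2l !dotZr ler_pM2l//.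
  rewrite xbl' -subr_ge0 YE; have [M1 M1l'] := M1P (dg l').
  pose Cst := c1 * (`|x| * M1) + c1 * (`|x| * M2).
  have L : (fun k => dot x (U (dg l')) - dot x H + t k * Cst) @ F -->
      dot x (U (dg l')) - dot x H + 0 * Cst.
    by apply: cvgD; [exact: cvg_cst|exact: cvgMr_tmp].
  rewrite mul0r addr0 in L; apply: (cvg_lim_ge0 L); near=> k.
  have tk := t0 k.
  have e1 : dot x (V_ k (dg l')) - dot x (U (dg l')) <= c1 * (`|x| * (M1 * t k)).
    rewrite -dotBr; apply: le_trans (dot_le _ _) _; rewrite ler_pM2l// ler_wpM2l//.
    by near: k.
  have e2 : - (dot x (V_ k (dg (l + t k *: l'))) - dot x s - t k * dot x H)
      <= c1 * (`|x| * (M2 * t k ^+ 2)).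
    rewrite -dotZr -!dotBr -dotNr; apply: le_trans (dot_le _ _) _.
    by rewrite normrN ler_pM2l// ler_wpM2l//; near: k.
  have e3 : dot x (V_ k (dg l)) <= dot xb l.
    by apply: le_trans (ss_fan ss _ _) _; rewrite (ss_spec ss (GV k)) sl.
  move: e2; rewrite dgE (ss_add _ _ (GV k)) (ss_scale _ _ (GV k)) dotDr dotZr xs.
  rewrite expr2 => e2; rewrite -(pmulr_rge0 _ tk) /Cst.
  have := ler_wpM2l (ltW tk) e1.
  move: e2 e3; set A1 := dot x (V_ k (dg l)); set A2 := dot x (V_ k (dg l')).
  set A3 := dot x (U (dg l')); set A4 := dot x H; set A5 := dot xb l.
  nra.
(* Fan's inequality is an equality for [Y] and [dg l], and again for [Y + dg l]
   and [dg (l + tau *: l')], so the three have a common ordered frame. *)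
have [V [GV0 YV lV l'V]] : exists V, [/\ G V, Y = V (dg xb), dg l = V (dg l) &
    dg l' = V (dg l')].
  set lt := l + tau *: l' in stau.
  have [W1 GW1 W1E] := ss_diag ss (Y + dg l).
  have Yl_fan : dot Y (dg l) = dot (spec Y) (spec (dg l)) by rewrite sY sl Yl.
  have [_ _ sYl] := fan_equality GW1 W1E Yl_fan.
  have [V GV0 VE] := ss_diag ss (Y + dg l + dg lt).
  have fan2 : dot (Y + dg l) (dg lt) = dot (spec (Y + dg l)) (spec (dg lt)).
    rewrite sYl sY sl stau /lt !dotDl (ss_dg ss) dgE !dotDr !dotZr.
    by rewrite Yl Yl'.
  have [YlV ltV _] := fan_equality GV0 VE fan2.
  have [YV lV _] := fan_equality GV0 YlV Yl_fan.
  rewrite sl in lV; exists V; split => //; first by rewrite -sY.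
  have tn : tau != 0 by rewrite gt_eqF.
  apply: (scalerI tn).
  move: ltV; rewrite stau /lt dgE (ss_add _ _ GV0) (ss_scale _ _ GV0).
  by rewrite -lV => /addrI.
have xUV : x = U (V (dg xb)) by rewrite -YV UK.
(* The normal [(xb, -1)] to the epigraph of [gs] turns regularity of that set
   into a comparison of values minus linearisations. *)
pose r_ k : R^o := (t k)^-1 * (th_ k - ths).
have r_cvg : r_ @ F --> (dot x H : R^o).
  have Lh : (fun k => dot x (h_ k)) @ F --> dot x H.
    by apply: cvg_dot => //; exact: cvg_cst.
  move/cvgrPdist_le: Lh => Lh.
  apply/cvgrPdist_le => eps eps0; have e20 : 0 < eps / 2 by rewrite divr_gt0.
  near=> k; have tk := t0 k.
  have th_k : gs (l_ k) = (th_ k)%:E by near: k.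
  have h1 : `|dot x H - dot x (h_ k)| <= eps / 2.
    by near: k; exact: Lh.
  have h2 : th_ k - ths - t k * dot x (h_ k) <= eps / 2 * t k.
    by rewrite /ths; near: k; exact: th_le.
  have h3 := thk _ th_k.
  have rE : r_ k - dot x (h_ k) = (t k)^-1 * (th_ k - ths - t k * dot x (h_ k)).
    by rewrite /r_ [RHS]mulrBr mulrA mulVf// mul1r.
  have h4 : 0 <= r_ k - dot x (h_ k) <= eps / 2.
    rewrite rE mulr_ge0 ?invr_ge0 ?(ltW tk)//=; last by rewrite subr_ge0.
    by rewrite ler_pdivrMl// [leRHS]mulrC.
  move: h1 h4; rewrite !ler_norml => /andP[? ?] /andP[? ?]; apply/andP; split; lra.
have NK z : epi gs z -> dot ((xb, -1) : 'cV[R]_n * R^o) (z - (l, ths : R^o)) <= 0.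
  rewrite /epi /= => zE; have := le_trans (xb_sub z.1) zE; rewrite lee_fin => zle.
  rewrite [leLHS]/(dot xb (z.1 - l) + (-1) * ((z.2 : R) - ths)).
  by rewrite mulN1r subr_le0 lerBrDl.
have dc : (fun k => (de k, r_ k)) @ F --> (l', dot x H : R^o) by exact: (cvg_pair de_cvg r_cvg).
have Kd : \forall k \near F, epi gs ((l, ths : R^o) + t k *: (de k, r_ k)).
  near=> k; have th_k : gs (l_ k) = (th_ k)%:E by near: k.
  rewrite /epi /= -l_E th_k lee_fin.
  have E : th_ k = ths + t k * ((t k)^-1 * (th_ k - ths)).
    by rewrite mulrA mulfV// mul1r addrC subrK.
  by rewrite {1}E; exact: lexx.
have Nd : dot ((xb, -1) : 'cV[R]_n * R^o) (l', dot x H : R^o) = 0.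
  have E : dot xb l' + (-1) * dot x H = 0 by rewrite xbl' mulN1r subrr.
  exact: E.
have [M [e_ [eM e_le]]] := reg _ NK F _ t _ _ t0 t_cvg dc Kd Nd.
pose m_ k : 'cV[R]_n := l + t k *: l' + t k ^+ 2 *: (e_ k).1.
pose rho_ k : R := ths + t k * dot x H + t k ^+ 2 * (e_ k).2.
(* [V] fixes the first-order part of [m_ k], so [s_ k] follows the line [s + t k *: H]. *)
pose s_ k := V_ k (V (dg (m_ k))).
pose w_ k := (t k ^+ 2 / 2)^-1 *: (s_ k - s - t k *: H).
have w_E k : (t k ^+ 2 / 2) *: w_ k = s_ k - s - t k *: H.
  by rewrite /w_ scalerA mulfV ?scale1r// mulf_neq0 ?expf_neq0.
have s_E k : s_ k - s - t k *: H = (V_ k (dg (l + t k *: l')) - s - t k *: H)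
    + t k ^+ 2 *: V_ k (V (dg (e_ k).1)).
  rewrite /s_ /m_ linearD linearZ (ss_add _ _ GV0) (ss_add _ _ (GV k)).
  rewrite (ss_scale _ _ GV0) (ss_scale _ _ (GV k)) dgE (ss_add _ _ GV0) (ss_scale _ _ GV0).
  rewrite -lV -l'V -!addrA; congr (_ + _).
  by rewrite [in RHS]addrA [RHS]addrC.
have [ci ci0 Hci] := @norm_le_of_dot R X.
have [cd cd0 Hcd] := linear_bounded_euclid dg.
have dgM : \forall k \near F, `|V_ k (V (dg (e_ k).1))| <= ci * (cd * M).
  near=> k; have [ek _] : `|e_ k| <= M /\ epi gs ((l, ths : R^o) +
    t k *: (l', dot x H : R^o) + t k ^+ 2 *: e_ k) by near: k.
  apply: (le_trans (Hci _ (dg (e_ k).1) _)).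
    by rewrite (ss_dot ss (GV k)) (ss_dot ss GV0).
  rewrite ler_pM2l//; apply: le_trans (Hcd _) _; rewrite ler_pM2l//.
  by apply: le_trans ek; rewrite [leRHS]/Num.norm/= le_max lexx.
have [w w_cvg] : exists w : X, w_ @ F --> w.
  apply: (ultra_cvg_bounded (M := 2 * (M2 + ci * (cd * M)))); near=> k.
  have t2 : 0 < t k ^+ 2 by rewrite exprn_gt0.
  rewrite /w_ normrZ gtr0_norm ?invr_gt0 ?divr_gt0// ler_pdivrMl ?divr_gt0//.
  have -> : t k ^+ 2 / 2 * (2 * (M2 + ci * (cd * M)))
      = M2 * t k ^+ 2 + t k ^+ 2 * (ci * (cd * M)) by field.
  rewrite s_E; apply: le_trans (ler_normD _ _) _; apply: lerD; first by near: k.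
  by rewrite normrZ gtr0_norm// ler_pM2l//; near: k.
have [M1 M1R] := M1P (V (dg xb)).
exists w_, w; split=> // eps eps0.
have eps20 : 0 < eps / 2 by rewrite divr_gt0.
pose A := c1 * `|M1| + 1.
have A0 : 0 < A by rewrite ltr_wpDl// mulr_ge0// ltW.
have small : \forall k \near F, `|h_ k - H| + `|t k / 2| * `|w_ k| <= eps / 2 / A.
  have L : (fun k => `|h_ k - H| + `|t k / 2| * `|w_ k|) @ F --> 0 + `|0 / 2 : R| * `|w|.
    apply: cvgD; first by apply/norm_cvg0P/subr_cvg0.
    by apply: cvgM; apply: cvg_norm => //; exact: cvgMr_tmp.
  rewrite mul0r normr0 mul0r addr0 in L; near=> k; apply: ltW; near: k.
  by apply: (cvgr_lt _ L); exact: divr_gt0.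
near=> k; rewrite w_E; have tk := t0 k.
have -> : s + t k *: H + (s_ k - s - t k *: H) = s_ k.
  exact: cancel_sum.
have -> : t k *: H + (s_ k - s - t k *: H) - t k *: h_ k = - (s + t k *: h_ k - s_ k).
  exact: cancel_step.
have [_ Km] : `|e_ k| <= M /\ epi gs ((l, ths : R^o) +
    t k *: (l', dot x H : R^o) + t k ^+ 2 *: e_ k) by near: k.
have gm : (gs (spec (s_ k)) <= (rho_ k)%:E)%E.
  by rewrite /s_ (ss_spec ss (GV k)) (ss_spec ss GV0) gsym; exact: Km.
apply: le_trans gm _; rewrite lee_fin dotNr.
have e1 : dot xb (de k - l' - t k *: (e_ k).1) - (r_ k - dot x H - t k * (e_ k).2)
    <= eps / 2 * t k.
  have E : dot ((xb, -1) : 'cV[R]_n * R^o) ((de k, r_ k) - (l', dot x H : R^o) - t k *: e_ k)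
      = dot xb (de k - l' - t k *: (e_ k).1) - (r_ k - dot x H - t k * (e_ k).2).
    by rewrite -[X in _ = _ - X]mul1r -mulNr.
  by rewrite -E; near: k; exact: e_le.
have lm : l_ k - m_ k = t k *: (de k - l' - t k *: (e_ k).1).
  rewrite l_E /m_ -(addrA l (t k *: l')) opprD addrACA subrr add0r opprD addrA.
  by rewrite !scalerBr [X in _ = _ - X]scalerA -expr2.
have trE : t k * (r_ k - dot x H - t k * (e_ k).2) = th_ k - rho_ k.
  suff E (c2 : R) : t k * ((t k)^-1 * (th_ k - ths) - dot x H - t k * c2)
      = th_ k - (ths + t k * dot x H + t k ^+ 2 * c2) by exact: E.
  by field.
have R0 : `|V_ k (V (dg xb)) - U (V (dg xb))| <= M1 * t k by near: k.
rewrite -xUV in R0; set Rk := V_ k (V (dg xb)) in R0.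
have sRk : spec Rk = xb.
  by rewrite /Rk (ss_spec ss (GV k)) (ss_spec ss GV0) /xb spec_dg_spec.
have fan1 : dot Rk (s + t k *: h_ k) <= dot xb (l_ k).
  by rewrite -sRk; exact: (ss_fan ss).
have Rks : dot Rk (s_ k) = dot xb (m_ k).
  by rewrite /Rk /s_ (ss_dot ss (GV k)) (ss_dot ss GV0) (ss_dg ss).
have diffE : s + t k *: h_ k - s_ k = t k *: (h_ k - H - (t k / 2) *: w_ k).
  by rewrite !scalerBr scalerA mulrA -expr2 w_E cancel_diff.
have err : - dot (Rk - x) (s + t k *: h_ k - s_ k) <= eps / 2 * t k ^+ 2.
  rewrite -dotNl; apply: le_trans (dot_le _ _) _; rewrite normrN diffE normrZ.
  rewrite (gtr0_norm tk).
  have R1 : `|Rk - x| <= `|M1| * t k.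
    apply: (@le_trans _ _ (M1 * t k)); first exact: R0.
    by rewrite ler_pM2r// ler_norm.
  have R2 : `|h_ k - H - (t k / 2) *: w_ k| <= eps / 2 / A.
    apply: le_trans (ler_normB _ _) _; rewrite normrZ; near: k; exact: small.
  apply: (@le_trans _ _ (c1 * ((`|M1| * t k) * (t k * (eps / 2 / A))))).
    by rewrite ler_pM2l// ler_pM// ?mulr_ge0 ?(ltW tk)// ler_pM2l.
  have -> : c1 * ((`|M1| * t k) * (t k * (eps / 2 / A))) = (c1 * `|M1|) * (t k ^+ 2 * (eps / 2 / A)) by ring.
  have -> : eps / 2 * t k ^+ 2 = A * (t k ^+ 2 * (eps / 2 / A)) by field; rewrite gt_eqF.
  apply: ler_wpM2r; last by rewrite /A lerDl.
  by rewrite mulr_ge0 ?sqr_ge0// ltW// divr_gt0.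
have e2 : dot xb (l_ k) - dot xb (m_ k) - (th_ k - rho_ k) <= eps / 2 * t k ^+ 2.
  rewrite -dotBr lm dotZr -trE -mulrBr expr2 mulrA [leRHS]mulrC.
  by rewrite ler_pM2l.
move: err fan1; rewrite dotBl [dot Rk (_ - _)]dotBr Rks.
lra.
Unshelve. all: by end_near. Qed.

End SpectralSystem.

(** * Orthogonal matrices *)

Section Orthogonal.
Context {R : realType}.

Definition orthogonal_mx n (P : 'M[R]_n) := P^T *m P = 1%:M.

Lemma orthogonal_mxr n (P : 'M[R]_n) : orthogonal_mx P -> P *m P^T = 1%:M.
Proof. exact: mulmx1C. Qed.

Lemma orthogonal_mx1 n : orthogonal_mx (1%:M : 'M[R]_n).
Proof. by rewrite /orthogonal_mx trmx1 mulmx1. Qed.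

Lemma orthogonal_mxT n (P : 'M[R]_n) : orthogonal_mx P -> orthogonal_mx P^T.
Proof. by move=> /orthogonal_mxr; rewrite /orthogonal_mx trmxK. Qed.

Lemma orthogonal_mxM n (P Q : 'M[R]_n) :
  orthogonal_mx P -> orthogonal_mx Q -> orthogonal_mx (P *m Q).
Proof.
move=> oP oQ; rewrite /orthogonal_mx trmx_mul mulmxA -(mulmxA Q^T) oP mulmx1.
exact: oQ.
Qed.

Lemma orthogonal_mx_perm n (s : 'S_n) : orthogonal_mx (perm_mx s : 'M[R]_n).
Proof.
by rewrite /orthogonal_mx tr_perm_mx -perm_mxM mulVg perm_mx1.
Qed.

Lemma orthogonal_mx_block n (Q : 'M[R]_n) : orthogonal_mx Q ->
  orthogonal_mx (block_mx 1%:M 0 0 Q : 'M[R]_(1 + n)).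
Proof.
move=> oQ; rewrite /orthogonal_mx tr_block_mx mulmx_block !trmx0 trmx1.
by rewrite !mulmx0 !mul0mx !addr0 add0r mulmx1 oQ -scalar_mx_block.
Qed.

Lemma dot_colE n (u v : 'cV[R]_n) : dot u v = (u^T *m v) 0 0.
Proof. by rewrite /dot/= /mxdot /mxtrace big_ord1. Qed.

Lemma dot_mxE m n (A B : 'M[R]_(m, n)) : dot A B = \tr (A^T *m B).
Proof. by []. Qed.

Lemma dot_mulmxl m n p (P : 'M[R]_(m, p)) (A : 'M[R]_(p, n)) B :
  dot (P *m A) B = dot A (P^T *m B).
Proof. by rewrite !dot_mxE trmx_mul mulmxA. Qed.

Lemma dot_trmx m n (A B : 'M[R]_(m, n)) : dot A^T B^T = dot A B.
Proof. by rewrite !dot_mxE trmxK mxtrace_mulC -mxtrace_tr trmx_mul trmxK. Qed.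

Lemma dot_mulmxr m n p (P : 'M[R]_(n, p)) (A : 'M[R]_(m, n)) B :
  dot (A *m P) B = dot A (B *m P^T).
Proof. by rewrite -dot_trmx trmx_mul dot_mulmxl -dot_trmx trmxK trmx_mul !trmxK. Qed.

Lemma dot_orthogonal m n (P : 'M[R]_m) (Q : 'M[R]_n) (A B : 'M[R]_(m, n)) :
  orthogonal_mx P -> orthogonal_mx Q ->
  dot (P *m A *m Q^T) (P *m B *m Q^T) = dot A B.
Proof.
move=> oP oQ; rewrite dot_mulmxr trmxK -[P *m B *m _ *m _]mulmxA oQ mulmx1.
by rewrite dot_mulmxl mulmxA oP mul1mx.
Qed.

Lemma mul_col_dot n (u v w : 'cV[R]_n) : u *m v^T *m w = dot v w *: u.
Proof.
rewrite -mulmxA [v^T *m w]mx11_scalar mul_mx_scalar; congr (_ *: _).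
by rewrite dot_colE.
Qed.

Lemma householder n (w : 'cV[R]_n) : w != 0 ->
  exists2 P : 'M[R]_n, orthogonal_mx P &
    forall v, P *m v = v - (2 * dot w v / dot w w) *: w.
Proof.
move=> w0; have d0 : dot w w != 0 by rewrite gt_eqF ?dot_gt0.
pose P := 1%:M - (2 / dot w w) *: (w *m w^T).
have PT : P^T = P by rewrite /P linearB linearZ/= trmx1 trmx_mul trmxK.
have Pv (v : 'cV_n) : P *m v = v - (2 * dot w v / dot w w) *: w.
  by rewrite mulmxBl mul1mx -scalemxAl mul_col_dot scalerA mulrAC.
exists P => //; rewrite /orthogonal_mx PT; apply/matrixP => i j.
have E : P *m (P *m delta_mx j 0) = delta_mx j 0 :> 'cV_n.
  rewrite !Pv dotBr dotZr -addrA -opprD -scalerDl.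
  set q := dot w _; rewrite (_ : _ / _ + _ = 0) ?scale0r ?subr0//.
  by field.
have := congr1 (fun A : 'cV_n => A i 0) E.
by rewrite mulmxA -colE !mxE eqxx andbT.
Qed.

(** Householder reflections act transitively on the unit sphere. *)
Lemma orthogonal_first_col n (u : 'cV[R]_(1 + n)) : dot u u = 1 ->
  exists2 P : 'M[R]_(1 + n), orthogonal_mx P & P *m delta_mx 0 0 = u.
Proof.
move=> uu; set e0 : 'cV_(1 + n) := delta_mx 0 0.
have e00 : dot e0 e0 = 1 by rewrite dot_colE trmx_delta mul_delta_mx mxE !eqxx.
have [->|ue0] := eqVneq u e0.
  by exists 1%:M; [exact: orthogonal_mx1|rewrite mul1mx].
have w0 : u - e0 != 0 by rewrite subr_eq0.
have d0 : dot (u - e0) (u - e0) != 0 by rewrite gt_eqF ?dot_gt0.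
have [P oP Pv] := householder w0; exists P => //.
rewrite Pv (_ : _ / _ = -1) ?scaleN1r ?opprK; first by rewrite addrC subrK.
move: d0; rewrite !dotBl !dotBr uu e00 (dotC e0 u) => d0.
by field.
Qed.

End Orthogonal.

(** * Spectral theorem and eigenvalues of symmetric matrices *)

Section Spectrum.
Context {R : realType}.

Lemma symmetric_eigenvector n (A : 'M[R]_(1 + n)) : A^T = A ->
  exists (a : R) (u : 'cV[R]_(1 + n)), dot u u = 1 /\ A *m u = a *: u.
Proof.
move=> sA; have [_ cpA] : is_eigvals A (eigvals A) by apply: eigvalsP; exact/eqP.
pose a := eigvals A 0 0.
have /eigenvalueP[v vA v0] : eigenvalue A a.
  rewrite eigenvalue_root_char cpA (bigD1 ord0)//= rootM.
  by rewrite (_ : eigvals A ord0 0 = a) ?root_XsubC ?eqxx.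
have v0' : v^T != 0 by rewrite trmx_eq0.
exists a, ((enorm v^T)^-1 *: v^T); split.
  rewrite dotZl dotZr mulrA -invfM -expr2 enorm_sqr mulVf// gt_eqF// dot_gt0//.
rewrite -scalemxAr scalerA mulrC -scalerA; congr (_ *: _).
by rewrite -[A]sA -trmx_mul vA linearZ.
Qed.

(** Deflation: a reflection moves a unit eigenvector to the first basis vector. *)
Theorem spectral_theorem n (A : 'M[R]_n) : A^T = A ->
  exists2 P : 'M[R]_n, orthogonal_mx P & exists x : 'cV[R]_n, A = P *m diag_mx x^T *m P^T.
Proof.
elim: n A => [|n IHn] A sA.
  by exists 1%:M; [exact: orthogonal_mx1|exists 0; rewrite [LHS]thinmx0 [RHS]thinmx0].
have [a [u [uu Au]]] := symmetric_eigenvector (n := n) sA.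
have [P oP Pe] := orthogonal_first_col uu.
have [B [sB Be ->]] : exists B : 'M[R]_(1 + n), [/\ B^T = B,
    B *m delta_mx 0 0 = a *: (delta_mx 0 0 : 'cV_(1 + n)) & A = P *m B *m P^T].
  exists (P^T *m A *m P); split; first by rewrite !trmx_mul trmxK sA mulmxA.
    by rewrite -!mulmxA Pe Au -scalemxAr -Pe mulmxA oP mul1mx.
  by rewrite !mulmxA orthogonal_mxr// mul1mx -mulmxA orthogonal_mxr// mulmx1.
have Bcol i : B i 0 = a * (i == 0)%:R.
  have := congr1 (fun v : 'cV_(1 + n) => v i 0) Be.
  by rewrite -colE !mxE eqxx andbT.
have Bblock : B = block_mx a%:M 0 0 (drsubmx B).
  have ul : ulsubmx B = a%:M.
    apply/matrixP => i j; rewrite !ord1 mxE !mxE [lshift _ _](_ : _ = 0); last exact: val_inj.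
    by rewrite Bcol eqxx mulr1 mulr1n.
  have dl : dlsubmx B = 0.
    apply/matrixP => i j; rewrite !ord1 mxE !mxE [lshift _ _](_ : _ = 0); last exact: val_inj.
    by rewrite Bcol mulr0.
  have ur : ursubmx B = 0.
    by rewrite -[LHS]trmxK trmx_ursub sB dl trmx0.
  by rewrite -[LHS]submxK ul dl ur.
have sB' : (drsubmx B)^T = drsubmx B by rewrite trmx_drsub sB.
have [Q oQ [x xE]] := IHn _ sB'.
set Q' : 'M[R]_(1 + n) := block_mx 1%:M 0 0 Q.
have oQ' : orthogonal_mx Q' by exact: orthogonal_mx_block.
have BE : B = Q' *m block_mx a%:M 0 0 (diag_mx x^T) *m Q'^T.
  rewrite Bblock xE /Q' tr_block_mx !trmx0 trmx1 !mulmx_block.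
  by rewrite !(mulmx0, mul0mx, addr0, add0r, mul1mx, mulmx1).
exists (P *m Q'); first exact: orthogonal_mxM.
exists (col_mx a%:M x).
have diagE : diag_mx (col_mx (a%:M : 'cV_1) x)^T = block_mx a%:M 0 0 (diag_mx x^T).
  rewrite tr_col_mx diag_mx_row; congr block_mx.
  by apply/matrixP => i j; rewrite !ord1 !mxE.
by rewrite [diag_mx _]diagE BE trmx_mul !mulmxA.
Qed.

Lemma char_poly_diag n (x : 'cV[R]_n) :
  char_poly (diag_mx x^T) = \prod_i ('X - (x i 0)%:P).
Proof.
rewrite char_poly_trig ?diag_mx_is_trig//; apply: eq_bigr => i _.
by rewrite !mxE eqxx mulr1n.
Qed.

Lemma eigvals_conj n (P A : 'M[R]_n) : orthogonal_mx P ->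
  eigvals (P *m A *m P^T) = eigvals A.
Proof.
move=> oP; rewrite /eigvals; congr (xget _ _).
have PU : P^T \in unitmx by apply: (proj2 (mulmx1_unit (orthogonal_mxr oP))).
have inv : invmx P^T = P.
  by rewrite -[RHS]mulmx1 -(mulmxV PU) mulmxA orthogonal_mxr// mul1mx.
have cpE : char_poly (P *m A *m P^T) = char_poly A by rewrite -{1}inv char_poly_conj.
by apply/seteqP; split=> l []; rewrite /is_eigvals cpE.
Qed.

(** Unique factorisation identifies the multisets of roots. *)
Lemma prod_XsubC_perm n (x y : 'cV[R]_n) :
  \prod_i ('X - (x i 0)%:P) = \prod_i ('X - (y i 0)%:P) ->
  exists s : 'S_n, forall i, y i 0 = x (s i) 0.
Proof.
move=> xy.
have pe : perm_eq [tuple y i 0 | i < n] [tuple x i 0 | i < n].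
  apply: prod_XsubC_eq; rewrite !big_tuple.
  under eq_bigr do rewrite tnth_mktuple.
  by under [RHS]eq_bigr do rewrite tnth_mktuple.
have /tuple_permP[s sE] := pe; exists s => i.
have /(congr1 (fun t => nth 0 t i)) := sE.
by rewrite -!tnth_nth !tnth_mktuple.
Qed.

Definition sorted_col n (x : 'cV[R]_n) := forall i j : 'I_n, (i <= j)%N -> x j 0 <= x i 0.

Lemma sorted_perm_eq n (x y : 'cV[R]_n) (s : 'S_n) : sorted_col x -> sorted_col y ->
  (forall i, y i 0 = x (s i) 0) -> y = x.
Proof.
move=> sx sy xy.
pose tx := [tuple x i 0 | i < n]; pose ty := [tuple y i 0 | i < n].
have sorted_t (z : 'cV[R]_n) : sorted_col z -> sorted >=%O [tuple z i 0 | i < n].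
  move=> sz; apply/(sortedP 0) => i; rewrite size_tuple => ilt.
  have i1 := ltnW ilt.
  have tE j (jn : (j < n)%N) : nth 0 [tuple z i 0 | i < n] j = z (Ordinal jn) 0.
    by rewrite -[X in nth _ _ X]/(nat_of_ord (Ordinal jn)) -tnth_nth tnth_mktuple.
  by rewrite (tE _ i1) (tE _ ilt) /= sz.
have pe : perm_eq ty tx.
  apply/tuple_permP; exists s; congr val; apply: eq_mktuple => i.
  by rewrite tnth_mktuple xy.
have tE : ty = tx.
  apply: val_inj; apply: (sorted_eq (leT := >=%O)) => //; try exact: sorted_t.
  - by move=> a b c ab bc; exact: le_trans bc ab.
  - by move=> a b; rewrite andbC => /le_anti.
apply/colP => i; have := congr1 (fun t => tnth t i) tE.
by rewrite !tnth_mktuple.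
Qed.

Lemma eigvals_unique n (A : 'M[R]_n) l : is_eigvals A l -> eigvals A = l.
Proof.
move=> Al; have [sl cl] := Al.
have [se ce] : is_eigvals A (eigvals A) by apply: (xgetPex 0); exists l.
have [s sE] := prod_XsubC_perm (etrans (esym cl) ce).
exact: sorted_perm_eq sl se sE.
Qed.

Lemma eigvals_sorted n (A : 'M[R]_n) : A^T = A -> sorted_col (eigvals A).
Proof. by move=> sA; have [] : is_eigvals A (eigvals A) by apply: eigvalsP; exact/eqP. Qed.

Lemma tr_diag_col n (x : 'cV[R]_n) : (diag_mx x^T)^T = diag_mx x^T.
Proof. exact: tr_diag_mx. Qed.

Lemma eigvals_diag_perm n (x : 'cV[R]_n) :
  exists s : 'S_n, eigvals (diag_mx x^T) = perm_mx s *m x.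
Proof.
have [_ cE] : is_eigvals (diag_mx x^T) (eigvals (diag_mx x^T)).
  by apply: eigvalsP; apply/eqP; exact: tr_diag_col.
have [s sE] := prod_XsubC_perm (etrans (esym (char_poly_diag x)) cE).
exists s; apply/colP => i; rewrite sE -row_permE mxE; congr (x _ _).
Qed.

Lemma eigvals_diagE n (x : 'cV[R]_n) : eigvals (diag_mx x^T) = x <-> sorted_col x.
Proof.
split=> [<-|sx]; first exact/eigvals_sorted/tr_diag_col.
by apply: eigvals_unique; split => //; exact: char_poly_diag.
Qed.

Lemma spectral_decomposition n (A : 'M[R]_n) : A^T = A ->
  exists2 P : 'M[R]_n, orthogonal_mx P & A = P *m diag_mx (eigvals A)^T *m P^T.
Proof.
move=> sA; have [P oP [x AE]] := spectral_theorem sA.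
have eA : eigvals A = eigvals (diag_mx x^T) by rewrite AE eigvals_conj.
have [s sE] := eigvals_diag_perm x.
exists (P *m (perm_mx s)^T).
  by apply: orthogonal_mxM => //; apply/orthogonal_mxT/orthogonal_mx_perm.
rewrite eA sE AE [(P *m _)^T]trmx_mul trmxK !mulmxA; congr (_ *m _); rewrite -!mulmxA; congr (_ *m _).
have dE i : (perm_mx s *m x) i 0 = x (s i) 0 by rewrite -row_permE mxE.
move: (perm_mx s *m x) dE => c dE.
apply/matrixP => i j; rewrite mul_diag_mx tr_perm_mx -row_permE !mxE.
by rewrite dE permKV mulr_natr.
Qed.

End Spectrum.

(** * Rearrangement and Fan's inequality *)

Section Rearrangement.
Context {R : realType}.

(** Dual potentials of the assignment problem with cost [a i * b j]: their
    discrete derivative is [a] with respect to [b].  The sequences are extended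
    by [0], so that the potentials of nonnegative sequences are nonnegative. *)
Lemma rearrangement_potentials n (a b : 'cV[R]_n) : sorted_col a -> sorted_col b ->
  exists u v : 'I_n -> R, [/\ forall i j, a i 0 * b j 0 <= u i + v j,
    forall i, u i + v i = a i 0 * b i 0 &
    (forall i, 0 <= a i 0) -> (forall i, 0 <= b i 0) ->
      forall i, 0 <= u i /\ 0 <= v i].
Proof.
move=> sa sb.
pose ext (c : 'cV[R]_n) (k : nat) : R := if insub k is Some i then c i 0 else 0.
have extE c (i : 'I_n) : ext c i = c i 0 by rewrite /ext valK.
have extn c : ext c n = 0 by rewrite /ext insubF// ltnn.
have ext_le c (k l : nat) : sorted_col c -> (k <= l)%N -> (l < n)%N -> ext c l <= ext c k.
  move=> sc kl ln; have kn := leq_ltn_trans kl ln.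
  by rewrite (extE c (Ordinal ln)) (extE c (Ordinal kn)) sc.
pose v (j : nat) := \sum_(j <= k < n) ext a k * (ext b k - ext b k.+1).
have vB (i j : nat) : (i <= j)%N -> (j <= n)%N ->
    v i - v j = \sum_(i <= k < j) ext a k * (ext b k - ext b k.+1).
  by move=> ij jn; rewrite /v (big_cat_nat ij jn)/= addrK.
have bB (i j : nat) : (i <= j)%N -> \sum_(i <= k < j) (ext b k - ext b k.+1) = ext b i - ext b j.
  move=> ij; rewrite -[RHS]opprB -(telescope_sumr _ ij) -sumrN.
  by apply: eq_bigr => k _; rewrite opprB.
have b_step (k j : nat) : (k < j)%N -> (j < n)%N \/ (j = n /\ forall i, 0 <= b i 0) ->
    0 <= ext b k - ext b k.+1.
  move=> kj; rewrite subr_ge0; case=> [jn|[jn b0]].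
    by apply: ext_le => //; exact: leq_ltn_trans jn.
  have [k1|k1] := ltnP k.+1 n; first exact: ext_le.
  have -> : k.+1 = n by apply/eqP; rewrite eqn_leq k1 -jn andbT.
  have kn : (k < n)%N by rewrite -jn.
  by rewrite extn (extE b (Ordinal kn)).
have v_up (i j : nat) : (i <= j)%N -> (i < n)%N -> (j < n)%N \/ (j = n /\ forall i, 0 <= b i 0) ->
    v i - v j <= ext a i * (ext b i - ext b j).
  move=> ij iN jn; have jn' : (j <= n)%N by case: jn => [/ltnW|[->]].
  rewrite vB// -(bB _ _ ij) mulr_sumr; rewrite !big_nat; apply: ler_sum => k /andP[ik kj].
  apply: ler_wpM2r; first exact: b_step kj jn.
  by apply: ext_le => //; exact: leq_trans kj jn'.
have v_dn (i j : nat) : (i <= j)%N -> (j < n)%N ->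
    ext a j * (ext b i - ext b j) <= v i - v j.
  move=> ij jn; rewrite (vB _ _ ij (ltnW jn)) -(bB _ _ ij) mulr_sumr !big_nat.
  apply: ler_sum => k /andP[ik kj].
  apply: ler_wpM2r; first by apply: (b_step k j kj); left.
  by apply: ext_le => //; exact: ltnW.
exists (fun i : 'I_n => a i 0 * b i 0 - v i), (fun i : 'I_n => v i); split.
- move=> i j; have [ij|/ltnW ji] := leqP i j.
    have := v_up i j ij (ltn_ord i) (or_introl (ltn_ord j)).
    by rewrite !extE; lra.
  by have := v_dn j i ji (ltn_ord i); rewrite !extE; lra.
- by move=> i; rewrite subrK.
move=> a0 b0 i; split.
  have := v_up i n (ltnW (ltn_ord i)) (ltn_ord i) (or_intror (conj erefl b0)).
  rewrite !extE extn subr0 {2}/v big_geq// subr0; lra.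
rewrite /v big_nat; apply: sumr_ge0 => k /andP[ik kn].
apply: mulr_ge0; first by rewrite (extE a (Ordinal kn)).
by apply: (b_step k n kn); right.
Qed.

Lemma rearrangement_stochastic n (a b : 'cV[R]_n) (S : 'M[R]_n) :
  sorted_col a -> sorted_col b -> (forall i j, 0 <= S i j) ->
  (forall i, \sum_j S i j = 1) -> (forall j, \sum_i S i j = 1) ->
  \sum_i \sum_j a i 0 * b j 0 * S i j <= dot a b.
Proof.
move=> sa sb S0 Sr Sc; have [u [v [uv uvE _]]] := rearrangement_potentials sa sb.
apply: (@le_trans _ _ (\sum_i \sum_j (u i + v j) * S i j)).
  by apply: ler_sum => i _; apply: ler_sum => j _; exact: ler_wpM2r.
have -> : \sum_i \sum_j (u i + v j) * S i j = \sum_i (u i + v i).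
  under eq_bigr do (under eq_bigr do rewrite mulrDl; rewrite big_split/=).
  rewrite !big_split/=; congr (_ + _).
    by apply: eq_bigr => i _; rewrite -mulr_sumr Sr mulr1.
  by rewrite exchange_big; apply: eq_bigr => i _; rewrite -mulr_sumr Sc mulr1.
by rewrite /dot/= mxdotE big_ord1; apply: ler_sum => i _; rewrite uvE.
Qed.

Lemma rearrangement_substochastic n (a b : 'cV[R]_n) (S : 'M[R]_n) :
  sorted_col a -> sorted_col b -> (forall i, 0 <= a i 0) -> (forall i, 0 <= b i 0) ->
  (forall i j, 0 <= S i j) ->
  (forall i, \sum_j S i j <= 1) -> (forall j, \sum_i S i j <= 1) ->
  \sum_i \sum_j a i 0 * b j 0 * S i j <= dot a b.
Proof.
move=> sa sb a0 b0 S0 Sr Sc.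
have [u [v [uv uvE /(_ a0 b0) uv0]]] := rearrangement_potentials sa sb.
apply: (@le_trans _ _ (\sum_i \sum_j (u i + v j) * S i j)).
  by apply: ler_sum => i _; apply: ler_sum => j _; exact: ler_wpM2r.
apply: (@le_trans _ _ (\sum_i (u i + v i))); last first.
  by rewrite /dot/= mxdotE big_ord1; apply: ler_sum => i _; rewrite uvE.
under eq_bigr do (under eq_bigr do rewrite mulrDl; rewrite big_split/=).
rewrite !big_split/=; apply: lerD.
  apply: ler_sum => i _; rewrite -mulr_sumr -[leRHS]mulr1; apply: ler_wpM2l => //.
  by have [] := uv0 i.
rewrite exchange_big; apply: ler_sum => i _; rewrite -mulr_sumr -[leRHS]mulr1.
by apply: ler_wpM2l => //; have [] := uv0 i.
Qed.

Lemma orthogonal_row_norm n (W : 'M[R]_n) i : orthogonal_mx W -> \sum_j W i j ^+ 2 = 1.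
Proof.
move=> /orthogonal_mxr/matrixP/(_ i i); rewrite !mxE eqxx => E; rewrite -[RHS]/(true%:R) -E.
by apply: eq_bigr => j _; rewrite mxE.
Qed.

Lemma orthogonal_col_norm n (W : 'M[R]_n) j : orthogonal_mx W -> \sum_i W i j ^+ 2 = 1.
Proof.
move=> /orthogonal_mxT/orthogonal_row_norm => /(_ j) <-.
by apply: eq_bigr => i _; rewrite mxE.
Qed.

Lemma dot_diag_conj n (a b : 'cV[R]_n) (W K : 'M[R]_n) :
  dot (diag_mx a^T) (W *m diag_mx b^T *m K^T) = \sum_i \sum_j a i 0 * b j 0 * (W i j * K i j).
Proof.
rewrite /dot/= mxdotE exchange_big/=; apply: eq_bigr => i _.
rewrite (bigD1 i)//= big1 ?addr0; last first.
  by move=> j ji; rewrite !mxE eq_sym (negbTE ji) mulr0n mul0r.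
rewrite mxE eqxx mulr1n mxE mxE mulr_sumr; apply: eq_bigr => j _.
by rewrite mul_mx_diag !mxE; ring.
Qed.

(** Fan's inequality: the squared entries of an orthogonal matrix form a doubly
    stochastic matrix. *)
Lemma fan_eigvals n (A B : 'M[R]_n) : A^T = A -> B^T = B ->
  dot A B <= dot (eigvals A) (eigvals B).
Proof.
move=> sA sB; have [P oP AE] := spectral_decomposition sA.
have [Q oQ BE] := spectral_decomposition sB.
have oW : orthogonal_mx (P^T *m Q) by apply: orthogonal_mxM => //; exact: orthogonal_mxT.
rewrite {1}AE {1}BE dot_mulmxr trmxK dot_mulmxl.
have -> : P^T *m (Q *m diag_mx (eigvals B)^T *m Q^T *m P)
    = (P^T *m Q) *m diag_mx (eigvals B)^T *m (P^T *m Q)^T.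
  by rewrite trmx_mul trmxK !mulmxA.
rewrite dot_diag_conj.
have := @rearrangement_stochastic n (eigvals A) (eigvals B)
  (\matrix_(i, j) (P^T *m Q) i j ^+ 2).
move=> /(_ (eigvals_sorted sA) (eigvals_sorted sB)).
have -> : \sum_i \sum_j eigvals A i 0 * eigvals B j 0 * ((P^T *m Q) i j * (P^T *m Q) i j)
    = \sum_i \sum_j eigvals A i 0 * eigvals B j 0 * (\matrix_(i, j) (P^T *m Q) i j ^+ 2) i j.
  by apply: eq_bigr => i _; apply: eq_bigr => j _; rewrite [in RHS]mxE expr2.
apply.
- by move=> i j; rewrite mxE sqr_ge0.
- by move=> i; under eq_bigr do rewrite mxE; exact: orthogonal_row_norm.
- by move=> i; under eq_bigr do rewrite mxE; exact: orthogonal_col_norm.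
Qed.

End Rearrangement.

(** * Singular values and von Neumann's inequality *)

Section SingularValues.
Context {R : realType}.

Definition rdiag n r (x : 'cV[R]_n) : 'M[R]_(n, n + r) := row_mx (diag_mx x^T) 0.

Fact rdiag_linear n r : linear (@rdiag n r).
Proof.
move=> a x y; rewrite /rdiag !linearP /= scale_row_mx add_row_mx scaler0 addr0.
by [].
Qed.

HB.instance Definition _ n r :=
  GRing.isLinear.Build R 'cV[R]_n 'M[R]_(n, n + r) _ (@rdiag n r) (@rdiag_linear n r).

Lemma rdiagE n r (x : 'cV[R]_n) i j : rdiag r x i j = x i 0 *+ (i == j :> nat).
Proof.
rewrite /rdiag; case: (split_ordP j) => k ->.
  by rewrite row_mxEl !mxE.
rewrite row_mxEr mxE (_ : _ == _ = false)//=.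
by apply/negbTE; rewrite neq_ltn ltn_addr.
Qed.

Lemma rdiag_mul_tr n r (x : 'cV[R]_n) :
  rdiag r x *m (rdiag r x)^T = diag_mx (\col_i x i 0 ^+ 2)^T.
Proof.
rewrite /rdiag tr_row_mx mul_row_col trmx0 mulmx0 addr0 tr_diag_col mulmx_diag.
by congr diag_mx; apply/rowP => i; rewrite !mxE expr2.
Qed.

Lemma dot_rdiag n r (x y : 'cV[R]_n) : dot (rdiag r x) (rdiag r y) = dot x y.
Proof.
rewrite !dot_mxE mxtrace_mulC /rdiag tr_row_mx mul_row_col trmx0 mulmx0 addr0.
rewrite tr_diag_col mulmx_diag mxtrace_diag /mxtrace big_ord1 mxE.
by apply: eq_bigr => i _; rewrite !mxE mulrC.
Qed.

(** A pair of unit singular vectors; when the left one lies in the kernel of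
    the transpose, the right one is taken in the kernel, which is nonzero since
    the matrix is not taller than wide. *)
Lemma singular_pair n r (B : 'M[R]_(1 + n, 1 + n + r)) :
  exists (s : R) (u : 'cV[R]_(1 + n)) (w : 'cV[R]_(1 + (n + r))),
  [/\ 0 <= s, dot u u = 1, dot w w = 1, B^T *m u = s *: w & B *m w = s *: u].
Proof.
have [|mu [u [uu BBu]]] := @symmetric_eigenvector R n (B *m B^T).
  by rewrite trmx_mul trmxK.
have [z0|z0] := eqVneq (B^T *m u) 0; last first.
  set z := B^T *m u in z0; pose s := enorm z.
  have s0 : 0 < s by exact: enorm_gt0.
  have s2 : s ^+ 2 = mu.
    by rewrite enorm_sqr {1}/z dot_mulmxl trmxK mulmxA BBu dotZr uu mulr1.
  exists s, u, (s^-1 *: z); split => //.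
  - exact: ltW.
  - by rewrite dotZl dotZr mulrA -invfM -expr2 -enorm_sqr mulVf// gt_eqF// exprn_gt0.
  - by rewrite scalerA mulfV ?gt_eqF// scale1r.
  rewrite -scalemxAr /z mulmxA BBu scalerA -s2; congr (_ *: _).
  by rewrite expr2 mulrA mulVf ?gt_eqF// mul1r.
have u0 : u != 0 by apply: contra_eq_neq uu => ->; rewrite dot0l eq_sym oner_eq0.
have rkB : (\rank B < 1 + n + r)%N.
  apply: leq_trans (leq_addr r (1 + n)); rewrite ltn_neqAle rank_leq_row andbT.
  apply: contra u0 => rf.
  have uB : u^T *m B = 0 by rewrite -[LHS]trmxK trmx_mul trmxK z0 trmx0.
  move: uB => /eqP; rewrite -(mul0mx 1 B) (inj_eq (row_free_inj rf)).
  by rewrite trmx_eq0.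
have : kermx B^T != 0 by rewrite -mxrank_eq0 mxrank_ker mxrank_tr -lt0n subn_gt0.
move=> /rowV0Pn[v /sub_kermxP vB v0].
have v0' : v^T != 0 by rewrite trmx_eq0.
exists 0, u, ((enorm v^T)^-1 *: v^T); split => //.
- rewrite dotZl dotZr mulrA -invfM -expr2 enorm_sqr mulVf// gt_eqF// dot_gt0//.
- by rewrite scale0r.
- by rewrite -scalemxAr scale0r -[B]trmxK -trmx_mul vB trmx0 scaler0.
Qed.

Lemma rdiag_block n r (s : R) (x : 'cV[R]_n) :
  rdiag r (col_mx s%:M x : 'cV[R]_(1 + n)) = block_mx s%:M 0 0 (rdiag r x) :> 'M[R]_(1 + n, 1 + (n + r)).
Proof.
apply/matrixP => i j; rewrite rdiagE.
case: (split_ordP i) => i' ->; case: (split_ordP j) => j' ->.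
- by rewrite block_mxEul col_mxEu !ord1 !mxE /= mulr1n.
- by rewrite block_mxEur col_mxEu !ord1 !mxE /= mulr0n.
- by rewrite block_mxEdl col_mxEd !ord1 !mxE /= mulr0n.
- by rewrite block_mxEdr col_mxEd rdiagE.
Qed.

(** Deflation by a singular pair.  The width is written [n + r], which is how
    [n <= m] enters. *)
Theorem svd n r (B : 'M[R]_(n, n + r)) :
  exists (P : 'M[R]_n) (Q : 'M[R]_(n + r)) (x : 'cV[R]_n),
  [/\ orthogonal_mx P, orthogonal_mx Q, forall i, 0 <= x i 0 & B = P *m rdiag r x *m Q^T].
Proof.
elim: n B => [|n IHn] B.
  exists 1%:M, 1%:M, 0; split; try exact: orthogonal_mx1.
    by move=> i; rewrite mxE.
  by apply/matrixP => -[].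
have [s [u [w [s0 uu ww Bu Bw]]]] := singular_pair (B : 'M[R]_(1 + n, 1 + n + r)).
have [P oP Pe] := orthogonal_first_col uu.
have [Q oQ Qe] := orthogonal_first_col ww.
have [C [Ce CTe BE]] : exists C : 'M[R]_(1 + n, 1 + (n + r)), [/\
    C *m delta_mx 0 0 = s *: (delta_mx 0 0 : 'cV[R]_(1 + n)),
    C^T *m delta_mx 0 0 = s *: (delta_mx 0 0 : 'cV[R]_(1 + (n + r))) &
    B = P *m C *m Q^T].
  exists (P^T *m B *m Q); split.
  - by rewrite -!mulmxA Qe Bw -scalemxAr -Pe mulmxA oP mul1mx.
  - by rewrite !trmx_mul trmxK -!mulmxA Pe Bu -scalemxAr -Qe mulmxA oQ mul1mx.
  - by rewrite !mulmxA orthogonal_mxr// mul1mx -mulmxA orthogonal_mxr// mulmx1.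
have Ccol i : C i 0 = s * (i == 0)%:R.
  have := congr1 (fun v : 'cV[R]_(1 + n) => v i 0) Ce.
  by rewrite -colE !mxE eqxx andbT.
have Crow i : C 0 i = s * (i == 0)%:R.
  have := congr1 (fun v : 'cV[R]_(1 + (n + r)) => v i 0) CTe.
  by rewrite -colE !mxE eqxx andbT.
have Cblock : C = block_mx s%:M 0 0 (drsubmx C).
  have ul : ulsubmx C = s%:M.
    apply/matrixP => i j; rewrite !ord1 mxE !mxE [lshift _ _](_ : _ = 0); last exact: val_inj.
    by rewrite [lshift _ _](_ : _ = 0) ?Ccol ?eqxx ?mulr1 ?mulr1n//; exact: val_inj.
  have dl : dlsubmx C = 0.
    apply/matrixP => i j; rewrite !ord1 mxE !mxE [lshift _ _](_ : _ = 0); last exact: val_inj.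
    by rewrite Ccol mulr0.
  have ur : ursubmx C = 0.
    apply/matrixP => i j; rewrite !ord1 mxE !mxE [lshift _ _](_ : _ = 0); last exact: val_inj.
    by rewrite Crow mulr0.
  by rewrite -[LHS]submxK ul dl ur.
have [P' [Q' [x [oP' oQ' x0 CE]]]] := IHn (drsubmx C).
set P1 : 'M[R]_(1 + n) := block_mx 1%:M 0 0 P'.
set Q1 : 'M[R]_(1 + (n + r)) := block_mx 1%:M 0 0 Q'.
have oP1 : orthogonal_mx P1 by exact: orthogonal_mx_block.
have oQ1 : orthogonal_mx Q1 by exact: orthogonal_mx_block.
pose D1 : 'M[R]_(1 + n, 1 + (n + r)) := rdiag r (col_mx s%:M x : 'cV[R]_(1 + n)).
have D1E : D1 = block_mx s%:M 0 0 (rdiag r x) by exact: rdiag_block.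
have CE' : C = P1 *m D1 *m Q1^T.
  rewrite Cblock CE D1E /P1 /Q1 tr_block_mx !trmx0 trmx1 !mulmx_block.
  by rewrite !(mulmx0, mul0mx, addr0, add0r, mul1mx, mulmx1).
exists (P *m P1), (Q *m Q1), (col_mx s%:M x); split.
- exact: orthogonal_mxM.
- exact: orthogonal_mxM.
- have x1 (i : 'I_(1 + n)) : 0 <= (col_mx s%:M x : 'cV[R]_(1 + n)) i 0.
    by case: (split_ordP i) => k ->; rewrite ?col_mxEu ?col_mxEd// !ord1 mxE eqxx mulr1n.
  exact: x1.
- by rewrite BE CE' [(Q *m Q1)^T]trmx_mul !mulmxA.
Qed.

Lemma singvals_conj n m (P : 'M[R]_n) (Q : 'M[R]_m) (B : 'M[R]_(n, m)) :
  orthogonal_mx P -> orthogonal_mx Q -> singvals (P *m B *m Q^T) = singvals B.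
Proof.
move=> oP oQ; rewrite /singvals; congr (map_mx _ _).
rewrite !trmx_mul trmxK !mulmxA -[_ *m Q^T *m Q]mulmxA oQ mulmx1.
by rewrite -[P *m B *m B^T]mulmxA eigvals_conj.
Qed.

Lemma perm_mx_mulE n (s : 'S_n) (x : 'cV[R]_n) i : (perm_mx s *m x) i 0 = x (s i) 0.
Proof. by rewrite -row_permE mxE. Qed.

Lemma singvals_rdiag n r (x : 'cV[R]_n) :
  exists s : 'S_n, forall i, singvals (rdiag r x) i 0 = `|x (s i) 0|.
Proof.
rewrite /singvals rdiag_mul_tr; have [s ->] := eigvals_diag_perm (\col_i x i 0 ^+ 2).
by exists s => i; rewrite mxE perm_mx_mulE mxE sqrtr_sqr.
Qed.

Lemma singvals_ge0 n m (B : 'M[R]_(n, m)) i : 0 <= singvals B i 0.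
Proof. by rewrite mxE sqrtr_ge0. Qed.

Lemma singvals_sorted n m (B : 'M[R]_(n, m)) : sorted_col (singvals B).
Proof.
move=> i j ij; rewrite !mxE; apply: ler_wsqrtr; apply: eigvals_sorted => //.
by rewrite trmx_mul trmxK.
Qed.

Lemma singvals_rdiagE n r (x : 'cV[R]_n) :
  singvals (rdiag r x) = x <-> sorted_col x /\ forall i, 0 <= x i 0.
Proof.
split=> [<-|[sx x0]]; first by split; [exact: singvals_sorted|move=> i; exact: singvals_ge0].
have [s sE] := singvals_rdiag r x.
apply: (sorted_perm_eq (s := s) sx (@singvals_sorted _ _ _)) => i.
by rewrite sE ger0_norm.
Qed.

Lemma rdiag_perm n r (s : 'S_n) (x : 'cV[R]_n) :
  rdiag r x = (perm_mx s)^T *m rdiag r (perm_mx s *m x) *m block_mx (perm_mx s) 0 0 1%:M.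
Proof.
rewrite /rdiag -mulmxA mul_row_block mul_mx_row !mulmx0 mul0mx !addr0 mulmx0.
congr row_mx; move: (perm_mx s *m x) (perm_mx_mulE s x) => c cE.
apply/matrixP => i j; rewrite mul_diag_mx tr_perm_mx -row_permE !mxE.
by rewrite cE permKV mulr_natr.
Qed.

Lemma orthogonal_mx_block1 n r (Q : 'M[R]_n) : orthogonal_mx Q ->
  orthogonal_mx (block_mx Q 0 0 1%:M : 'M[R]_(n + r)).
Proof.
move=> oQ; rewrite /orthogonal_mx tr_block_mx mulmx_block !trmx0 trmx1.
by rewrite !mulmx0 !mul0mx !addr0 add0r mulmx1 oQ -scalar_mx_block.
Qed.

Lemma singular_decomposition n r (B : 'M[R]_(n, n + r)) :
  exists (P : 'M[R]_n) (Q : 'M[R]_(n + r)),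
  [/\ orthogonal_mx P, orthogonal_mx Q & B = P *m rdiag r (singvals B) *m Q^T].
Proof.
have [P [Q [x [oP oQ x0 BE]]]] := svd B.
have [s sE] := singvals_rdiag r x.
have xE : singvals B = perm_mx s *m x.
  apply/colP => i; rewrite {1}BE singvals_conj// sE perm_mx_mulE ger0_norm//.
exists (P *m (perm_mx s)^T), (Q *m (block_mx (perm_mx s) 0 0 1%:M)^T); split.
- by apply: orthogonal_mxM => //; apply/orthogonal_mxT/orthogonal_mx_perm.
- by apply: orthogonal_mxM => //; apply/orthogonal_mxT/orthogonal_mx_block1/orthogonal_mx_perm.
by rewrite xE BE (rdiag_perm r s x) [(Q *m _)^T]trmx_mul trmxK !mulmxA.
Qed.

(** Von Neumann's trace inequality: the products of the entries of two
    orthogonal matrices are dominated by a doubly substochastic matrix. *)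
Lemma von_neumann n r (A B : 'M[R]_(n, n + r)) :
  dot A B <= dot (singvals A) (singvals B).
Proof.
have [P [Q [oP oQ AE]]] := singular_decomposition A.
have [P' [Q' [oP' oQ' BE]]] := singular_decomposition B.
set a := singvals A in AE *; set b := singvals B in BE *.
pose W := P^T *m P'; pose Z := Q^T *m Q'.
have oW : orthogonal_mx W by apply: orthogonal_mxM => //; exact: orthogonal_mxT.
have oZ : orthogonal_mx Z by apply: orthogonal_mxM => //; exact: orthogonal_mxT.
have -> : dot A B = dot (rdiag r a) (W *m rdiag r b *m Z^T).
  by rewrite AE BE dot_mulmxr trmxK dot_mulmxl /W /Z trmx_mul trmxK !mulmxA.
have oK : W *m rdiag r b *m Z^T = row_mx (W *m diag_mx b^T *m (ulsubmx Z)^T)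
    (W *m diag_mx b^T *m (dlsubmx Z)^T).
  rewrite /rdiag mul_mx_row mulmx0 -[Z in LHS]submxK tr_block_mx mul_row_block.
  by rewrite !mul0mx !addr0.
have -> : dot (rdiag r a) (W *m rdiag r b *m Z^T)
    = dot (diag_mx a^T) (W *m diag_mx b^T *m (ulsubmx Z)^T).
  rewrite oK !dot_mxE /rdiag tr_row_mx mul_col_row mxtrace_block.
  by rewrite trmx0 !mul0mx mxtrace0 addr0.
rewrite dot_diag_conj; set K := ulsubmx Z.
pose S : 'M[R]_n := \matrix_(i, j) ((W i j ^+ 2 + K i j ^+ 2) / 2).
have KZ i j : K i j = Z (lshift r i) (lshift r j) by rewrite /K !mxE.
have Kr i : \sum_j K i j ^+ 2 <= 1.
  rewrite -(orthogonal_row_norm (lshift r i) oZ) big_split_ord /=.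
  under eq_bigr do rewrite KZ.
  by rewrite lerDl; apply: sumr_ge0 => j _; exact: sqr_ge0.
have Kc j : \sum_i K i j ^+ 2 <= 1.
  rewrite -(orthogonal_col_norm (lshift r j) oZ) big_split_ord /=.
  under eq_bigr do rewrite KZ.
  by rewrite lerDl; apply: sumr_ge0 => i _; exact: sqr_ge0.
apply: (@le_trans _ _ (\sum_i \sum_j a i 0 * b j 0 * S i j)).
  apply: ler_sum => i _; apply: ler_sum => j _; apply: ler_wpM2l.
    by apply: mulr_ge0; exact: singvals_ge0.
  rewrite [leRHS]mxE ler_pdivlMr// -subr_ge0.
  have -> : W i j ^+ 2 + K i j ^+ 2 - W i j * K i j * 2 = (W i j - K i j) ^+ 2 by ring.
  exact: sqr_ge0.
apply: rearrangement_substochastic.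
- exact: singvals_sorted.
- exact: singvals_sorted.
- by move=> i; exact: singvals_ge0.
- by move=> i; exact: singvals_ge0.
- by move=> i j; rewrite mxE divr_ge0// addr_ge0// sqr_ge0.
- move=> i; under eq_bigr do rewrite mxE.
  rewrite -mulr_suml big_split/= orthogonal_row_norm//.
  by have := Kr i; lra.
- move=> j; under eq_bigr do rewrite mxE.
  rewrite -mulr_suml big_split/= orthogonal_col_norm//.
  by have := Kc j; lra.
Qed.

End SingularValues.

(** * Second-order calculus of rotations *)

Section MatrixLimits.
Context {R : realType}.

Lemma mx_entry_norm m n (A : 'M[R]_(m, n)) i j : `|A i j| <= `|A|.
Proof.
by rewrite [leRHS]/Num.norm/= mx_normrE; apply/bigmax_geP; right; exists (i, j).
Qed.

Lemma mx_norm_le m n (A : 'M[R]_(m, n)) (M : R) : 0 <= M ->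
  (forall i j, `|A i j| <= M) -> `|A| <= M.
Proof.
move=> M0 AM; rewrite [leLHS]/Num.norm/= mx_normrE.
by apply: bigmax_le => // -[i j] _ /=.
Qed.

Lemma mulmx_norm_le m n p (A : 'M[R]_(m, n)) (B : 'M[R]_(n, p)) :
  `|A *m B| <= n%:R * (`|A| * `|B|).
Proof.
apply: mx_norm_le; first by rewrite !mulr_ge0.
move=> i j; rewrite mxE; apply: le_trans (ler_norm_sum _ _ _) _.
rewrite mulr_natl -[X in _ *+ X]card_ord -sumr_const; apply: ler_sum => k _.
by rewrite normrM; apply: ler_pM => //; exact: mx_entry_norm.
Qed.

Context (F : set_system nat) {FF : ProperFilter F}.

Lemma cvg_mulmx m n p (A_ : nat -> 'M[R]_(m, n)) (B_ : nat -> 'M[R]_(n, p))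
  (A : 'M[R]_(m, n)) (B : 'M[R]_(n, p)) :
  A_ @ F --> A -> B_ @ F --> B -> (fun k => A_ k *m B_ k) @ F --> A *m B.
Proof.
move=> cA cB.
apply: (@cvg_le_norm _ _ _ _ _ _ _ (fun k =>
    n%:R * (`|A_ k - A| * `|B_ k|) + n%:R * (`|A| * `|B_ k - B|))).
  apply: nearW => k.
  have -> : A_ k *m B_ k - A *m B = (A_ k - A) *m B_ k + A *m (B_ k - B).
    by rewrite mulmxBl mulmxBr addrA subrK.
  by apply: le_trans (ler_normD _ _) _; apply: lerD; exact: mulmx_norm_le.
rewrite -[X in _ --> X](_ : n%:R * (0 * `|B|) + n%:R * (`|A| * 0) = 0); last first.
  by rewrite mul0r !mulr0 addr0.
apply: cvgD; apply: cvgMl_tmp; apply: cvgM.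
- by apply/norm_cvg0P/subr_cvg0.
- exact: cvg_norm.
- exact: cvg_cst.
- by apply/norm_cvg0P/subr_cvg0.
Qed.

Lemma cvg_trmx m n (A_ : nat -> 'M[R]_(m, n)) (A : 'M[R]_(m, n)) :
  A_ @ F --> A -> (fun k => (A_ k)^T) @ F --> A^T.
Proof. by move=> cA; exact: (linear_cvg (f := @trmx R m n)). Qed.

Lemma cvg_entry m n (A_ : nat -> 'M[R]_(m, n)) (A : 'M[R]_(m, n)) i j :
  A_ @ F --> A -> (fun k => A_ k i j) @ F --> A i j.
Proof.
move=> cA; apply: (@cvg_le_norm _ _ _ _ _ _ _ (fun k => `|A_ k - A|)).
  by apply: nearW => k; apply: le_trans (mx_entry_norm _ i j); rewrite !mxE.
by apply/norm_cvg0P/subr_cvg0.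
Qed.

Lemma orthogonal_norm_le n (P : 'M[R]_n) : orthogonal_mx P -> `|P| <= 1.
Proof.
move=> oP; apply: mx_norm_le => // i j.
rewrite -(@ler_pXn2r _ 2) ?nnegrE// expr1n real_normK ?num_real//.
rewrite -(orthogonal_row_norm i oP) (bigD1 j)//= lerDl.
by apply: sumr_ge0 => k _; exact: sqr_ge0.
Qed.

Lemma orthogonal_cvg n (P_ : nat -> 'M[R]_n) (P : 'M[R]_n) : (forall k, orthogonal_mx (P_ k)) ->
  P_ @ F --> P -> orthogonal_mx P.
Proof.
move=> oP cP; have := cvg_mulmx (cvg_trmx cP) cP.
rewrite (_ : (fun k => _) = (fun=> 1%:M)); last by apply/funext => k; exact: oP.
move=> H; rewrite /orthogonal_mx.
apply: (@cvg_unique _ (@norm_hausdorff R _) ((fun=> 1%:M : 'M[R]_n) @ F)) => //.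
exact: cvg_cst.
Qed.

Variable t : nat -> R.
Hypothesis t_gt0 : forall k, 0 < t k.
Hypothesis t_cvg : t @ F --> 0.

(** [f = O(t ^+ p)] along [F]. *)
Definition Opow (V : normedModType R) (p : nat) (f : nat -> V) :=
  exists M, \forall k \near F, `|f k| <= M * t k ^+ p.

Lemma OpowP (V : normedModType R) p (f : nat -> V) : Opow p f ->
  exists2 M, 0 <= M & \forall k \near F, `|f k| <= M * t k ^+ p.
Proof.
move=> [M fM]; exists `|M| => //; apply: filterS fM => k /le_trans; apply.
by rewrite ler_wpM2r ?exprn_ge0 ?ler_norm// ltW.
Qed.

Lemma Opow_cst (V : normedModType R) (a : V) : Opow 0 (fun=> a).
Proof. by exists `|a|; apply: nearW => k; rewrite expr0 mulr1. Qed.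

Lemma Opow_add (V : normedModType R) p (f g : nat -> V) :
  Opow p f -> Opow p g -> Opow p (fun k => f k + g k).
Proof.
move=> [M fM] [N gN]; exists (M + N); near=> k.
by apply: le_trans (ler_normD _ _) _; rewrite mulrDl lerD//; near: k.
Unshelve. all: by end_near. Qed.

Lemma Opow_scale (V : normedModType R) p (f : nat -> V) :
  Opow p f -> Opow p.+1 (fun k => t k *: f k).
Proof.
move=> [M fM]; exists M; apply: filterS fM => k.
by rewrite normrZ gtr0_norm// exprS mulrCA ler_pM2l.
Qed.

Lemma Opow_weaken (V : normedModType R) p (f : nat -> V) : Opow p.+1 f -> Opow p f.
Proof.
move=> /OpowP[M M0 fM]; exists M; near=> k.
apply: (@le_trans _ _ (M * t k ^+ p.+1)); first by near: k.
rewrite ler_wpM2l// exprS ler_piMl ?exprn_ge0 ?(ltW (t_gt0 k))//.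
by apply: ltW; near: k; apply: (cvgr_lt _ t_cvg).
Unshelve. all: by end_near. Qed.

Lemma Opow_mulmx m n l p q (f : nat -> 'M[R]_(m, n)) (g : nat -> 'M[R]_(n, l)) :
  Opow p f -> Opow q g -> Opow (p + q) (fun k => f k *m g k).
Proof.
move=> /OpowP[M M0 fM] /OpowP[N N0 gN]; exists (n%:R * (M * N)); near=> k.
apply: le_trans (mulmx_norm_le _ _) _; rewrite -mulrA ler_wpM2l//.
rewrite exprD mulrACA; apply: ler_pM => //; near: k; [exact: fM|exact: gN].
Unshelve. all: by end_near. Qed.

Lemma Opow_tr m n p (f : nat -> 'M[R]_(m, n)) : Opow p f -> Opow p (fun k => (f k)^T).
Proof.
move=> /OpowP[M M0 fM]; exists M; apply: filterS fM => k fk.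
apply: mx_norm_le => [|i j]; first by rewrite mulr_ge0 ?exprn_ge0 ?(ltW (t_gt0 k)).
by rewrite mxE; apply: le_trans (mx_entry_norm _ _ _) fk.
Qed.

Lemma Opow_ext (V : normedModType R) p (f g : nat -> V) : f =1 g -> Opow p f -> Opow p g.
Proof. by move=> /funext->. Qed.

(** Second-order expansion of a rotated segment: only the first-order terms of
    the rotations matter. *)
Lemma rotation_expansion n m (C1 : nat -> 'M[R]_n) (C2 : nat -> 'M[R]_m)
  (O1 : 'M[R]_n) (O2 : 'M[R]_m) (D L : 'M[R]_(n, m)) :
  Opow 2 (fun k => C1 k - 1%:M - t k *: O1) ->
  Opow 2 (fun k => C2 k - 1%:M - t k *: O2) ->
  Opow 2 (fun k => C1 k *m (D + t k *: L) *m (C2 k)^T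
    - (D + t k *: (O1 *m D + D *m O2^T + L))).
Proof.
move=> H1 H2; set E1 := (fun k => C1 k - _ - _) in H1; set E2 := (fun k => C2 k - _ - _) in H2.
have N0 : Opow 0 (fun k => D + t k *: L).
  apply: Opow_add; first exact: Opow_cst.
  by apply: Opow_weaken; apply: Opow_scale; exact: Opow_cst.
have H1' : Opow 1 (fun k => t k *: L + t k *: (O1 *m (D + t k *: L)) + E1 k *m (D + t k *: L)).
  apply: Opow_add; first apply: Opow_add.
  - by apply: Opow_scale; exact: Opow_cst.
  - by apply: Opow_scale; exact: (Opow_mulmx (Opow_cst _) N0).
  - by apply: Opow_weaken; exact: (Opow_mulmx H1 N0).
have H0 : Opow 0 (fun k => D + (t k *: L + t k *: (O1 *m (D + t k *: L)) + E1 k *m (D + t k *: L))).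
  by apply: Opow_add; [exact: Opow_cst|exact: Opow_weaken].
have T : Opow 2 (fun k => t k *: (t k *: (O1 *m L)) + E1 k *m (D + t k *: L) +
    t k *: ((t k *: L + t k *: (O1 *m (D + t k *: L)) + E1 k *m (D + t k *: L)) *m O2^T) +
    (D + (t k *: L + t k *: (O1 *m (D + t k *: L)) + E1 k *m (D + t k *: L))) *m (E2 k)^T).
  apply: Opow_add; first apply: Opow_add; first apply: Opow_add.
  - by do 2 apply: Opow_scale; exact: Opow_cst.
  - exact: (Opow_mulmx H1 N0).
  - by apply: Opow_scale; exact: (Opow_mulmx H1' (Opow_cst _)).
  - exact: (Opow_mulmx H0 (Opow_tr H2)).
apply: Opow_ext T => k.
have -> : C1 k = 1%:M + t k *: O1 + E1 k by rewrite /E1 -addrA [t k *: O1 + _]addrC subrK addrC subrK.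
have -> : C2 k = 1%:M + t k *: O2 + E2 k by rewrite /E2 -addrA [t k *: O2 + _]addrC subrK addrC subrK.
move: (E1 k) (E2 k) => e1 e2; set N := D + t k *: L.
set Y := t k *: L + t k *: (O1 *m N) + e1 *m N.
have -> : (1%:M + t k *: O1 + e1) *m N = D + Y.
  by rewrite 2!mulmxDl mul1mx -scalemxAl /Y /N -!addrA.
have -> : (1%:M + t k *: O2 + e2)^T = 1%:M + t k *: O2^T + e2^T.
  by rewrite !linearD /= trmx1 linearZ.
rewrite 2!(mulmxDr (D + Y)) mulmx1 -scalemxAr (mulmxDl D Y O2^T).
have YE : Y = t k *: L + t k *: (O1 *m D + t k *: (O1 *m L)) + e1 *m N.
  by rewrite /Y; congr (_ + _ *: _ + _); rewrite /N mulmxDr -scalemxAr.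
move: ((D + Y) *m e2^T) (Y *m O2^T) => Z y; rewrite YE.
move: (D *m O2^T) (e1 *m N) (O1 *m L) (O1 *m D) => c f b a.
by apply/matrixP => i j; rewrite !mxE; ring.
Qed.

Lemma skew_dot0 n m (A : 'M[R]_n) (z : 'M[R]_(n, m)) : A^T = - A -> dot z (A *m z) = 0.
Proof.
move=> sA; have : dot z (A *m z) = - dot z (A *m z).
  by rewrite {1}dotC dot_mulmxl sA mulNmx dotNr.
lra.
Qed.

Lemma skew_expand n m (A : 'M[R]_n) (z : 'M[R]_(n, m)) : A^T = - A ->
  dot z z <= dot ((1%:M - A) *m z) ((1%:M - A) *m z).
Proof.
move=> sA; rewrite mulmxBl mul1mx dotBl !dotBr (dotC (A *m z)) skew_dot0//.
by have := dot_ge0 (A *m z); lra.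
Qed.

Lemma skew_unit n (A : 'M[R]_n) : A^T = - A -> 1%:M - A \in unitmx.
Proof.
move=> sA; rewrite unitmxE unitfE; apply/det0P => -[v v0 vA].
have sA' : (- A)^T = - - A by rewrite linearN /= sA.
have E : (1%:M - - A) *m v^T = 0.
  have -> : 1%:M - - A = (1%:M - A)^T by rewrite linearB /= trmx1 sA.
  by rewrite -trmx_mul vA trmx0.
have := skew_expand v^T sA'; rewrite E dot0l => v_le.
have : v^T == 0 by apply/eqP/dot_eq0/le_anti; rewrite dot_ge0 andbT.
by rewrite trmx_eq0 (negbTE v0).
Qed.

(** Cayley transform: the rotations [(1 - A)^-1 (1 + A)], with [A] half of
    [t *: O], are tangent to the skew-symmetric matrix [O].  The remainder is
    controlled because [1 - A] expands distances ([skew_expand]). *)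
Lemma cayley n (O : 'M[R]_n) : O^T = - O ->
  exists C : nat -> 'M[R]_n, (forall k, orthogonal_mx (C k)) /\
    Opow 2 (fun k => C k - 1%:M - t k *: O).
Proof.
move=> sO; pose A k := (t k / 2) *: O.
have sA k : (A k)^T = - A k by rewrite linearZ /= sO scalerN.
have U k := skew_unit (sA k).
have MT k : (1%:M - A k)^T = 1%:M + A k by rewrite linearB /= trmx1 sA opprK.
have PT k : (1%:M + A k)^T = 1%:M - A k by rewrite linearD /= trmx1 sA.
have UP k : 1%:M + A k \in unitmx by rewrite -MT unitmx_tr.
have comm k : (1%:M + A k) *m (1%:M - A k) = (1%:M - A k) *m (1%:M + A k).
  rewrite [LHS]mulmxBr [X in _ - X = _]mulmxDl [RHS]mulmxBl [X in _ = _ - X]mulmxDr.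
  by rewrite !(mul1mx, mulmx1).
pose C k := invmx (1%:M - A k) *m (1%:M + A k).
have CE k : C k = (1%:M + A k) *m invmx (1%:M - A k).
  transitivity (C k *m ((1%:M - A k) *m invmx (1%:M - A k))).
    by rewrite mulmxV// mulmx1.
  rewrite /C mulmxA.
  by rewrite -(mulmxA (invmx _) (1%:M + A k)) comm mulmxA mulVmx// mul1mx.
exists C; split=> [k|].
  rewrite /orthogonal_mx {2}CE /C trmx_mul trmx_inv MT PT.
  by rewrite mulmxA -[_ *m invmx _ *m _]mulmxA mulVmx// mulmx1 mulmxV.
have [c c0 Hc] := @norm_le_of_dot R 'M[R]_n.
exists (c * (`|O *m O| / 2)); apply: nearW => k.
have DE : (1%:M - A k) *m (C k - 1%:M - t k *: O) = (t k ^+ 2 / 2) *: (O *m O).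
  rewrite 2!mulmxBr /C mulmxA mulmxV// mul1mx mulmx1.
  have -> : t k *: O = (2 : R) *: A k by rewrite scalerA mulrC divfK.
  rewrite mulmxBl mul1mx -scalemxAr /A -scalemxAl -scalemxAr.
  move: (O *m O) => OO; apply/matrixP => i j; rewrite !mxE.
  by field.
apply: (le_trans (Hc _ ((t k ^+ 2 / 2) *: (O *m O)) _)).
  by rewrite -DE; exact: skew_expand.
rewrite normrZ ger0_norm ?divr_ge0 ?exprn_ge0 ?(ltW (t_gt0 k))//.
by rewrite le_eqVlt; apply/orP; left; apply/eqP; field.
Qed.

End MatrixLimits.

(** * First-order perturbation of spectral decompositions *)

Section Tangents.
Context {R : realType} (F : set_system nat) {FU : UltraFilter F}.
Variable t : nat -> R.
Hypothesis t_gt0 : forall k, 0 < t k.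
Hypothesis t_cvg : t @ F --> 0.

Lemma orthogonal_ultra_cvg n (P_ : nat -> 'M[R]_n) : (forall k, orthogonal_mx (P_ k)) ->
  exists2 P : 'M[R]_n, orthogonal_mx P & P_ @ F --> P.
Proof.
move=> oP; have [P cP] : exists P : 'M[R]_n, P_ @ F --> P.
  by apply: (ultra_cvg_bounded (M := 1)); apply: nearW => k; exact: orthogonal_norm_le.
by exists P => //; exact: orthogonal_cvg cP.
Qed.

Lemma cvg_quotient (V : normedModType R) (l_ : nat -> V) (l l' : V) :
  (fun k => (t k)^-1 *: (l_ k - l)) @ F --> l' -> l_ @ F --> l.
Proof.
move=> dc; have E : l_ = (fun k => l + t k *: ((t k)^-1 *: (l_ k - l))).
  by apply/funext => k; rewrite scalerA mulfV ?gt_eqF// scale1r addrC subrK.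
rewrite E -[X in _ --> X]addr0 -[X in _ --> _ + X](scale0r l').
by apply: cvgD; [exact: cvg_cst|exact: cvgZ].
Qed.

Lemma cvg_add_small (V : normedModType R) (s H : V) (h_ : nat -> V) : h_ @ F --> H ->
  (fun k => s + t k *: h_ k) @ F --> s.
Proof.
move=> hc; rewrite -[X in _ --> X]addr0 -[X in _ --> _ + X](scale0r H).
by apply: cvgD; [exact: cvg_cst|exact: cvgZ].
Qed.

Lemma cvg_limit_unique (V : normedModType R) (f : nat -> V) (a b : V) :
  f @ F --> a -> f @ F --> b -> a = b.
Proof.
by move=> fa fb; apply: (@cvg_unique _ (@norm_hausdorff R V) (f @ F)).
Qed.

Lemma Opow_conj n m (P : 'M[R]_n) (Q : 'M[R]_m) p (f : nat -> 'M[R]_(n, m)) :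
  Opow F t p f -> Opow F t p (fun k => P *m f k *m Q).
Proof.
move=> fO; have Pf : Opow F t (0 + p) (fun k => P *m f k).
  exact: (Opow_mulmx t_gt0 (Opow_cst _ P) fO).
rewrite -[p]add0n -[(0 + p)%N]addn0; exact: (Opow_mulmx t_gt0 Pf (Opow_cst _ Q)).
Qed.

(** An entry of the relation between the frames of two close matrices, in a
    diagonal block of equal eigenvalues: the rate of change of the eigenvalue is
    read off the perturbation. *)
Lemma eigen_entry n (W Z : 'M[R]_n) (u l : 'cV[R]_n) (c : R) a i : c != 0 ->
  l a 0 = l i 0 -> W *m diag_mx u^T = diag_mx l^T *m W + c *: Z ->
  W a i * (c^-1 *: (u - l)) i 0 = Z a i.
Proof.
move=> c0 lai /(congr1 (fun A : 'M[R]_n => A a i)).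
rewrite mul_mx_diag mul_diag_mx !mxE lai => E.
rewrite mulrCA mulrBr E [W a i * _]mulrC addrAC subrr add0r.
by rewrite mulrA mulVf ?mul1r.
Qed.

(** First-order perturbation of the spectral decomposition: in the limit of the
    frames of the perturbed matrices, the diagonal blocks of the perturbation on
    the eigenspaces of [s] are diagonal, and the rest is generated by a rotation,
    whose generator divides by the differences of eigenvalues. *)
Lemma eigen_tangent n (s H : 'M[R]_n) (h_ : nat -> 'M[R]_n) (l' : 'cV[R]_n) :
  s^T = s -> (forall k, (h_ k)^T = h_ k) -> h_ @ F --> H ->
  (fun k => (t k)^-1 *: (eigvals (s + t k *: h_ k) - eigvals s)) @ F --> l' ->
  exists (P : 'M[R]_n) (C : nat -> 'M[R]_n),
  [/\ orthogonal_mx P, s = P *m diag_mx (eigvals s)^T *m P^T,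
    forall k, orthogonal_mx (C k), Opow F t 1 (fun k => C k - P) &
    Opow F t 2 (fun k => C k *m diag_mx (eigvals s + t k *: l')^T *m (C k)^T - (s + t k *: H))].
Proof.
move=> ss hs hc dc; set l := eigvals s in dc *.
pose s_ k := s + t k *: h_ k; pose l_ k := eigvals (s_ k).
have ss_ k : (s_ k)^T = s_ k by rewrite linearD linearZ /= ss hs.
have HT : H^T = H.
  apply: (@cvg_limit_unique 'M[R]_n (fun k => (h_ k)^T)); first exact: cvg_trmx.
  by rewrite (_ : (fun k => _) = h_)//; apply/funext.
have /choice[P_ HP] : forall k, exists P, orthogonal_mx P /\ s_ k = P *m diag_mx (l_ k)^T *m P^T.
  by move=> k; have [P] := spectral_decomposition (ss_ k); exists P.
have oP_ k : orthogonal_mx (P_ k) by have [] := HP k.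
have [P oP Pc] := orthogonal_ultra_cvg oP_.
have lc : l_ @ F --> l by exact: cvg_quotient dc.
have diag_cvg (u_ : nat -> 'cV[R]_n) (u : 'cV[R]_n) : u_ @ F --> u ->
    (fun k => diag_mx (u_ k)^T) @ F --> diag_mx u^T.
  by move=> uc; apply: (linear_cvg (f := @diag_mx R n)); exact: cvg_trmx.
have sE : s = P *m diag_mx l^T *m P^T.
  apply: (@cvg_limit_unique 'M[R]_n (fun k => s + t k *: h_ k)); first exact: (cvg_add_small hc).
  rewrite (_ : (fun k => _) = fun k => P_ k *m diag_mx (l_ k)^T *m (P_ k)^T).
    by apply: cvg_mulmx; [apply: cvg_mulmx => //; exact: diag_cvg|exact: cvg_trmx].
  by apply/funext => k; have [_ ] := HP k.
pose K := P^T *m H *m P; pose K_ k := P^T *m h_ k *m P; pose W_ k := P^T *m P_ k.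
have Kc : K_ @ F --> K.
  by apply: cvg_mulmx; [apply: cvg_mulmx => //; exact: cvg_cst|exact: cvg_cst].
have Wc : W_ @ F --> (1%:M : 'M[R]_n) by rewrite -oP; apply: cvg_mulmx => //; exact: cvg_cst.
have KWc : (fun k => K_ k *m W_ k) @ F --> K by rewrite -[K]mulmx1; exact: cvg_mulmx.
have KT : K^T = K by rewrite /K !trmx_mul trmxK HT mulmxA.
have WE k : W_ k *m diag_mx (l_ k)^T = diag_mx l^T *m W_ k + t k *: (K_ k *m W_ k).
  have E1 : P^T *m s_ k *m P_ k = W_ k *m diag_mx (l_ k)^T.
    have [_ {1}->] := HP k; rewrite /W_ !mulmxA -[RHS]mulmx1 -(oP_ k).
    by rewrite !mulmxA.
  have E2 : P^T *m s_ k = diag_mx l^T *m P^T + t k *: (P^T *m h_ k).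
    by rewrite /s_ mulmxDr -scalemxAr {1}sE !mulmxA oP mul1mx.
  rewrite -E1 E2 mulmxDl -scalemxAl /W_ !mulmxA; congr (_ + _ *: _).
  by rewrite /K_ -[_ *m P *m P^T]mulmxA orthogonal_mxr// mulmx1.
have Kdiag a i : l a 0 = l i 0 -> K a i = l' i 0 *+ (a == i).
  move=> lai.
  have entry k : W_ k a i * ((t k)^-1 *: (l_ k - l)) i 0 = (K_ k *m W_ k) a i.
    by apply: eigen_entry (WE k) => //; rewrite gt_eqF.
  apply: (@cvg_limit_unique R^o (fun k => (K_ k *m W_ k) a i)); first exact: cvg_entry.
  rewrite (_ : (fun k => _) = fun k => W_ k a i * ((t k)^-1 *: (l_ k - l)) i 0); last first.
    by apply/funext => k; rewrite entry.
  rewrite -mulr_natl (_ : (a == i)%:R = (1%:M : 'M[R]_n) a i); last by rewrite mxE.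
  by apply: cvgM; exact: cvg_entry.
have HK : H = P *m K *m P^T.
  by rewrite /K !mulmxA orthogonal_mxr// mul1mx -mulmxA orthogonal_mxr// mulmx1.
clearbody K; pose O : 'M[R]_n := \matrix_(a, i) (K a i / (l i 0 - l a 0)).
have OT : O^T = - O.
  apply/matrixP => a i; rewrite !mxE -[in LHS]KT mxE -mulrN -invrN opprB.
  by [].
have KE : K = O *m diag_mx l^T + diag_mx l^T *m O^T + diag_mx l'^T.
  apply/matrixP => a i; rewrite OT mulmxN mul_mx_diag mul_diag_mx !mxE.
  have [lai|lai] := eqVneq (l a 0) (l i 0).
    rewrite lai subrr invr0 !(mulr0, mul0r) subrr add0r Kdiag//.
    by case: (eqVneq a i) => [->|].
  have ai : a == i = false by apply: contraNF lai => /eqP->.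
  by rewrite ai mulr0n addr0; field; rewrite subr_eq0 eq_sym.
have FP : ProperFilter F by exact: ultra_proper.
have [C0 [oC0 C0O]] := @cayley R F FP t t_gt0 n O OT.
exists P, (fun k => P *m C0 k); split => //.
- by move=> k; exact: orthogonal_mxM.
- have C1 : Opow F t 1 (fun k => C0 k - 1%:M).
    apply: (@Opow_ext _ F t _ _ (fun k => C0 k - 1%:M - t k *: O + t k *: O)).
      by move=> k; rewrite subrK.
    apply: Opow_add; first exact: Opow_weaken C0O.
    by apply: Opow_scale => //; exact: Opow_cst.
  apply: (Opow_ext _ (Opow_conj P 1%:M C1)) => k.
  by rewrite mulmx1 mulmxBr mulmx1.
have E := @rotation_expansion R F FP t t_gt0 t_cvg n n C0 C0 O O (diag_mx l^T)
  (diag_mx l'^T) C0O C0O.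
apply: (Opow_ext _ (Opow_conj P P^T E)) => k.
rewrite -KE mulmxBr mulmxBl; congr (_ - _).
  rewrite trmx_mul !mulmxA; congr (_ *m _ *m _); rewrite -!mulmxA; congr (_ *m (_ *m _)).
  by rewrite !linearD /= !linearZ.
by rewrite mulmxDr mulmxDl -sE -scalemxAr -scalemxAl -HK.
Qed.

Section RdiagEntries.
Variables (n r : nat).
Implicit Types (x : 'cV[R]_n) (W : 'M[R]_n) (Z : 'M[R]_(n + r)).

Lemma addmxE m p (A B : 'M[R]_(m, p)) i j : (A + B) i j = A i j + B i j.
Proof. by rewrite mxE. Qed.

Lemma mul_rdiagEl W x a i : (W *m rdiag r x) a (lshift r i) = W a i * x i 0.
Proof. by rewrite /rdiag mul_mx_row row_mxEl mul_mx_diag !mxE. Qed.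

Lemma mul_rdiagEr W x a j : (W *m rdiag r x) a (rshift n j) = 0.
Proof. by rewrite /rdiag mul_mx_row row_mxEr mulmx0 mxE. Qed.

Lemma rdiag_mulE x Z a j : (rdiag r x *m Z) a j = x a 0 * Z (lshift r a) j.
Proof.
rewrite /rdiag -[Z in LHS]vsubmxK mul_row_col mul0mx addr0 mul_diag_mx.
by rewrite !mxE.
Qed.

(** The analogue of [eigen_entry].  The sum and the difference of the two frames
    separate the symmetric and the skew parts of the perturbation: the first has
    the divisors [l i - l a], the second [l i + l a], which vanish only on the
    block of zero singular values. *)
Lemma singular_entries W Z (X : 'M[R]_(n, n + r)) (Y : 'M[R]_(n + r, n))
    (u l : 'cV[R]_n) (c : R) : c != 0 ->
  W *m rdiag r u = rdiag r l *m Z + c *: X ->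
  Z *m (rdiag r u)^T = (rdiag r l)^T *m W + c *: Y ->
  [/\ forall a i, l a 0 = l i 0 ->
        (W a i + Z (lshift r a) (lshift r i)) * (c^-1 *: (u - l)) i 0
        = X a (lshift r i) + Y (lshift r a) i,
      forall a i, l a 0 = 0 -> l i 0 = 0 ->
        (W a i - Z (lshift r a) (lshift r i)) * (c^-1 *: (u - l)) i 0
        = X a (lshift r i) - Y (lshift r a) i &
      forall a j, l a 0 = 0 -> X a (rshift n j) = 0].
Proof.
move=> c0 E1 E2.
have e1 a i : W a i * u i 0 = l a 0 * Z (lshift r a) (lshift r i) + c * X a (lshift r i).
  have := congr1 (fun A : 'M[R]_(n, n + r) => A a (lshift r i)) E1.
  by rewrite mul_rdiagEl mxE rdiag_mulE [(c *: X) _ _]mxE.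
have e2 a j : 0 = l a 0 * Z (lshift r a) (rshift n j) + c * X a (rshift n j).
  have := congr1 (fun A : 'M[R]_(n, n + r) => A a (rshift n j)) E1.
  by rewrite mul_rdiagEr mxE rdiag_mulE [(c *: X) _ _]mxE.
have e3 a i : Z (lshift r a) (lshift r i) * u i 0 = l a 0 * W a i + c * Y (lshift r a) i.
  have E2' : rdiag r u *m Z^T = W^T *m rdiag r l + c *: Y^T.
    by rewrite -[rdiag r u]trmxK -trmx_mul E2 linearD linearZ /= trmx_mul trmxK.
  have := congr1 (fun A : 'M[R]_(n, n + r) => A i (lshift r a)) E2'.
  rewrite rdiag_mulE addmxE mul_rdiagEl [(c *: Y^T) _ _]mxE.
  by rewrite [Z^T _ _]mxE [W^T _ _]mxE [Y^T _ _]mxE mulrC [W a i * _]mulrC.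
have dE i : (c^-1 *: (u - l)) i 0 = c^-1 * (u i 0 - l i 0) by rewrite !mxE.
split=> [a i lai|a i la li|a j la].
- apply: (mulfI c0); rewrite dE mulrCA [c * (c^-1 * _)]mulrA mulfV// mul1r.
  by have := e1 a i; have := e3 a i; rewrite lai; move: (Z _ _) (X _ _) (Y _ _) => z x y; nra.
- apply: (mulfI c0); rewrite dE mulrCA [c * (c^-1 * _)]mulrA mulfV// mul1r.
  by have := e1 a i; have := e3 a i; rewrite la li; move: (Z _ _) (X _ _) (Y _ _) => z x y; nra.
- by have /esym/eqP := e2 a j; rewrite la mul0r add0r mulf_eq0 (negbTE c0) => /eqP.
Qed.

End RdiagEntries.

(** First-order perturbation of the singular value decomposition, as in
    [eigen_tangent], with a pair of rotations. *)
Lemma singular_tangent n r (s H : 'M[R]_(n, n + r)) (h_ : nat -> 'M[R]_(n, n + r))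
    (l' : 'cV[R]_n) : h_ @ F --> H ->
  (fun k => (t k)^-1 *: (singvals (s + t k *: h_ k) - singvals s)) @ F --> l' ->
  exists (P : 'M[R]_n) (Q : 'M[R]_(n + r)) (C : nat -> 'M[R]_n) (E : nat -> 'M[R]_(n + r)),
  [/\ orthogonal_mx P /\ orthogonal_mx Q, s = P *m rdiag r (singvals s) *m Q^T,
    forall k, orthogonal_mx (C k) /\ orthogonal_mx (E k),
    Opow F t 1 (fun k => C k - P) /\ Opow F t 1 (fun k => E k - Q) &
    Opow F t 2 (fun k => C k *m rdiag r (singvals s + t k *: l') *m (E k)^T - (s + t k *: H))].
Proof.
move=> hc dc; set l := singvals s in dc *.
have FP : ProperFilter F by exact: ultra_proper.
pose s_ k := s + t k *: h_ k; pose l_ k := singvals (s_ k).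
have /choice[PQ_ HPQ] : forall k, exists PQ : 'M[R]_n * 'M[R]_(n + r),
    [/\ orthogonal_mx PQ.1, orthogonal_mx PQ.2 & s_ k = PQ.1 *m rdiag r (l_ k) *m PQ.2^T].
  by move=> k; have [P [Q H3]] := singular_decomposition (s_ k); exists (P, Q).
pose P_ k := (PQ_ k).1; pose Q_ k := (PQ_ k).2.
have oP_ k : orthogonal_mx (P_ k) by have [] := HPQ k.
have oQ_ k : orthogonal_mx (Q_ k) by have [] := HPQ k.
have s_E k : s_ k = P_ k *m rdiag r (l_ k) *m (Q_ k)^T by have [] := HPQ k.
have [P oP Pc] := orthogonal_ultra_cvg oP_.
have [Q oQ Qc] := orthogonal_ultra_cvg oQ_.
have lc : l_ @ F --> l by exact: cvg_quotient dc.
have sE : s = P *m rdiag r l *m Q^T.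
  apply: (@cvg_limit_unique 'M[R]_(n, n + r) s_); first exact: (cvg_add_small hc).
  rewrite (_ : s_ = fun k => P_ k *m rdiag r (l_ k) *m (Q_ k)^T).
    apply: cvg_mulmx; [apply: cvg_mulmx => //|exact: cvg_trmx].
    exact: (linear_cvg (f := @rdiag R n r)).
  by apply/funext => k.
pose K := P^T *m H *m Q; pose K_ k := P^T *m h_ k *m Q.
pose W_ k := P^T *m P_ k; pose Z_ k := Q^T *m Q_ k.
have Kc : K_ @ F --> K.
  by apply: cvg_mulmx; [apply: cvg_mulmx => //; exact: cvg_cst|exact: cvg_cst].
have Wc : W_ @ F --> (1%:M : 'M[R]_n) by rewrite -oP; apply: cvg_mulmx => //; exact: cvg_cst.
have Zc : Z_ @ F --> (1%:M : 'M[R]_(n + r)) by rewrite -oQ; apply: cvg_mulmx => //; exact: cvg_cst.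
have Xc : (fun k => K_ k *m Z_ k) @ F --> K by rewrite -[K]mulmx1; exact: cvg_mulmx.
have Yc : (fun k => (K_ k)^T *m W_ k) @ F --> K^T.
  by rewrite -[K^T]mulmx1; apply: cvg_mulmx => //; exact: cvg_trmx.
have WE k : W_ k *m rdiag r (l_ k) = rdiag r l *m Z_ k + t k *: (K_ k *m Z_ k).
  have E1 : P^T *m s_ k *m Q_ k = W_ k *m rdiag r (l_ k).
    by rewrite {1}s_E /W_ !mulmxA -[LHS]mulmxA oQ_ mulmx1.
  have E2 : P^T *m s_ k = rdiag r l *m Q^T + t k *: (P^T *m h_ k).
    by rewrite /s_ mulmxDr -scalemxAr {1}sE !mulmxA oP mul1mx.
  rewrite -E1 E2 mulmxDl -scalemxAl /Z_ !mulmxA; congr (_ + _ *: _).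
  by rewrite /K_ -[_ *m Q *m Q^T]mulmxA orthogonal_mxr// mulmx1.
have ZE k : Z_ k *m (rdiag r (l_ k))^T = (rdiag r l)^T *m W_ k + t k *: ((K_ k)^T *m W_ k).
  have E1 : Q^T *m (s_ k)^T *m P_ k = Z_ k *m (rdiag r (l_ k))^T.
    by rewrite {1}s_E /Z_ !trmx_mul trmxK !mulmxA -[LHS]mulmxA oP_ mulmx1.
  have E2 : Q^T *m (s_ k)^T = (rdiag r l)^T *m P^T + t k *: (Q^T *m (h_ k)^T).
    rewrite /s_ linearD linearZ /= mulmxDr -scalemxAr {1}sE !trmx_mul trmxK !mulmxA oQ.
    by rewrite mul1mx.
  rewrite -E1 E2 mulmxDl -scalemxAl /W_ !mulmxA; congr (_ + _ *: _).
  by rewrite /K_ !trmx_mul trmxK !mulmxA -[_ *m P *m P^T]mulmxA orthogonal_mxr// mulmx1.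
have ent k := singular_entries (lt0r_neq0 (t_gt0 k)) (WE k) (ZE k).
have Ksum a i : l a 0 = l i 0 -> K a (lshift r i) + K i (lshift r a) = (l' i 0 *+ (a == i)) *+ 2.
  move=> lai.
  apply: (@cvg_limit_unique R^o (fun k => (K_ k *m Z_ k) a (lshift r i) + ((K_ k)^T *m W_ k) (lshift r a) i)).
    rewrite [K i _](_ : _ = K^T (lshift r a) i); last by rewrite [RHS]mxE.
    by apply: cvgD; exact: cvg_entry.
  rewrite (_ : (fun k => _) = fun k => (W_ k a i + Z_ k (lshift r a) (lshift r i))
      * ((t k)^-1 *: (l_ k - l)) i 0); last first.
    by apply/funext => k; have [-> //] := ent k.
  rewrite (_ : _ *+ 2 = ((1%:M : 'M[R]_n) a i + (1%:M : 'M[R]_(n + r)) (lshift r a) (lshift r i)) * l' i 0).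
    by apply: cvgM; [apply: cvgD; exact: cvg_entry|exact: cvg_entry].
  by rewrite !mxE (inj_eq (@lshift_inj _ _)); case: (a == i); rewrite ?mulr1n ?mulr0n; ring.
have Kdiff a i : l a 0 = 0 -> l i 0 = 0 -> K a (lshift r i) = K i (lshift r a).
  move=> la li; apply/eqP; rewrite -subr_eq0; apply/eqP.
  apply: (@cvg_limit_unique R^o (fun k => (K_ k *m Z_ k) a (lshift r i) - ((K_ k)^T *m W_ k) (lshift r a) i)).
    rewrite [K i _](_ : _ = K^T (lshift r a) i); last by rewrite [RHS]mxE.
    by apply: cvgB; exact: cvg_entry.
  rewrite (_ : (fun k => _) = fun k => (W_ k a i - Z_ k (lshift r a) (lshift r i))
      * ((t k)^-1 *: (l_ k - l)) i 0); last first.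
    by apply/funext => k; have [_ -> //] := ent k.
  rewrite (_ : 0 = ((1%:M : 'M[R]_n) a i - (1%:M : 'M[R]_(n + r)) (lshift r a) (lshift r i)) * l' i 0).
    by apply: cvgM; [apply: cvgB; exact: cvg_entry|exact: cvg_entry].
  by rewrite !mxE (inj_eq (@lshift_inj _ _)) subrr mul0r.
have Kzero a j : l a 0 = 0 -> K a (rshift n j) = 0.
  move=> la; apply: (@cvg_limit_unique R^o (fun k => (K_ k *m Z_ k) a (rshift n j))); first exact: cvg_entry.
  rewrite (_ : (fun k => _) = fun=> 0); first exact: cvg_cst.
  by apply/funext => k; have [_ _ ->] := ent k.
have HK : H = P *m K *m Q^T.
  by rewrite /K !mulmxA orthogonal_mxr// mul1mx -mulmxA orthogonal_mxr// mulmx1.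
have l0 i : 0 <= l i 0 by exact: singvals_ge0.
clearbody K l.
pose p a i := (K a (lshift r i) + K i (lshift r a)) / (l i 0 - l a 0).
pose q a i := (K a (lshift r i) - K i (lshift r a)) / (l i 0 + l a 0).
have pT a i : p i a = - p a i by rewrite /p -mulrN -invrN opprB addrC.
have qT a i : q i a = - q a i by rewrite /q -mulNr opprB [l a 0 + _]addrC.
(* [p] and [q] solve the equation [KE] below for the skew generators; a division
   by [0] occurs only where the corresponding combination of [K] is diagonal or
   zero. *)
pose O1 : 'M[R]_n := \matrix_(a, i) ((p a i + q a i) / 2).
pose B : 'M[R]_(n, r) := \matrix_(a, j) (K a (rshift n j) / l a 0).
pose O2 : 'M[R]_(n + r) := block_mx (\matrix_(a, i) ((p a i - q a i) / 2)) (- B) B^T 0.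
have O1T : O1^T = - O1 by apply/matrixP => a i; rewrite !mxE pT qT -opprD mulNr.
have O2T : O2^T = - O2.
  rewrite /O2 tr_block_mx opp_block_mx trmxK linearN /= trmx0 oppr0 opprK.
  by congr block_mx; apply/matrixP => a i; rewrite !mxE pT qT -opprD mulNr.
have KE : K = O1 *m rdiag r l + rdiag r l *m O2^T + rdiag r l'.
  apply/matrixP => a j; rewrite 2!addmxE O2T rdiag_mulE [(- O2) _ _]mxE.
  case: (split_ordP j) => i ->.
    rewrite mul_rdiagEl /O2 block_mxEul rdiagE /= !mxE.
    rewrite (_ : (a == i :> nat) = (a == i))//.
    have -> : (p a i + q a i) / 2 * l i 0 + l a 0 * - ((p a i - q a i) / 2)
        = (p a i * (l i 0 - l a 0) + q a i * (l i 0 + l a 0)) / 2 by field.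
    have -> : q a i * (l i 0 + l a 0) = K a (lshift r i) - K i (lshift r a).
      have [lai|lai] := eqVneq (l i 0 + l a 0) 0; last by rewrite /q mulfVK.
      have [li la] : l i 0 = 0 /\ l a 0 = 0 by move: (l0 i) (l0 a); split; lra.
      by rewrite lai mulr0 (Kdiff a i)// subrr.
    have -> : p a i * (l i 0 - l a 0)
        = K a (lshift r i) + K i (lshift r a) - (l' i 0 *+ (a == i)) *+ 2.
      have [lai|lai] := eqVneq (l i 0 - l a 0) 0.
        by rewrite lai mulr0 Ksum ?subrr//; lra.
      have ai : a == i = false by apply: contraNF lai => /eqP->; rewrite subrr.
      by rewrite ai mulr0n mul0rn subr0 /p mulfVK.
    by case: (eqVneq a i) => [<-|_]; rewrite ?mulr1n ?mulr0n; field.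
  have -> : rdiag r l' a (rshift n i) = 0 by rewrite /rdiag row_mxEr mxE.
  rewrite mul_rdiagEr /O2 block_mxEur !mxE opprK add0r addr0; have [la|la] := eqVneq (l a 0) 0; first by rewrite la mul0r Kzero.
  by rewrite mulrC mulfVK.
have [C0 [oC0 C0O]] := @cayley R F FP t t_gt0 n O1 O1T.
have [E0 [oE0 E0O]] := @cayley R F FP t t_gt0 _ O2 O2T.
have first_order m (X0 : nat -> 'M[R]_m) (X O : 'M[R]_m) :
    Opow F t 2 (fun k => X0 k - 1%:M - t k *: O) -> Opow F t 1 (fun k => X *m X0 k - X).
  move=> XO; have X1 : Opow F t 1 (fun k => X0 k - 1%:M).
    apply: (@Opow_ext _ F t _ _ (fun k => X0 k - 1%:M - t k *: O + t k *: O)).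
      by move=> k; rewrite subrK.
    apply: Opow_add; first exact: Opow_weaken XO.
    by apply: Opow_scale => //; exact: Opow_cst.
  apply: (Opow_ext _ (Opow_conj X 1%:M X1)) => k.
  by rewrite mulmx1 mulmxBr mulmx1.
exists P, Q, (fun k => P *m C0 k), (fun k => Q *m E0 k); split => //.
- by move=> k; split; exact: orthogonal_mxM.
- by split; [exact: first_order C0O|exact: first_order E0O].
have X := @rotation_expansion R F FP t t_gt0 t_cvg n (n + r) C0 E0 O1 O2 (rdiag r l)
  (rdiag r l') C0O E0O.
apply: (Opow_ext _ (Opow_conj P Q^T X)) => k.
rewrite -KE mulmxBr mulmxBl; congr (_ - _).
  rewrite trmx_mul !mulmxA; congr (_ *m _ *m _); rewrite -!mulmxA; congr (_ *m (_ *m _)).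
  by rewrite !linearD /= !linearZ.
by rewrite mulmxDr mulmxDl -sE -scalemxAr -scalemxAl -HK.
Qed.

End Tangents.

(** * The spectral systems of rectangular and symmetric matrices *)

Lemma Opow_rotate (R : realType) (F : set_system nat) {FF : ProperFilter F} (t : nat -> R) n m
  (C : nat -> 'M[R]_n) (E : nat -> 'M[R]_m) (P : 'M[R]_n) (Q : 'M[R]_m) (x : 'M[R]_(n, m)) :
  (forall k, 0 < t k) -> (forall k, orthogonal_mx (E k)) ->
  Opow F t 1 (fun k => C k - P) -> Opow F t 1 (fun k => E k - Q) ->
  Opow F t 1 (fun k => C k *m x *m (E k)^T - P *m x *m Q^T).
Proof.
move=> t0 oE CP EQ.
have E0 : Opow F t 0 (fun k => (E k)^T).
  exists 1; apply: nearW => k; rewrite expr0 mulr1.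
  exact: orthogonal_norm_le (orthogonal_mxT (oE k)).
have T1 : Opow F t (1 + 0 + 0) (fun k => (C k - P) *m x *m (E k)^T).
  by apply: Opow_mulmx => //; apply: Opow_mulmx => //; exact: Opow_cst.
have T2 : Opow F t (0 + 1) (fun k => (P *m x) *m (E k - Q)^T).
  by apply: Opow_mulmx => //; [exact: Opow_cst|exact: Opow_tr].
apply: (Opow_ext _ (Opow_add T1 T2)) => k.
by rewrite linearB /= mulmxBr mulmxBl mulmxBl addrA subrK.
Qed.

Section RectangularSystem.
Context {R : realType} (n r : nat).

Definition rect_group : set ('M[R]_(n, n + r) -> 'M[R]_(n, n + r)) :=
  [set U | exists (P : 'M[R]_n) (Q : 'M[R]_(n + r)),
    [/\ orthogonal_mx P, orthogonal_mx Q & U = fun B => P *m B *m Q^T]].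

Lemma rect_system : @spectral_system R 'M[R]_(n, n + r) n
  (fun B => singvals B) (rdiag r : {linear 'cV[R]_n -> 'M[R]_(n, n + r)}) rect_group.
Proof.
split.
- move=> _ [P [Q [oP oQ ->]]] a x y.
  by rewrite mulmxDr mulmxDl -scalemxAr -scalemxAl.
- by move=> _ [P [Q [oP oQ ->]]] x y; exact: dot_orthogonal.
- move=> _ _ [P [Q [oP oQ ->]]] [P' [Q' [oP' oQ' ->]]].
  exists (P *m P'), (Q *m Q'); split; try exact: orthogonal_mxM.
  by apply/funext => B /=; rewrite [(Q *m _)^T]trmx_mul !mulmxA.
- move=> _ [P [Q [oP oQ ->]]]; exists (fun B => P^T *m B *m Q^T^T).
    by exists P^T, Q^T; split => //; exact: orthogonal_mxT.
  move=> B; rewrite trmxK !mulmxA orthogonal_mxr// mul1mx -mulmxA orthogonal_mxr//.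
  by rewrite mulmx1.
- by move=> _ [P [Q [oP oQ ->]]] x; exact: singvals_conj.
- by move=> l l'; exact: dot_rdiag.
- move=> x; have [P [Q [oP oQ xE]]] := singular_decomposition x.
  by exists (fun B => P *m B *m Q^T) => //; exists P, Q.
- by move=> x y; exact: von_neumann.
- exists ('I_n * 'I_n + 'I_n)%type, (fun i : ('I_n * 'I_n + 'I_n)%type => match i return 'cV[R]_n with
    | inl (i, j) => if (i <= j)%N then delta_mx i 0 - delta_mx j 0 else 0
    | inr i => delta_mx i 0 end) => l.
  have dd (i : 'I_n) : dot (delta_mx i 0) l = l i 0.
    by rewrite dot_colE trmx_delta -rowE mxE.
  split=> [/singvals_rdiagE[sl l0] [[i j]|i]|H].
  + by case: ifP => ij; rewrite ?dot0l// dotBl !dd subr_ge0 sl.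
  + by rewrite dd.
  apply/singvals_rdiagE; split=> [i j ij|i]; last by have := H (inr i); rewrite dd.
  by have := H (inl (i, j)); rewrite ij dotBl !dd subr_ge0.
move=> F t h_ s H l' FU t0 tc hc dc.
have FP : ProperFilter F by exact: ultra_proper.
have [P [Q [C [E [[oP oQ] sE oCE [CP EQ] CE]]]]] := singular_tangent t0 tc hc dc.
exists (fun B => P *m B *m Q^T), (fun k B => C k *m B *m (E k)^T); split => //.
- by exists P, Q.
- by move=> k; have [oC oE] := oCE k; exists (C k), (E k).
- move=> x; have [|M HM] := @Opow_rotate R F FP t n (n + r) C E P Q x t0 _ CP EQ.
    by move=> k; have [] := oCE k.
  by exists M; apply: filterS HM => k; rewrite expr1.
have [M HM] := CE; exists M; apply: filterS HM => k.
by rewrite opprD addrA.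
Qed.

End RectangularSystem.

Section SymmetricSystem.
Context {R : realType} (n : nat).

Lemma symvalK (A : symmx R n) : (symval A)^T = symval A.
Proof. exact/eqP/(valP A). Qed.

Fact conj_sym_subproof (P : 'M[R]_n) (A : symmx R n) :
  P *m symval A *m P^T \in @symmetric_mx R n.
Proof. by apply/eqP; rewrite !trmx_mul trmxK symvalK mulmxA. Qed.

Definition conj_sym (P : 'M[R]_n) (A : symmx R n) : symmx R n :=
  SymMx (conj_sym_subproof P A).

Fact sdiag_subproof (x : 'cV[R]_n) : diag_mx x^T \in @symmetric_mx R n.
Proof. by apply/eqP; exact: tr_diag_col. Qed.

Definition sdiag (x : 'cV[R]_n) : symmx R n := SymMx (sdiag_subproof x).

Fact sdiag_linear : linear sdiag.
Proof. by move=> a x y; apply: val_inj; rewrite /= !linearP. Qed.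

HB.instance Definition _ := GRing.isLinear.Build R 'cV[R]_n (symmx R n) _ sdiag sdiag_linear.

Lemma dot_diag (x y : 'cV[R]_n) : dot (diag_mx x^T) (diag_mx y^T) = dot x y.
Proof.
rewrite !dot_mxE tr_diag_col mulmx_diag mxtrace_diag /mxtrace big_ord1 mxE.
by apply: eq_bigr => i _; rewrite !mxE.
Qed.

Lemma symval_cvg T (F : set_system T) {FF : Filter F} (u : T -> symmx R n) (a : symmx R n) :
  u @ F --> a -> (fun k => symval (u k)) @ F --> symval a.
Proof.
move=> ua; apply: (@cvg_le_norm _ _ _ _ _ _ _ (fun k => `|u k - a|)).
  exact: nearW.
by apply/norm_cvg0P/subr_cvg0.
Qed.

Definition sym_group : set (symmx R n -> symmx R n) :=
  [set U | exists2 P : 'M[R]_n, orthogonal_mx P & U = conj_sym P].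

Lemma sym_system : @spectral_system R (symmx R n) n
  (fun B => eigvals (symval B)) (sdiag : {linear 'cV[R]_n -> symmx R n}) sym_group.
Proof.
split.
- move=> _ [P oP ->] a x y; apply: val_inj => /=.
  by rewrite mulmxDr mulmxDl -scalemxAr -scalemxAl.
- by move=> _ [P oP ->] x y; exact: dot_orthogonal.
- move=> _ _ [P oP ->] [P' oP' ->].
  exists (P *m P'); first exact: orthogonal_mxM.
  by apply/funext => B; apply: val_inj; rewrite /= [(P *m _)^T]trmx_mul !mulmxA.
- move=> _ [P oP ->]; exists (conj_sym P^T).
    by exists P^T => //; exact: orthogonal_mxT.
  move=> B; apply: val_inj; rewrite /= trmxK !mulmxA orthogonal_mxr// mul1mx.
  by rewrite -mulmxA orthogonal_mxr// mulmx1.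
- by move=> _ [P oP ->] x; exact: eigvals_conj.
- by move=> l l'; exact: dot_diag.
- move=> x; have [P oP xE] := spectral_decomposition (symvalK x).
  by exists (conj_sym P); [exists P|exact: val_inj].
- by move=> x y; apply: fan_eigvals; exact: symvalK.
- exists ('I_n * 'I_n)%type, (fun ij : 'I_n * 'I_n =>
    if (ij.1 <= ij.2)%N then delta_mx ij.1 0 - delta_mx ij.2 0 else 0) => l.
  have dd (i : 'I_n) : dot (delta_mx i 0) l = l i 0.
    by rewrite dot_colE trmx_delta -rowE mxE.
  split=> [/eigvals_diagE sl [i j] /=|H].
    by case: ifP => ij; rewrite ?dot0l// dotBl !dd subr_ge0 sl.
  apply/eigvals_diagE => i j ij.
  by have := H (i, j); rewrite /= ij dotBl !dd subr_ge0.
move=> F t h_ s H l' FU t0 tc hc dc.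
have FP : ProperFilter F by exact: ultra_proper.
have [P [C [oP sE oC CP CE]]] := eigen_tangent t0 tc (symvalK s)
  (fun k => symvalK (h_ k)) (symval_cvg hc) dc.
exists (conj_sym P), (fun k => conj_sym (C k)); split => //.
- by exists P.
- exact: val_inj.
- by move=> k; exists (C k).
- move=> x; have [M HM] := @Opow_rotate R F FP t n n C C P P (symval x) t0 oC CP CP.
  by exists M; apply: filterS HM => k; rewrite expr1.
have [M HM] := CE; exists M; apply: filterS HM => k.
by rewrite opprD addrA.
Qed.

End SymmetricSystem.

(** * Symmetric functions and the admissible spectral settings *)

Section Symmetry.
Context {R : realType} (n : nat).
Implicit Types (g : 'cV[R]_n -> \bar R) (x : 'cV[R]_n).

Lemma orthogonal_diag_sign (eps : 'rV[R]_n) : (forall j, eps 0 j = 1 \/ eps 0 j = -1) ->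
  orthogonal_mx (diag_mx eps).
Proof.
move=> e1; rewrite /orthogonal_mx tr_diag_mx mulmx_diag -diag_const_mx; congr diag_mx.
by apply/rowP => j; rewrite !mxE; case: (e1 j) => ->; rewrite ?mulrNN mulr1.
Qed.

Lemma conjugate_invariant g (T : 'M[R]_n) : orthogonal_mx T ->
  (forall x, g (T *m x) = g x) -> forall x, conjugate g (T *m x) = conjugate g x.
Proof.
move=> oT gT x; apply/le_anti/andP; split; apply: ge_ereal_sup => _ [u _ <-] /=.
  apply: ereal_sup_ubound; exists (T^T *m u) => //.
  by rewrite -gT mulmxA orthogonal_mxr// mul1mx dot_mulmxl trmxK.
apply: ereal_sup_ubound; exists (T *m u) => //.
by rewrite gT dot_mulmxl mulmxA oT mul1mx.
Qed.

Lemma conjugate_perm_symmetric g : perm_symmetric g -> perm_symmetric (conjugate g).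
Proof.
by move=> gs s x; apply: conjugate_invariant => //; exact: orthogonal_mx_perm.
Qed.

Lemma conjugate_abs_symmetric g : abs_symmetric g -> abs_symmetric (conjugate g).
Proof.
move=> gs s eps e1 x; apply: conjugate_invariant; last by move=> y; exact: gs.
by apply: orthogonal_mxM; [exact: orthogonal_diag_sign|exact: orthogonal_mx_perm].
Qed.

Lemma abs_symmetric_perm g : abs_symmetric g -> perm_symmetric g.
Proof.
move=> gs s x; rewrite -[RHS](gs s (const_mx 1)); last by move=> j; rewrite mxE; left.
by rewrite diag_const_mx mul1mx.
Qed.

Lemma perm_symmetric_eigvals g : perm_symmetric g ->
  forall l, g (eigvals (diag_mx l^T)) = g l.
Proof. by move=> gs l; have [s ->] := eigvals_diag_perm l; exact: gs. Qed.

Lemma abs_signed_perm (x y : 'cV[R]_n) (s : 'S_n) : (forall i, y i 0 = `|x (s i) 0|) ->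
  exists2 eps : 'rV[R]_n, forall j, eps 0 j = 1 \/ eps 0 j = -1 &
    y = diag_mx eps *m perm_mx s *m x.
Proof.
move=> yE; exists (\row_j (if x (s j) 0 < 0 then -1 else 1)) => [j|].
  by rewrite mxE; case: ifP; [right|left].
apply/colP => i; rewrite -mulmxA mul_diag_mx -row_permE !mxE yE.
by case: ltP => [/ltr0_norm->|/ger0_norm->]; rewrite ?mulN1r ?mul1r.
Qed.

Lemma abs_symmetric_singvals g r : abs_symmetric g ->
  forall l, g (singvals (rdiag r l)) = g l.
Proof.
move=> gs l; have [s sE] := singvals_rdiag r l.
by have [eps e1 ->] := abs_signed_perm sE; exact: gs.
Qed.

(** Singular values of a symmetric matrix are the absolute values of its
    eigenvalues, so an absolutely symmetric function of them is the same function
    of the eigenvalues. *)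
Lemma singvals_symmetric (A : 'M[R]_n) : A^T = A ->
  exists s : 'S_n, forall i, singvals A i 0 = `|eigvals A (s i) 0|.
Proof.
move=> sA; have [P oP AE] := spectral_decomposition sA.
have AA : A *m A^T = P *m diag_mx (\col_i (eigvals A i 0) ^+ 2)^T *m P^T.
  rewrite sA {1 2}AE !mulmxA -[_ *m P^T *m P]mulmxA oP mulmx1; congr (_ *m _).
  rewrite -mulmxA mulmx_diag; congr (_ *m diag_mx _).
  by apply/rowP => i; rewrite !mxE expr2.
rewrite /singvals AA eigvals_conj//.
have [s ->] := eigvals_diag_perm (\col_i (eigvals A i 0) ^+ 2).
by exists s => i; rewrite mxE perm_mx_mulE mxE sqrtr_sqr.
Qed.

Lemma abs_symmetric_sym g : abs_symmetric g ->
  forall B : symmx R n, g (singvals (symval B)) = g (eigvals (symval B)).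
Proof.
move=> gs B; have [s sE] := singvals_symmetric (symvalK B).
by have [eps e1 ->] := abs_signed_perm sE; exact: gs.
Qed.

Lemma conjugate_gtNy (V : euclidType R) (p : V -> \bar R) v : proper_fun p -> conjugate p v != -oo%E.
Proof.
move=> [pN [u pu]]; rewrite -ltNye.
apply: (@lt_le_trans _ _ ((dot u v)%:E - p u)%E); last by apply: ereal_sup_ubound; exists u.
by move: pu (pN u); rewrite /effdom /=; case: (p u) => [r| |]// _ _; rewrite ltNye.
Qed.

End Symmetry.

(** The conjugate of a spectral function is the same spectral function of the
    conjugate, and it inherits second-order regularity from it.  For singular
    values of symmetric matrices one passes to eigenvalues: the signed
    permutation between the two spectra is an isometry that preserves the
    conjugate of [g]. *)
Theorem spectral_setting_regular (R : realType) (n : nat) (X : euclidType R)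
    (spec : X -> 'cV[R]_n) (symmetry : ('cV[R]_n -> \bar R) -> Prop)
    (g : 'cV[R]_n -> \bar R) (s : X) :
  spectral_setting spec symmetry -> proper_fun g -> symmetry g ->
  fun_cone_reducible (conjugate g) (spec s) ->
  outer_regular (conjugate (g \o spec)) s.
Proof.
move=> setting pg; case: setting s => [m nm|{X spec symmetry}|{X spec symmetry}] s gs [gfin red].
- move: s gfin red; rewrite -(subnKC nm); move: (m - n)%N => r s gfin red.
  have gsym := abs_symmetric_singvals r gs.
  have gsym' := abs_symmetric_singvals r (conjugate_abs_symmetric gs).
  rewrite (conjugate_spectral (rect_system n r) gsym).
  apply: (spectral_outer_regular (rect_system n r)) => //.
    by rewrite fin_numE conjugate_gtNy//= -ltey.
  exact: cone_reducible_regular.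
- have gsp := abs_symmetric_perm gs.
  have -> : g \o (fun B : symmx R n => singvals (symval B))
      = g \o (fun B : symmx R n => eigvals (symval B)).
    by apply/funext => B /=; exact: abs_symmetric_sym.
  have gsym := perm_symmetric_eigvals gsp.
  have gsym' := perm_symmetric_eigvals (conjugate_perm_symmetric gsp).
  have cgs := abs_symmetric_sym (conjugate_abs_symmetric gs) s.
  rewrite (conjugate_spectral (sym_system n) gsym).
  apply: (spectral_outer_regular (sym_system n)) => //.
    by rewrite -cgs fin_numE conjugate_gtNy//= -ltey.
  have [p pE] := singvals_symmetric (symvalK s).
  have [eps e1 TE] := abs_signed_perm pE.
  set T := diag_mx eps *m perm_mx p in TE.
  have oT : orthogonal_mx T.
    by apply: orthogonal_mxM; [exact: orthogonal_diag_sign|exact: orthogonal_mx_perm].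
  have gT x : conjugate g (T *m x) = conjugate g x by exact: (conjugate_abs_symmetric gs).
  pose f (z : 'cV[R]_n * R^o) : 'cV[R]_n * R^o := (T *m z.1, z.2).
  pose f' (z : 'cV[R]_n * R^o) : 'cV[R]_n * R^o := (T^T *m z.1, z.2).
  apply: (@second_order_regular_isometry _ _ _ f f').
  + by move=> a x y; rewrite /f /= mulmxDr -scalemxAr.
  + move=> x y; rewrite [LHS]/(dot (T *m x.1) (T *m y.1) + dot x.2 y.2).
    by rewrite dot_mulmxl mulmxA oT mul1mx.
  + by move=> [x y]; rewrite /f /f' /= mulmxA orthogonal_mxr// mul1mx.
  + by move=> [x y]; rewrite /f /epi /= gT.
  by rewrite /f /= -cgs -TE; exact: cone_reducible_regular.
have gsym := perm_symmetric_eigvals gs.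
have gsym' := perm_symmetric_eigvals (conjugate_perm_symmetric gs).
rewrite (conjugate_spectral (sym_system n) gsym).
apply: (spectral_outer_regular (sym_system n)) => //.
  by rewrite fin_numE conjugate_gtNy//= -ltey.
exact: cone_reducible_regular.
Qed.

(** * Directional epiderivatives and tangent cones along filters *)

Section EpiDerivatives.
Context {R : realType}.
Local Open Scope ereal_scope.

Lemma limf_einf_le (T0 : choiceType) (T : filteredType T0) (G : set_system T)
  (F : set_system nat) {FF : ProperFilter F} (z : nat -> T) (f : T -> \bar R) (c : \bar R) :
  z @ F --> G -> (\forall k \near F, f (z k) <= c) -> limf_einf f G <= c.
Proof.
move=> zG fz; rewrite limf_einfE; apply: ge_ereal_sup => _ [V GV <-].
have FV : F (z @^-1` V) by exact: zG.
have [k [Vk fk]] := @filter_ex _ F _ _ (@filterI _ F _ _ _ FV fz).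
by apply: le_trans fk; apply: ereal_inf_lbound; exists (z k).
Qed.

Lemma limf_einf_ge (T0 : choiceType) (T : filteredType T0) (G : set_system T) (f : T -> \bar R) (c : \bar R) :
  G [set z | c <= f z] -> c <= limf_einf f G.
Proof.
move=> Gc; rewrite limf_einfE; apply: (@le_trans _ _ (ereal_inf (f @` [set z | c <= f z]))).
  by apply: le_ereal_inf_tmp => _ [z cz <-].
by apply: ereal_sup_ubound; exists [set z | c <= f z].
Qed.

Context {V : euclidType R} (F : set_system nat) {FF : ProperFilter F}.
Variables (t : nat -> R).
Hypothesis t_gt0 : forall k, (0 < t k)%R.
Hypothesis t_cvg : t @ F --> (0 : R)%R.

Lemma cvg_at_right0 : t @ F --> (0 : R)^'+.
Proof.
move=> A /= [e /= e0 eA].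
have L := t_cvg; move/cvgrPdist_lt: L => /(_ _ e0).
by apply: filterS => k tk; apply: eA => //=; exact: t_gt0.
Qed.

(** The subgradient bounds all difference quotients from below, and the given
    points attain the bound in the limit. *)
Lemma epideriv_subdiff (p : V -> \bar R) (u x d : V) (d_ : nat -> V) (p0 : R) (p_ : nat -> R) :
  p u = p0%:E -> subdiff p u x -> d_ @ F --> d ->
  (\forall k \near F, p (u + t k *: d_ k)%R = (p_ k)%:E) ->
  (forall eps, (0 < eps)%R -> \forall k \near F,
    (p_ k - p0 - t k * dot x (d_ k) <= eps * t k)%R) ->
  epideriv p u d = (dot x d)%:E.
Proof.
move=> pu px dc pE p_le; have Lx : (fun k => dot x (d_ k)) @ F --> dot x d.
  by apply: cvg_dot => //; exact: cvg_cst.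
apply/le_anti/andP; split.
  apply/lee_addgt0Pr => eps eps0; have e2 : (0 < eps / 2)%R by rewrite divr_gt0.
  apply: (@limf_einf_le _ _ _ F _ (fun k => (t k, d_ k))).
    exact: (cvg_pair cvg_at_right0 dc).
  move/cvgrPdist_le: Lx => Lx.
  near=> k; have tk := t_gt0 k => /=.
  have -> : p (u + t k *: d_ k)%R = (p_ k)%:E by near: k.
  rewrite pu -EFinB -EFinM -EFinD lee_fin ler_pdivrMr//.
  have h1 : (p_ k - p0 - t k * dot x (d_ k) <= eps / 2 * t k)%R by near: k; exact: p_le.
  have : (`|dot x d - dot x (d_ k)| <= eps / 2)%R by near: k; exact: Lx.
  rewrite ler_norml => /andP[h2 _].
  have := ler_wpM2r (ltW tk) h2; lra.
apply/lee_addgt0Pr => eps eps0.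
rewrite -leeBlDr// -EFinB; apply: limf_einf_ge.
have dnear : \forall d' \near d, (`|dot x d - dot x d'| <= eps)%R.
  have : dot x d' @[d' --> d] --> dot x d by apply: cvg_dot; [exact: cvg_cst|exact: cvg_id].
  by move=> /cvgrPdist_le /(_ _ eps0).
exists ([set s | (0 < s)%R], [set d' | (`|dot x d - dot x d'| <= eps)%R]) => /=.
  by split => //; exact: nbhs_right_gt.
move=> [s d'] /= [s0 dd']; have := px (u + s *: d')%R.
rewrite [(u + _)%R]addrC addrK dotZr pu -EFinD.
have : (dot x d - eps <= dot x d')%R by move: dd'; rewrite ler_norml => /andP[_]; lra.
case: (p _) => [r| |]//=; last by move=> _ _; rewrite addye// gt0_mulye ?lte_fin ?invr_gt0// leey.
rewrite !lee_fin => h1 h2; rewrite ler_pdivlMr//.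
have := ler_wpM2r (ltW s0) h1; lra.
Unshelve. all: by end_near. Qed.

Lemma epideriv2_le (p : V -> \bar R) (u d w : V) (w_ : nat -> V) (p0 D L : R) :
  p u = p0%:E -> epideriv p u d = D%:E -> w_ @ F --> w ->
  (forall eps, (0 < eps)%R -> \forall k \near F,
     p (u + t k *: d + (t k ^+ 2 / 2) *: w_ k)%R <=
     (p0 + t k * D + (t k ^+ 2 / 2) * (L + eps))%R%:E) ->
  epideriv2 p u d w <= L%:E.
Proof.
move=> pu pd wc pw; apply/lee_addgt0Pr => eps eps0.
apply: (@limf_einf_le _ _ _ F _ (fun k => (t k, w_ k))).
  exact: (cvg_pair cvg_at_right0 wc).
near=> k; have tk := t_gt0 k => /=.
have t2 : (0 < t k ^+ 2 / 2)%R by rewrite divr_gt0// exprn_gt0.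
have : p (u + t k *: d + (t k ^+ 2 / 2) *: w_ k)%R <=
    (p0 + t k * D + (t k ^+ 2 / 2) * (L + eps))%R%:E by near: k; exact: pw.
rewrite pu pd; case: (p _) => [r| |]//=.
  rewrite !lee_fin => h.
  by rewrite ler_pdivrMr// mulrC; lra.
by move=> _; rewrite gt0_mulNye ?leNye// lte_fin invr_gt0.
Unshelve. all: by end_near. Qed.

(** Diagonal extraction turns a limit along a filter into a limit of a sequence. *)
Lemma tangent_cone_limit (D : set V) (u v : V) (u_ : nat -> V) :
  (forall k, D (u_ k)) -> (fun k => (t k)^-1 *: (u_ k - u))%R @ F --> v ->
  tangent_cone D u v.
Proof.
move=> Du qc.
have /choice[i Hi] : forall j : nat, exists k, (t k < harmonic j)%R /\
    (`|(t k)^-1 *: (u_ k - u) - v| <= harmonic j)%R.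
  move=> j; have hj : (0 < harmonic j :> R)%R by exact: harmonic_gt0.
  have F1 : \forall k \near F, (t k < harmonic j)%R by apply: (cvgr_lt _ t_cvg).
  have F2 : \forall k \near F, (`|(t k)^-1 *: (u_ k - u) - v| <= harmonic j)%R.
    have L := qc; move/cvgrPdist_le: L => /(_ _ hj); apply: filterS => k; by rewrite distrC.
  by have [k [k1 k2]] := @filter_ex _ F _ _ (@filterI _ F _ _ _ F1 F2); exists k.
have hc : (harmonic j @[j --> \oo] --> (0 : R))%R by exact: cvg_harmonic.
have tc : (t (i j) @[j --> \oo] --> (0 : R))%R.
  apply: (@cvg_le_norm _ _ _ _ _ _ _ harmonic) => //.
  by apply: nearW => j; rewrite subr0 gtr0_norm// ltW//; have [] := Hi j.
have qc' : ((t (i j))^-1 *: (u_ (i j) - u) @[j --> \oo] --> v)%R.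
  apply: (@cvg_le_norm _ _ _ _ _ _ _ harmonic) => //.
  by apply: nearW => j; have [] := Hi j.
exists (u_ \o i), (t \o i); split => //; [by move=> k; exact: Du| |by move=> k; exact: t_gt0].
have E : (u_ \o i = fun j => u + t (i j) *: ((t (i j))^-1 *: (u_ (i j) - u)))%R.
  by apply/funext => j /=; rewrite scalerA mulfV ?gt_eqF// scale1r addrC subrK.
rewrite E -[X in _ --> X]addr0 -[X in _ --> (_ + X)%R](scale0r v).
apply: cvgD; [exact: cvg_cst|exact: (cvgZ tc qc')].
Qed.

End EpiDerivatives.

(** * Second-order Taylor expansion and gradients *)

Section Taylor.
Context {R : realType} {n : nat}.
Implicit Types (f : 'cV[R]_n -> R^o) (x v : 'cV[R]_n).

Lemma diff_grad f x v : differentiable f x -> 'd f x v = dot (grad f x) v.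
Proof.
move=> fx; rewrite [v in LHS]matrix_sum_delta linear_sum [dot _ _]mxdotE big_ord1.
by apply: eq_bigr => i _; rewrite big_ord1 linearZ /= -deriveE// mxE [LHS]mulrC.
Qed.

Lemma diff_hess f x v i : differentiable ('D_(delta_mx i 0) f) x ->
  'd ('D_(delta_mx i 0) f) x v = \sum_j v j 0 * hess f x j i.
Proof.
move=> fx; rewrite diff_grad// [dot _ _]mxdotE big_ord1.
by apply: eq_bigr => j _; rewrite !mxE mulrC.
Qed.

(** Mean value theorem on the segment, for the difference between [f] and its
    quadratic model; the first partial derivatives are differentiable at [x]. *)
Lemma C2_taylor (D : set 'cV[R]_n) f x (eps : R) : C2_on D f -> D x -> 0 < eps ->
  exists2 r : R, 0 < r & forall v, `|v| < r ->
    `|f (x + v) - f x - dot (grad f x) v - dot v (hess f x *m v) / 2| <= eps * `|v| ^+ 2.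
Proof.
move=> [[oD fD] D2] Dx eps0.
have /nbhs_ballP[r1 /= r10 Dr1] : \forall z \near x, D z by exact: open_nbhs_nbhs.
have {}Dr1 v : `|v| < r1 -> D (x + v).
  move=> vr; apply: Dr1; rewrite -ball_normE /ball_/= opprD addrA subrr add0r normrN.
  exact: vr.
pose e1 := eps / n.+1%:R.
have e10 : 0 < e1 by rewrite divr_gt0.
have gd i : differentiable ('D_(delta_mx i 0) f) x by have [_ /(_ _ Dx)[]] := D2 (delta_mx i 0).
have /choice[r_ Hr] : forall i : 'I_n, exists r : R, 0 < r /\
    forall z, `|z - x| < r ->
    `|'D_(delta_mx i 0) f z - 'D_(delta_mx i 0) f x - 'd ('D_(delta_mx i 0) f) x (z - x)|
      <= e1 * `|z - x|.
  by move=> i; have [r r0 H] := diff_remainder (gd i) e10; exists r.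
have [r [r0 rr1 rr_]] : exists r, [/\ 0 < r, r <= r1 & forall i, r <= r_ i].
  exists (\big[Order.min/r1]_i r_ i); split.
  - by apply: lt_bigmin => // i _; have [] := Hr i.
  - exact: bigmin_le_id.
  - by move=> i; exact: bigmin_le.
exists r => // v vr.
set q := dot v _.
pose g (s : R) := dot (1 : R^o) (f (x + s *: v)) - (s * dot (grad f x) v + s * (s * (q / 2))).
have Ds (s : R) : s \in `[0, 1] -> `|s *: v| <= `|v|.
  rewrite in_itv/= => /andP[s0 s1]; rewrite normrZ ger0_norm//.
  by rewrite ler_piMl.
have dg (s : R) : s \in `[0, 1] -> is_derive s 1 g
    (dot (1 : R^o) ('D_v f (x + s *: v)) - (dot (grad f x) v + s * q)).
  move=> s01; have Dz : D (x + s *: v).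
    by apply: Dr1; apply: le_lt_trans (Ds _ s01) _; exact: lt_le_trans rr1.
  apply: is_deriveB.
    by apply: is_derive_line; apply: diff_derivable; have [] := fD _ Dz.
  apply: is_deriveD.
    apply: (is_derive_eq (is_deriveM (is_derive_id _ _) (is_derive_cst _ _ _))).
    by rewrite scaler0 add0r [_ *: _]mulr1.
  apply: (is_derive_eq (is_deriveM (is_derive_id _ _)
    (is_deriveM (is_derive_id _ _) (is_derive_cst _ _ _)))).
  rewrite scaler0 add0r /=.
  have E : s * (q / 2 * 1) + (s * (q / 2)) * 1 = s * q by field.
  exact: E.
have sub01 (s : R) : s \in `]0, 1[ -> s \in `[0, 1].
  by rewrite !in_itv/= => /andP[/ltW-> /ltW->].
have [s s01 gE] := MVT ltr01 (fun s s01 => dg s (sub01 s s01))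
  (derivable_within_continuous (fun s s01 => @ex_derive _ _ _ _ _ _ _ (dg s s01))).
have {}gE : f (x + v) - f x - dot (grad f x) v - q / 2 =
    'D_v f (x + s *: v) - 'D_v f x - s * q.
  have d1 (y : R) : dot (1 : R^o) (y : R^o) = y by exact: mul1r.
  move: gE; rewrite /g !d1 !mul1r !mul0r scale1r scale0r !addr0 !subr0 mulr1 => gE.
  have -> : 'D_v f x = dot (grad f x) v.
    by have [fx _] := fD _ Dx; rewrite -diff_grad// deriveE.
  have E (a b c l m k : R) : a - (l + k) - b = c - (l + m) -> a - b - l - k = c - l - m by lra.
  exact: E.
have DvE z : D z -> 'D_v f z = \sum_i v i 0 * 'D_(delta_mx i 0) f z.
  move=> Dz; have [fz _] := fD _ Dz; rewrite deriveE// diff_grad//.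
  rewrite [dot _ _]mxdotE big_ord1; apply: eq_bigr => i _; by rewrite mxE mulrC.
have sv := Ds _ (sub01 _ s01); have svr := le_lt_trans sv vr.
have xsv : x + s *: v - x = s *: v by rewrite addrC addrA addNr add0r.
have qE : s * q = \sum_i v i 0 * 'd ('D_(delta_mx i 0) f) x (s *: v).
  rewrite /q [dot _ _]mxdotE big_ord1 mulr_sumr.
  under [RHS]eq_bigr => i _ do rewrite linearZ /= diff_hess//.
  under [LHS]eq_bigr => i _ do rewrite mxE mulr_sumr mulr_sumr.
  under [RHS]eq_bigr => i _ do rewrite [_ *: _]mulr_sumr mulr_sumr.
  rewrite exchange_big; apply: eq_bigr => i _; apply: eq_bigr => j _ /=; ring.
rewrite gE !DvE//; last by apply: Dr1; exact: lt_le_trans rr1.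
rewrite qE -!sumrB; apply: le_trans (ler_norm_sum _ _ _) _.
apply: (@le_trans _ _ (\sum_(i < n) (e1 * `|v| ^+ 2))).
  apply: ler_sum => i _; rewrite -!mulrBr normrM expr2 mulrA mulrC.
  apply: ler_pM => //; last exact: mx_entry_norm.
  have := (Hr i).2 (x + s *: v); rewrite xsv => /(_ (lt_le_trans svr (rr_ i))) H.
  by apply: le_trans H _; rewrite ler_pM2l.
rewrite sumr_const card_ord -mulr_natl mulrA; apply: ler_wpM2r; first exact: sqr_ge0.
by rewrite /e1 mulrCA ger_pMr// ler_pdivrMr// mul1r ler_nat.
Qed.

(** By homogeneity, the linear functional [xi - grad] is bounded by every
    positive multiple of the norm. *)
Lemma subdiff_grad (p : 'cV[R]_n -> \bar R) (D : set 'cV[R]_n) x (xi : 'cV[R]_n) :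
  C1_on D (fine \o p : 'cV[R]_n -> R^o) -> D x -> (forall z, D z -> p z \is a fin_num) ->
  subdiff p x xi -> xi = grad (fine \o p : 'cV[R]_n -> R^o) x.
Proof.
move=> [oD fD] Dx pD sx; set f : 'cV[R]_n -> R^o := fine \o p.
have [fx _] := fD _ Dx.
have /nbhs_ballP[r1 /= r10 Dr1] : \forall z \near x, D z by exact: open_nbhs_nbhs.
have {}Dr1 z : `|z - x| < r1 -> D z.
  by move=> zr; apply: Dr1; rewrite -ball_normE /ball_/= distrC.
have near_le (eps : R) : 0 < eps -> forall v, dot (xi - grad f x) v <= eps * `|v|.
  move=> eps0 v; have [r r0 Hr] := diff_remainder fx eps0.
  have [->|v0] := eqVneq v 0; first by rewrite dot0r normr0 mulr0.
  have nv : 0 < `|v| by rewrite normr_gt0.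
  pose s := Num.min r r1 / 2 / `|v|.
  have m0 : 0 < Num.min r r1 by rewrite lt_min r0.
  have s0 : 0 < s by rewrite !divr_gt0.
  have sv : `|s *: v| < Num.min r r1.
    by rewrite normrZ gtr0_norm// divfK ?gt_eqF// ltr_pdivrMr// mulr2n mulrDr mulr1 ltrDl.
  have E : x + s *: v - x = s *: v by rewrite addrC addrA addNr add0r.
  have := Hr (x + s *: v); rewrite E => /(_ (lt_le_trans sv _)); rewrite ge_min lexx => /(_ isT).
  rewrite diff_grad// dotZr normrZ (gtr0_norm s0).
  have := sx (x + s *: v).
  have Dxs : D (x + s *: v) by apply: Dr1; rewrite E (lt_le_trans sv)// ge_min lexx orbT.
  rewrite -(fineK (pD _ Dx)) -(fineK (pD _ Dxs)) lee_fin E dotZr dotBl.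
  rewrite ler_norml => h1 /andP[_ h2].
  rewrite -(ler_pM2l s0) mulrBr [s * (eps * _)]mulrCA.
  have {}h2 : (fine (p (x + s *: v)) : R) - fine (p x) - s * dot (grad f x) v <= eps * (s * `|v|).
    exact: h2.
  lra.
apply: dot_inj => v; rewrite ![dot v _]dotC; apply/eqP; rewrite -subr_eq0 -dotBl.
have le0 w : dot (xi - grad f x) w <= 0.
  apply/ler_addgt0Pl => eps eps0; rewrite addr0.
  have e1 : 0 < eps / (`|w| + 1) by rewrite divr_gt0// ltr_wpDl.
  apply: le_trans (near_le _ e1 w) _.
  rewrite mulrAC ler_pdivrMr ?ltr_wpDl// ler_pM2l// lerDl//.
by apply/eqP/le_anti; rewrite le0 -oppr_le0 -dotNr le0.
Qed.

End Taylor.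

(** * Multipliers and local quadratic growth *)

Lemma cvg_proj (U V : topologicalType) T (G : set_system T) (f : T -> U * V) (p : U * V) :
  f @ G --> p ->
  (fun k => (f k).1) @ G --> p.1 /\ (fun k => (f k).2) @ G --> p.2.
Proof.
by move=> fp; split; apply: (cvg_comp _ _ fp) => W Wp;
  [exact: (@cvg_fst _ _ _ _ _ W Wp)|exact: (@cvg_snd _ _ _ _ _ W Wp)].
Qed.

Section QuadraticGrowth.
Context {R : realType} {d e : nat} {X : euclidType R}.
Variables (C : X) (b : 'cV[R]_e).
Variables (F : {linear X -> 'cV[R]_d}) (Fadj : {linear 'cV[R]_d -> X}).
Variables (A : {linear X -> 'cV[R]_e}) (Aadj : {linear 'cV[R]_e -> X}).
Variables (h : 'cV[R]_d -> \bar R) (theta : X -> \bar R) (Q : set 'cV[R]_e).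
Let dual := ('cV[R]_e * 'cV[R]_d * X)%type.
Let Psi := dual_obj b h theta Q.
Hypotheses (adjF : is_adjoint F Fadj) (adjA : is_adjoint A Aadj).
Hypotheses (proper_h : proper_fun h) (proper_theta : proper_fun theta).
Implicit Types Z H : dual.

Lemma dual_obj_fin Z : (Psi Z < +oo)%E ->
  dual_cone Q Z.1.1 /\ exists a c, [/\ conjugate h (- Z.1.2) = a%:E,
    conjugate theta (- Z.2) = c%:E & Psi Z = (- dot b Z.1.1 + a + c)%:E].
Proof.
rewrite /Psi /dual_obj /indicator; case: ifPn => [/set_mem Qy|_].
  have := conjugate_gtNy (- Z.2) proper_theta; have := conjugate_gtNy (- Z.1.2) proper_h.
  case: (conjugate h _) => [a| |]//; case: (conjugate theta _) => [c| |]// _ _ _.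
  by split => //; exists a, c; rewrite sub0e.
have := conjugate_gtNy (- Z.2) proper_theta; have := conjugate_gtNy (- Z.1.2) proper_h.
by case: (conjugate h _) => [a| |]//; case: (conjugate theta _) => [c| |].
Qed.

Lemma dual_obj_finE Z a c : dual_cone Q Z.1.1 -> conjugate h (- Z.1.2) = a%:E ->
  conjugate theta (- Z.2) = c%:E -> Psi Z = (- dot b Z.1.1 + a + c)%:E.
Proof.
by move=> Qy ha tc; rewrite /Psi /dual_obj /indicator mem_set// ha tc sub0e.
Qed.

Lemma conjugate_subdiff_fin (V : euclidType R) (p : V -> \bar R) u v x (a a' : R) :
  p u = a%:E -> p v = a'%:E -> subdiff p u x -> 0 <= a' - a - dot x (v - u).
Proof. by move=> pu pv /(_ v); rewrite pu pv lee_fin; lra. Qed.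

Variables (Zb : dual) (ab cb : R).
Hypotheses (Qb : dual_cone Q Zb.1.1) (hb : conjugate h (- Zb.1.2) = ab%:E).
Hypotheses (tb : conjugate theta (- Zb.2) = cb%:E) (Cb : dual_constraint C Fadj Aadj Zb).
Let mult := multipliers C b F Fadj A Aadj h theta Q Zb.

(** Feasibility of [Z] and [Zb] makes the linear terms cancel, through the
    adjoints; what remains of the difference of objective values splits into
    three terms that the multiplier conditions make nonnegative. *)
Lemma kkt_gaps x Z a c : mult x -> dual_constraint C Fadj Aadj Z -> dual_cone Q Z.1.1 ->
  conjugate h (- Z.1.2) = a%:E -> conjugate theta (- Z.2) = c%:E ->
  [/\ 0 <= dot (A x - b) (Z.1.1 - Zb.1.1),
      0 <= a - ab + dot (F x) (Z.1.2 - Zb.1.2),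
      0 <= c - cb + dot x (Z.2 - Zb.2)
    & dot (A x - b) (Z.1.1 - Zb.1.1) + (a - ab + dot (F x) (Z.1.2 - Zb.1.2))
        + (c - cb + dot x (Z.2 - Zb.2))
      = (- dot b Z.1.1 + a + c) - (- dot b Zb.1.1 + ab + cb)].
Proof.
move=> [[_ nx] sx tx _] CZ QZ ha tc; split.
- by have := nx _ QZ; rewrite -opprB dotNl oppr_le0.
- by have := conjugate_subdiff_fin hb ha sx; rewrite -opprD dotNr opprK.
- by have := conjugate_subdiff_fin tb tc tx; rewrite -opprD dotNr opprK.
have : dot x (Aadj (Z.1.1 - Zb.1.1) + Fadj (Z.1.2 - Zb.1.2) + (Z.2 - Zb.2)) = 0.
  have -> : Aadj (Z.1.1 - Zb.1.1) + Fadj (Z.1.2 - Zb.1.2) + (Z.2 - Zb.2)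
      = (Aadj Z.1.1 + Fadj Z.1.2 + Z.2) - (Aadj Zb.1.1 + Fadj Zb.1.2 + Zb.2).
    by rewrite !linearB !opprD [RHS]addrACA [X in _ = X + _]addrACA.
  by rewrite CZ Cb subrr dot0r.
rewrite !dotDr -adjA -adjF !dotDr !dotDl !dotNr !dotNl; lra.
Qed.

Let fh : 'cV[R]_d -> R^o := fine \o conjugate h.
Hypothesis C2h : C2_on (effdom (conjugate h)) fh.

Lemma multiplier_grad x : mult x -> F x = grad fh (- Zb.1.2).
Proof.
move=> [_ sx _ _]; have [C1 _] := C2h.
apply: (subdiff_grad C1 _ _ sx) => [|z].
  by rewrite /effdom /= hb ltry.
rewrite /effdom /= => zoo; rewrite fin_numE (conjugate_gtNy _ proper_h)/=.
by rewrite lt_eqF.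
Qed.

(** The data of a failure of quadratic growth: feasible points approaching [Zb]
    along convergent directions, with an objective gap of order [o(t k ^+ 2)]. *)
Section BadSequence.
Variables (G : set_system nat) (t r : nat -> R) (H_ : nat -> dual) (H : dual).
Variables (a_ c_ : nat -> R).
Hypotheses (GU : UltraFilter G) (t_gt0 : forall k, 0 < t k) (t_cvg : t @ G --> (0 : R)).
Hypotheses (r_cvg : r @ G --> (0 : R)) (H_cvg : H_ @ G --> H).
Hypothesis ZC : forall k, dual_constraint C Fadj Aadj (Zb + t k *: H_ k).
Hypothesis ZQ : forall k, dual_cone Q (Zb + t k *: H_ k).1.1.
Hypothesis Zh : forall k, conjugate h (- (Zb + t k *: H_ k).1.2) = (a_ k)%:E.
Hypothesis Zt : forall k, conjugate theta (- (Zb + t k *: H_ k).2) = (c_ k)%:E.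
Hypothesis gap_le : forall k,
  (- dot b (Zb + t k *: H_ k).1.1 + a_ k + c_ k) - (- dot b Zb.1.1 + ab + cb)
  <= t k ^+ 2 * r k.

Let GP : ProperFilter G. Proof. exact: ultra_proper. Qed.

Lemma sequence_gaps x k : mult x ->
  [/\ 0 <= t k * dot (A x - b) (H_ k).1.1,
      0 <= a_ k - ab + t k * dot (F x) (H_ k).1.2,
      0 <= c_ k - cb + t k * dot x (H_ k).2
    & t k * dot (A x - b) (H_ k).1.1 + (a_ k - ab + t k * dot (F x) (H_ k).1.2)
        + (c_ k - cb + t k * dot x (H_ k).2) <= t k ^+ 2 * r k].
Proof.
move=> mx; have := kkt_gaps mx (ZC k) (ZQ k) (Zh k) (Zt k).
have -> : (Zb + t k *: H_ k).1.1 - Zb.1.1 = t k *: (H_ k).1.1 by rewrite /= addrAC subrr add0r.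
have -> : (Zb + t k *: H_ k).1.2 - Zb.1.2 = t k *: (H_ k).1.2 by rewrite /= addrAC subrr add0r.
have -> : (Zb + t k *: H_ k).2 - Zb.2 = t k *: (H_ k).2 by rewrite /= addrAC subrr add0r.
by rewrite !dotZr => -[g1 g2 g3 g4]; split => //; rewrite g4; exact: gap_le.
Qed.

Let Hy_cvg : (fun k => (H_ k).1.1) @ G --> H.1.1.
Proof. by have [/cvg_proj[]] := cvg_proj H_cvg. Qed.
Let Hw_cvg : (fun k => (H_ k).1.2) @ G --> H.1.2.
Proof. by have [/cvg_proj[]] := cvg_proj H_cvg. Qed.
Let HS_cvg : (fun k => (H_ k).2) @ G --> H.2.
Proof. by have [] := cvg_proj H_cvg. Qed.

Let small (eps : R) : 0 < eps -> \forall k \near G, t k <= 1 /\ r k <= eps.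
Proof.
move=> eps0; near=> k; split; apply: ltW; near: k.
  by apply: (cvgr_lt _ t_cvg).
by apply: (cvgr_lt _ r_cvg).
Unshelve. all: by end_near. Qed.

(** The other two gaps are nonnegative, so this one is below the total. *)
Lemma theta_gap_small x (eps : R) : mult x -> 0 < eps -> \forall k \near G,
  c_ k - cb - t k * dot x (- (H_ k).2) <= eps * t k.
Proof.
move=> mx eps0; apply: filterS (small eps0) => k [t1 rk].
have [g1 g2 g3 g4] := sequence_gaps k mx; have tk := t_gt0 k.
rewrite dotNr mulrN opprK.
have : t k ^+ 2 * r k <= eps * t k.
  by rewrite expr2 -mulrA mulrC ler_pM2r// -[leRHS]mul1r (le_trans (ler_wpM2l (ltW tk) rk))// ler_pM2r.
lra.
Qed.

Lemma theta_epideriv x : mult x ->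
  epideriv (conjugate theta) (- Zb.2) (- H.2) = (dot x (- H.2))%:E.
Proof.
move=> mx; have [_ _ sx _] := mx.
apply: (@epideriv_subdiff _ _ G _ t t_gt0 t_cvg _ _ _ _ (fun k => - (H_ k).2) cb c_) => //.
- exact: cvgN.
- by apply: nearW => k; rewrite -Zt scalerN -opprD.
- by move=> eps eps0; exact: theta_gap_small.
Qed.

(** Each of the three gaps is [o(t k)].  In the limit the complementarity gap
    says that [A x - b] is orthogonal to [H.1.1]; given the linear constraint on
    [H] this is the criticality equation, for [F x] is the gradient and the
    epiderivative is [<x, - H.2>]. *)
Lemma limit_critical x : mult x ->
  critical_cone b Fadj Aadj h theta Q Zb H.
Proof.
move=> mx; have lin0 : Aadj H.1.1 + Fadj H.1.2 + H.2 = 0.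
  have L : (fun k => Aadj (H_ k).1.1 + Fadj (H_ k).1.2 + (H_ k).2) @ G
      --> Aadj H.1.1 + Fadj H.1.2 + H.2.
    by apply: cvgD => //; apply: cvgD; exact: linear_cvg.
  apply: (cvg_limit_unique L).
  rewrite (_ : (fun k => _) = cst 0); first exact: cvg_cst.
  apply/funext => k /=.
  have E : Aadj Zb.1.1 + Fadj Zb.1.2 + Zb.2 +
      t k *: (Aadj (H_ k).1.1 + Fadj (H_ k).1.2 + (H_ k).2) = C.
    by rewrite !scalerDr [LHS]addrACA [X in X + _ = _]addrACA -!linearZ -!linearD; exact: ZC.
  move: E; rewrite [X in X + _]Cb => /eqP; rewrite -subr_eq0 addrAC subrr add0r scaler_eq0.
  by rewrite gt_eqF// => /eqP.
have comp0 : dot (A x - b) H.1.1 = 0.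
  have L : (fun k => dot (A x - b) (H_ k).1.1) @ G --> dot (A x - b) H.1.1.
    by apply: cvg_dot => //; exact: cvg_cst.
  apply: (cvg_limit_unique L); apply: (@cvg_le_norm _ R^o _ _ _ _ _ (fun k => t k * r k)); last first.
    by rewrite -(mul0r (0 : R)); exact: cvgM.
  apply: nearW => k; rewrite subr0; have [g1 g2 g3 g4] := sequence_gaps k mx.
  have tk := t_gt0 k; rewrite ger0_norm; last by move: g1; rewrite pmulr_rge0.
  by rewrite -(ler_pM2l tk) mulrA -expr2; lra.
split => //.
- apply: (@tangent_cone_limit _ _ G _ t t_gt0 t_cvg _ _ _ (fun k => (Zb + t k *: H_ k).1.1)).
    exact: ZQ.
  rewrite (_ : (fun k => _) = (fun k => (H_ k).1.1))//.
  apply/funext => k /=; rewrite [Zb.1.1 + _]addrC addrK scalerA mulVf ?gt_eqF//.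
  by rewrite scale1r.
- apply: (@tangent_cone_limit _ _ G _ t t_gt0 t_cvg _ _ _ (fun k => - (Zb + t k *: H_ k).2)).
    by move=> k; rewrite /effdom /= Zt ltry.
  rewrite (_ : (fun k => _) = (fun k => - (H_ k).2)); first exact: cvgN.
  apply/funext => k /=; rewrite -opprD [Zb.2 + _]addrC addrK scalerN scalerA mulVf ?gt_eqF//.
  by rewrite scale1r.
rewrite (theta_epideriv mx) -(multiplier_grad mx) -EFinB -EFinD; congr EFin.
have := congr1 (dot x) lin0; rewrite !dotDr dot0r -adjA -adjF.
move: comp0; rewrite dotBl dotNl dotNr; lra.
Qed.

Let q := dot H.1.2 (hess fh (- Zb.1.2) *m H.1.2).

(** Taylor expansion of the conjugate of [h], whose gradient at [- Zb.1.2] is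
    [F x]. *)
Lemma h_gap_lower x (eps : R) : mult x -> 0 < eps -> \forall k \near G,
  t k ^+ 2 * (q / 2 - eps) <= a_ k - ab + t k * dot (F x) (H_ k).1.2.
Proof.
move=> mx eps0; set B := hess fh (- Zb.1.2).
pose M := `|H.1.2| + 1; have M0 : 0 < M by rewrite ltr_wpDl.
have e1 : 0 < eps / 2 / M ^+ 2 by rewrite !divr_gt0// exprn_gt0.
have hD : effdom (conjugate h) (- Zb.1.2) by rewrite /effdom /= hb ltry.
have [r0 r00 Hr] := C2_taylor C2h hD e1.
have q_cvg : (fun k => dot (H_ k).1.2 (B *m (H_ k).1.2)) @ G --> q.
  by apply: cvg_dot => //; apply: (@linear_cvg _ _ _ (mulmx B)).
near=> k; have tk := t_gt0 k.
have wM : `|(H_ k).1.2| <= M.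
  by apply: ltW; near: k; apply: (cvgr_lt _ (cvg_norm Hw_cvg)); rewrite ltrDl.
have tM : t k * M < r0.
  by rewrite -ltr_pdivlMr//; near: k; apply: (cvgr_lt _ t_cvg); exact: divr_gt0.
have qk : q - eps <= dot (H_ k).1.2 (B *m (H_ k).1.2).
  by apply: ltW; near: k; apply: (cvgr_gt _ q_cvg); rewrite ltrBlDr ltrDl.
pose v := - (t k *: (H_ k).1.2).
have nv : `|v| <= t k * M by rewrite normrN normrZ gtr0_norm// ler_pM2l.
have := Hr v (le_lt_trans nv tM).
have -> : fh (- Zb.1.2 + v) = a_ k by rewrite /v -opprD /fh /= (Zh k).
have -> : fh (- Zb.1.2) = ab by rewrite /fh /= hb.
rewrite -(multiplier_grad mx) -/B mulmxN !dotNr -scalemxAr dotNl dotZl !dotZr opprK opprK.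
rewrite ler_norml => /andP[+ _].
have : `|v| ^+ 2 <= (t k * M) ^+ 2 by rewrite lerXn2r ?nnegrE// mulr_ge0// ltW.
rewrite -(ler_pM2l e1).
have -> : eps / 2 / M ^+ 2 * (t k * M) ^+ 2 = t k ^+ 2 * (eps / 2).
  by field; rewrite gt_eqF.
move=> h1 h2.
have {}h2 : - (eps / 2 / M ^+ 2 * `|v| ^+ 2) <= (a_ k : R) - ab + t k * dot (F x) (H_ k).1.2
    - t k * (t k * dot (H_ k).1.2 (B *m (H_ k).1.2)) / 2 by exact: h2.
have t2 : 0 < t k ^+ 2 by rewrite exprn_gt0.
move: qk; rewrite -(ler_pM2l t2) expr2; move: h1; rewrite expr2; lra.
Unshelve. all: by end_near. Qed.

Hypothesis theta_regular : outer_regular (conjugate theta) (- Zb.2).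

(** The limit [w] of the second-order parts given by outer regularity is a point
    at which the second epiderivative is at most [<x, w> - q]. *)
Lemma limit_second_order x : mult x ->
  (q%:E - conjugate (epideriv2 (conjugate theta) (- Zb.2)%R (- H.2)%R) x <= 0)%E.
Proof.
move=> mx; have [_ _ sx _] := mx.
have HSN : (fun k => - (H_ k).2) @ G --> - H.2 by exact: cvgN.
have Tk : \forall k \near G, conjugate theta (- Zb.2 + t k *: - (H_ k).2) = (c_ k)%:E.
  by apply: nearW => k; rewrite -Zt scalerN -opprD.
have [|w_ [w [w_cvg wP]]] := theta_regular sx GU t_gt0 t_cvg HSN Tk.
  by move=> eps eps0; rewrite tb; exact: theta_gap_small.
have w_le : (epideriv2 (conjugate theta) (- Zb.2)%R (- H.2)%R w <= (dot x w - q)%:E)%E.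
  apply: (epideriv2_le t_gt0 t_cvg tb (theta_epideriv mx) w_cvg) => eps eps0.
  have e7 : 0 < eps / 7 by rewrite divr_gt0.
  have xw_cvg : (fun k => dot x (w_ k)) @ G --> dot x w by apply: cvg_dot => //; exact: cvg_cst.
  near=> k; have tk := t_gt0 k; have t2 : 0 < t k ^+ 2 by rewrite exprn_gt0.
  have : (conjugate theta (- Zb.2 + t k *: - H.2 + (t k ^+ 2 / 2) *: w_ k)%R <=
    (c_ k + dot x (t k *: - H.2 + (t k ^+ 2 / 2) *: w_ k - t k *: - (H_ k).2)%R
      + eps / 7 * t k ^+ 2)%:E)%E by near: k; exact: wP.
  move/le_trans; apply; rewrite lee_fin.
  have hk : t k ^+ 2 * (q / 2 - eps / 7) <= a_ k - ab + t k * dot (F x) (H_ k).1.2.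
    by near: k; exact: h_gap_lower.
  have [_ rk] : t k <= 1 /\ r k <= eps / 7 by near: k; exact: small.
  have xwk : dot x (w_ k) <= dot x w + eps / 7.
    by apply: ltW; near: k; apply: (cvgr_lt _ xw_cvg); rewrite ltrDl.
  have [g1 _ _ g4] := sequence_gaps k mx.
  rewrite -(ler_pM2l t2) in rk; rewrite -(ler_pM2l t2) in xwk.
  rewrite !(dotDr, dotZr, dotNr); lra.
rewrite sube_le0; apply: (@le_trans _ _ ((dot w x)%:E - (dot x w - q)%:E)%E).
  by rewrite -EFinB lee_fin dotC; lra.
apply: (@le_trans _ _ ((dot w x)%:E - epideriv2 (conjugate theta) (- Zb.2)%R (- H.2)%R w)%E).
  exact: leeB.
by apply: ereal_sup_ubound; exists w.
Unshelve. all: by end_near. Qed.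
End BadSequence.
(** A failure for all constants [1 / k.+1] produces a bad sequence, whose limit
    direction contradicts the second-order condition. *)
Lemma local_growth : mult !=set0 -> outer_regular (conjugate theta) (- Zb.2) ->
  no_gap_sosc C b F Fadj A Aadj h theta Q Zb ->
  exists delta kappa : R, [/\ 0 < delta, 0 < kappa &
    forall Z, dual_constraint C Fadj Aadj Z -> enorm (Z - Zb) <= delta ->
      (Psi Zb + (kappa * enorm (Z - Zb) ^+ 2)%:E <= Psi Z)%E].
Proof.
move=> [x0 mx0] reg sosc; apply: contrapT => NG.
have /choice[Z_ HZ] : forall k : nat, exists Z, [/\ dual_constraint C Fadj Aadj Z,
    enorm (Z - Zb) <= harmonic k
    & (Psi Z < Psi Zb + (harmonic k * enorm (Z - Zb) ^+ 2)%:E)%E].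
  move=> k; apply: contrapT => NB; apply: NG; exists (harmonic k), (harmonic k).
  split; [exact: harmonic_gt0|exact: harmonic_gt0|move=> Z CZ Zk].
  by rewrite leNgt; apply/negP => lt; apply: NB; exists Z.
have PsiZb := dual_obj_finE Qb hb tb.
have Zfin k : (Psi (Z_ k) < +oo)%E.
  by have [_ _ lt] := HZ k; apply: (lt_trans lt); rewrite PsiZb -EFinD ltry.
have /choice[a_ /choice[c_ HF]] : forall k, exists a c, [/\ dual_cone Q (Z_ k).1.1,
    conjugate h (- (Z_ k).1.2) = a%:E, conjugate theta (- (Z_ k).2) = c%:E
    & Psi (Z_ k) = (- dot b (Z_ k).1.1 + a + c)%:E].
  by move=> k; have [Qk [a [c [ha tc Pk]]]] := dual_obj_fin (Zfin k); exists a, c.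
pose t k := enorm (Z_ k - Zb).
have t_gt0 k : 0 < t k.
  apply: enorm_gt0; rewrite subr_eq0; apply/eqP => ZZ.
  have [_ _] := HZ k; rewrite ZZ subrr /enorm dot0l sqrtr0 expr0n mulr0 adde0.
  by rewrite ltxx.
pose H_ k := (t k)^-1 *: (Z_ k - Zb).
have ZE k : Zb + t k *: H_ k = Z_ k.
  by rewrite /H_ scalerA mulfV ?gt_eqF// scale1r addrC subrK.
have HH k : dot (H_ k) (H_ k) = 1.
  rewrite /H_ dotZl dotZr mulrA -expr2 -enorm_sqr -/(t k) -exprMn.
  by rewrite mulVf ?gt_eqF// expr1n.
have [G [GU sG]] := ultraFilterLemma (eventually_filter : ProperFilter \oo).
have GP : ProperFilter G by exact: ultra_proper.
have [c1 c10 Hc1] := @norm_dot_bound R dual.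
have [H H_cvg] : exists H : dual, H_ @ G --> H.
  apply: (ultra_cvg_bounded (M := c1 + 1)) => //; apply: nearW => k.
  have := Hc1 (H_ k); rewrite HH mulr1 => hk.
  rewrite -(@ler_pXn2r _ 2)// ?nnegrE ?addr_ge0 ?(ltW c10)//.
  apply: le_trans hk _; rewrite sqrrD mulr1 expr1n mulr2n.
  by have := sqr_ge0 c1; lra.
have HH1 : dot H H = 1.
  have L : (fun k => dot (H_ k) (H_ k)) @ G --> dot H H by exact: cvg_dot.
  apply: (@cvg_limit_unique _ _ GU R^o _ _ _ L).
  by rewrite (_ : (fun k => _) = cst 1); [exact: cvg_cst|apply/funext].
have H0 : H != 0 by apply/eqP => H0; move: HH1; rewrite H0 dot0l; lra.
have r_cvg : (harmonic : nat -> R) @ G --> (0 : R) by move=> W W0; apply: sG; exact: cvg_harmonic.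
have t_cvg : t @ G --> (0 : R).
  apply: (@cvg_le_norm _ R^o _ _ _ _ _ harmonic) => //; apply: nearW => k.
  by rewrite subr0 gtr0_norm//; have [] := HZ k.
have ZC k : dual_constraint C Fadj Aadj (Zb + t k *: H_ k) by rewrite ZE; have [] := HZ k.
have ZQ k : dual_cone Q (Zb + t k *: H_ k).1.1 by rewrite ZE; have [] := HF k.
have Zh k : conjugate h (- (Zb + t k *: H_ k).1.2) = (a_ k)%:E by rewrite ZE; have [] := HF k.
have Zt k : conjugate theta (- (Zb + t k *: H_ k).2) = (c_ k)%:E by rewrite ZE; have [] := HF k.
have gap k : (- dot b (Zb + t k *: H_ k).1.1 + a_ k + c_ k) - (- dot b Zb.1.1 + ab + cb)
    <= t k ^+ 2 * harmonic k.
  have [_ _ lt] := HZ k; have [_ _ _ Pk] := HF k.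
  rewrite ZE lerBlDl mulrC; apply: ltW.
  by move: lt; rewrite PsiZb Pk -EFinD lte_fin.
have crit := limit_critical GU t_gt0 t_cvg r_cvg H_cvg ZC ZQ Zh Zt gap mx0.
have [_ [x mx <-]] := ereal_sup_gt (sosc _ crit H0).
rewrite ltNge => /negP; apply.
exact: (limit_second_order GU t_gt0 t_cvg r_cvg H_cvg ZC ZQ Zh Zt gap reg mx).
Qed.

End QuadraticGrowth.

(** * Convexity, uniqueness and the main result *)

Lemma conjugate_convex (R : realType) (V : euclidType R) (p : V -> \bar R) u v (a b s : R) :
  0 <= s -> s <= 1 -> conjugate p u = a%:E -> conjugate p v = b%:E ->
  (conjugate p (u + s *: (v - u))%R <= (a + s * (b - a))%:E)%E.
Proof.
move=> s0 s1 pu pv; apply: ge_ereal_sup => _ [w _ <-].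
have : ((dot w u)%:E - p w <= a%:E)%E by rewrite -pu; apply: ereal_sup_ubound; exists w.
have : ((dot w v)%:E - p w <= b%:E)%E by rewrite -pv; apply: ereal_sup_ubound; exists w.
case: (p w) => [r| |] /=; [|by rewrite !leNye|by rewrite !leye_eq].
rewrite !lee_fin dotDr dotZr dotBr => h1 h2.
have := ler_wpM2l s0 h1; have s2 : 0 <= 1 - s by rewrite subr_ge0.
have := ler_wpM2l s2 h2; lra.
Qed.

Lemma dist_to_singleton (R : realType) (V : euclidType R) (x u : V) :
  dist_to x [set u] = enorm (x - u).
Proof. by rewrite /dist_to image_set1 inf1. Qed.

Section Uniqueness.
Context {R : realType} {d e : nat} {X : euclidType R}.
Variables (C : X) (b : 'cV[R]_e) (Fadj : {linear 'cV[R]_d -> X}).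
Variables (Aadj : {linear 'cV[R]_e -> X}).
Variables (h : 'cV[R]_d -> \bar R) (theta : X -> \bar R) (Q : set 'cV[R]_e).
Let dual := ('cV[R]_e * 'cV[R]_d * X)%type.
Let Psi := dual_obj b h theta Q.
Hypotheses (proper_h : proper_fun h) (proper_theta : proper_fun theta).

Lemma dual_obj_convex (Z Z' : dual) (p p' s : R) : 0 <= s -> s <= 1 ->
  Psi Z = p%:E -> Psi Z' = p'%:E ->
  (Psi (Z + s *: (Z' - Z))%R <= (p + s * (p' - p))%:E)%E.
Proof.
move=> s0 s1 PZ PZ'.
have [|Qy [a [c [ha tc E]]]] := @dual_obj_fin _ _ _ _ b _ _ Q proper_h proper_theta Z.
  by rewrite -/Psi PZ ltry.
have [|Qy' [a' [c' [ha' tc' E']]]] := @dual_obj_fin _ _ _ _ b _ _ Q proper_h proper_theta Z'.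
  by rewrite -/Psi PZ' ltry.
move: E E'; rewrite -/Psi PZ PZ' => -[->] [->].
have Qs : dual_cone Q (Z + s *: (Z' - Z)).1.1.
  move=> z Qz; rewrite /= dotDl dotZl dotBl.
  have z1 := Qy z Qz; have z2 := Qy' z Qz; have s2 : 0 <= 1 - s by rewrite subr_ge0.
  have := mulr_ge0 s0 z2; have := mulr_ge0 s2 z1; lra.
rewrite /Psi /dual_obj /indicator mem_set// sub0e.
have hs := conjugate_convex s0 s1 ha ha'.
have ts := conjugate_convex s0 s1 tc tc'.
have Eh : - (Z + s *: (Z' - Z)).1.2 = - Z.1.2 + s *: (- Z'.1.2 - - Z.1.2).
  by rewrite /= opprD -scalerN opprD.
have Et : - (Z + s *: (Z' - Z)).2 = - Z.2 + s *: (- Z'.2 - - Z.2).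
  by rewrite /= opprD -scalerN opprD.
rewrite Eh Et; apply: (le_trans (leeD (leeD (lexx _) hs) ts)).
rewrite -EFinN -!EFinD lee_fin /= dotDr dotZr dotBr; lra.
Qed.

(** Along the segment to another solution the objective cannot exceed the optimal
    value, whereas it grows near [Z]. *)
Lemma growth_unique (Z Z' : dual) (delta kappa : R) : 0 < delta -> 0 < kappa ->
  (forall U, dual_constraint C Fadj Aadj U -> enorm (U - Z) <= delta ->
     (Psi Z + (kappa * enorm (U - Z) ^+ 2)%:E <= Psi U)%E) ->
  dual_solutions C b Fadj Aadj h theta Q Z ->
  dual_solutions C b Fadj Aadj h theta Q Z' -> Z' = Z.
Proof.
move=> delta0 kappa0 growth [CZ Zoo Zmin] [CZ' Zoo' Zmin'].
have PE : Psi Z' = Psi Z by apply/le_anti; rewrite Zmin// Zmin'.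
have [Qy [a [c [_ _ PZ]]]] := @dual_obj_fin _ _ _ _ b _ _ Q proper_h proper_theta Z Zoo.
set p := _ + c in PZ.
apply/eqP; rewrite -subr_eq0; apply: contraT => D0.
have N0 := enorm_gt0 D0; set N := enorm (Z' - Z) in N0.
pose s := Num.min 1 (delta / N).
have s0 : 0 < s by rewrite lt_min ltr01 divr_gt0.
have s1 : s <= 1 by rewrite ge_min lexx.
pose U := Z + s *: (Z' - Z).
have UZ : enorm (U - Z) = s * N by rewrite /U addrAC subrr add0r enormZ gtr0_norm.
have Ud : enorm (U - Z) <= delta by rewrite UZ -ler_pdivlMr// ge_min lexx orbT.
have CU : dual_constraint C Fadj Aadj U.
  have E : Aadj U.1.1 + Fadj U.1.2 + U.2 = (Aadj Z.1.1 + Fadj Z.1.2 + Z.2)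
      + s *: ((Aadj Z'.1.1 + Fadj Z'.1.2 + Z'.2) - (Aadj Z.1.1 + Fadj Z.1.2 + Z.2)).
    rewrite /U /= linearD [Fadj (_ + _)]linearD linearZ [Fadj (_ *: _)]linearZ.
    rewrite linearB [Fadj (_ - _)]linearB /= [X in X + _ = _]addrACA [LHS]addrACA -!scalerDr.
    congr (_ + _ *: _).
    by rewrite !opprD [RHS]addrACA [X in _ = X + _]addrACA.
  by rewrite /dual_constraint /= E CZ CZ' subrr scaler0 addr0.
have := growth U CU Ud; rewrite UZ.
have PZ' : Psi Z' = p%:E by rewrite PE.
move/le_trans => /(_ _ (dual_obj_convex (ltW s0) s1 PZ PZ')).
rewrite subrr mulr0 addr0 /Psi PZ -EFinD lee_fin gerDl leNgt.
by rewrite mulr_gt0// exprn_gt0// mulr_gt0.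
Qed.

End Uniqueness.

Theorem theorem13 (R : realType) (n d e : nat) (X : euclidType R)
  (spec : X -> 'cV[R]_n) (symmetry : ('cV[R]_n -> \bar R) -> Prop)
  (C : X) (b : 'cV[R]_e)
  (F : {linear X -> 'cV[R]_d}) (Fadj : {linear 'cV[R]_d -> X})
  (A : {linear X -> 'cV[R]_e}) (Aadj : {linear 'cV[R]_e -> X})
  (h : 'cV[R]_d -> \bar R) (theta : X -> \bar R) (g : 'cV[R]_n -> \bar R)
  (Q : set 'cV[R]_e)
  (ybar : 'cV[R]_e) (wbar : 'cV[R]_d) (Sbar : X) :
  let Zbar := (ybar, wbar, Sbar) in
  let Psi := dual_obj b h theta Q in
  let OmegaP := primal_solutions C b F A h theta Q in
  let OmegaD := dual_solutions C b Fadj Aadj h theta Q in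
  let FD := dual_feasible C Fadj Aadj Q in
  is_adjoint F Fadj -> is_adjoint A Aadj ->
  proper_fun h -> convex_fun h -> C1_on (effdom h) (fine \o h : 'cV[R]_d -> R^o) ->
  proper_fun theta -> closed_fun theta -> convex_fun theta ->
  polyhedral_cone Q ->
  OmegaP !=set0 -> OmegaD !=set0 ->
  spectral_setting spec symmetry ->
  proper_fun g -> closed_fun g -> convex_fun g -> symmetry g ->
  theta = g \o spec ->
  OmegaD Zbar ->
  multipliers C b F Fadj A Aadj h theta Q Zbar !=set0 ->
  C2_on (effdom (conjugate h)) (fine \o conjugate h : 'cV[R]_d -> R^o) ->
  fun_cone_reducible (conjugate g) (spec (- Sbar)) ->
  no_gap_sosc C b F Fadj A Aadj h theta Q Zbar ->
  OmegaD = [set Zbar] /\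
  exists delta kappa : R, [/\ 0 < delta, 0 < kappa
    & forall Z, FD Z -> closed_enorm_ball Zbar delta Z ->
      (Psi Z >= Psi Zbar + (kappa * dist_to Z OmegaD ^+ 2)%:E)%E].
Proof.
move=> Zbar Psi OmegaP OmegaD FD adjF adjA properh convh C1h propert closedt convt Qpoly
  OmegaP0 OmegaD0 setting properg closedg convg symg thetaE ZbarD mult0 C2h red sosc.
have [CZ Zoo _] := ZbarD.
have [Qy [a [c [ha tc _]]]] := dual_obj_fin properh propert Zoo.
have reg : outer_regular (conjugate theta) (- Zbar.2).
  by rewrite thetaE; exact: spectral_setting_regular setting properg symg red.
have [delta [kappa [delta0 kappa0 growth]]] :=
  local_growth adjF adjA properh propert Qy ha tc CZ C2h mult0 reg sosc.
have DE : OmegaD = [set Zbar].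
  apply/seteqP; split=> [Z ZD|_ -> //].
  exact: (growth_unique properh propert delta0 kappa0 growth ZbarD ZD).
split => //; exists delta, kappa; split => // Z [CZ' _] Zd.
by rewrite DE dist_to_singleton; exact: growth.
Qed.
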